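(* Let $X=\{X(t),\,t\ge 0\}$ be a one-dimensional symmetric $1$-stable process. Suppose that $f:\mathbb{R}\to\mathbb{R}$ is a bounded Borel function with $\int_{\mathbb{R}}|x f(x)|\,dx<\infty$ and $\int_{\mathbb{R}} f(x)\,dx=0$. Then, for any $t>0$, as $n\to\infty$, $$\frac{1}{\sqrt{n}}\int_0^{e^{nt}} f(X(s))\,ds \;\longrightarrow\; \Big(\frac{1}{\pi^2}\int_{\mathbb{R}}|\widehat{f}(x)|^2|x|^{-1}\,dx\Big)^{\frac12}\,\sqrt{Z(t)}\,\eta\quad\text{in law},$$ where $\widehat f$ is the Fourier transform of $f$, $Z(t)$ is an exponential random variable with parameter $t$ (i.e. with mean $t$), and $\eta$ is a standard normal random variable independent of $Z(t)$.
   Context: A symmetric $1$-stable process is a real-valued Lévy process (càdlàg paths, stationary independent increments, $X(0)=0$) with characteristic function $\mathbb{E}\,e^{i x X(t)}=e^{-t|x|}$ for all $t\ge 0$, $x\in\mathbb{R}$. The Fourier transform is $\widehat f(x)=\int_{\mathbb{R}} f(y)e^{-i x y}\,dy$. ''Exponential with parameter $t$'' is in the mean parametrization: $\mathbb{E}[Z(t)^m]=m!\,t^m$ for all $m\in\mathbb{N}$. *)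

(* Defs.v *)
From HB Require Import structures.
From mathcomp Require Import all_boot all_order all_algebra.
From mathcomp Require Import finmap.
From mathcomp Require Import all_classical all_reals all_analysis.
From mathcomp Require Export complex.

Set Implicit Arguments.
Unset Strict Implicit.
Unset Printing Implicit Defensive.

Import Order.TTheory GRing.Theory Num.Theory.
Import numFieldNormedType.Exports.

Local Open Scope classical_set_scope.
Local Open Scope ring_scope.
Local Open Scope complex_scope.

Definition expi {R : realType} (theta : R) : R[i] := cos theta +i* sin theta.

Definition Cintegral d (T : measurableType d) (R : realType)
    (mu : {measure set T -> \bar R}) (D : set T) (g : T -> R[i]) : R[i] :=
  Rintegral mu D (fun x => complex.Re (g x)) +i*
  Rintegral mu D (fun x => complex.Im (g x)).

Definition charfun d (T : measurableType d) (R : realType)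
    (P : probability T R) (Y : T -> R) (x : R) : R[i] :=
  Cintegral P setT (fun w => expi (x * Y w)).

Definition fourier {R : realType} (f : R -> R) (x : R) : R[i] :=
  Cintegral lebesgue_measure setT (fun y => (f y)%:C * expi (- (x * y))).

(* Only Borel sets are tested: the values of a measure on non-measurable sets
   are unspecified, so [distribution P Y = nu] would be too strong. *)
Definition has_law d (T : measurableType d) (R : realType)
    (P : probability T R) (Y : T -> R) (nu : set R -> \bar R) : Prop :=
  forall B : set R, measurable B -> P (Y @^-1` B) = nu B.

Definition independent_RVs d (T : measurableType d) (R : realType)
    (P : probability T R) (I : choiceType) (Y : I -> T -> R) : Prop :=
  forall (J : {fset I}) (B : I -> set R), (forall i, measurable (B i)) ->
    P (\bigcap_(i in [set` J]) (Y i @^-1` B i)) =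
    (\prod_(i <- J) P (Y i @^-1` B i))%E.

Definition independent_RVs2 d (T : measurableType d) (R : realType)
    (P : probability T R) (Y Z : T -> R) : Prop :=
  forall A B : set R, measurable A -> measurable B ->
    P (Y @^-1` A `&` Z @^-1` B) = (P (Y @^-1` A) * P (Z @^-1` B))%E.

(* Weak convergence of the laws; the variables may live on different
   probability spaces. Measurability is part of the claim, since the library's
   integral is total and means little on a non-measurable integrand. *)
Definition cvg_in_law d (T : measurableType d) d' (T' : measurableType d')
    (R : realType) (P : probability T R) (Y : nat -> T -> R)
    (Q : probability T' R) (Y' : T' -> R) : Prop :=
  [/\ forall n, measurable_fun [set: T] (Y n),
      measurable_fun [set: T'] Y'
    & forall g : R -> R, continuous g -> (exists M : R, forall x, `|g x| <= M) ->
        'E_P[g \o Y n]%E @[n --> \oo] --> 'E_Q[g \o Y']%E].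

Definition cadlag {R : realType} (x : R -> R) : Prop :=
  (forall t : R, 0 <= t -> x s @[s --> t^'+] --> x t) /\
  (forall t : R, 0 < t -> cvg (x s @[s --> t^'-])).

(* The time index ranges over all of [R], but only the values at nonnegative
   times are constrained or used. *)
Record levy_process d (T : measurableType d) (R : realType)
    (P : probability T R) (X : R -> {RV P >-> R}) : Prop := LevyProcess {
  levy_start : {ae P, forall w, X 0 w = 0} ;
  levy_cadlag : forall w, cadlag (fun s => X s w) ;
  levy_stationary : forall s h : R, 0 <= s -> 0 <= h ->
    has_law P (fun w => X (s + h) w - X s w) (distribution P (X h)) ;
  levy_independent : forall (n : nat) (s : nat -> R),
    0 <= s 0%N -> (forall i j, (i <= j)%N -> s i <= s j) ->
    independent_RVs P (fun (i : 'I_n) w => X (s i.+1) w - X (s i) w) }.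

Definition symmetric_1stable_process d (T : measurableType d) (R : realType)
    (P : probability T R) (X : R -> {RV P >-> R}) : Prop :=
  levy_process X /\
  forall t x : R, 0 <= t -> charfun P (X t) x = (expR (- (t * `|x|)))%:C.

(* Main.v *)
Require Import Defs.
From HB Require Import structures.
From mathcomp Require Import all_boot all_order all_algebra finmap.
From mathcomp Require Import all_classical all_reals all_analysis.
From mathcomp Require Import measurable_realfun complex ring lra.
Import Order.TTheory GRing.Theory Num.Theory.
Import numFieldNormedType.Exports.
Local Open Scope classical_set_scope.
Local Open Scope ring_scope.
Set Implicit Arguments.
Unset Strict Implicit.

(** Why the theorem holds.  Write [S = e^(nt)], [L = ln S = n t] and fix a
    frequency [y]; put [lam = y / sqrt n], so that [lam^2 L = y^2 t].  Let [c(x)]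
    and [s(x)] be the expectations of the cosine and of the sine of
    [lam * int_0^S f(x + X_u) du].

    Differentiating the cosine of the integral over [[r, S]] with respect to its
    starting time [r] gives, path by path, a Duhamel formula ([duhamel_gen]): the
    cosine of the full integral is 1 minus the integral over [r] of [lam f(x + X_r)]
    times the sine of the remaining integral.  In expectation the Markov property
    ([markov_sin], [markov_cos]) turns that last sine into the same functional [s]
    with horizon [S - r] at the point [x + X_r].  The law of [X_r] has the Cauchy
    density [p_r] of size [1/r], so replacing the horizon [S - r] by [S] costs only
    [O(lam^2)], uniformly in [S] and [x] ([expect_occ_horizon], [duhamel_expect]).
    What is left is a linear system,

      [c = 1 - lam G(f s) + O(lam^2)],  [s = lam G(f c) + O(lam^2)],

    where the kernel of [G] is [int_0^S p_r(z) dr = L / pi + k_S(z)], with [k_S]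
    bounded by a constant multiple of [|z|^(1/2) + |z|^(-1/2)], uniformly in [S]
    ([green_split], [reg_kernel_le]).

    The large constant [L / pi] makes [c] and [s] equal to constants [kc] and [ks]
    up to [O(lam (1 + |x|^(1/2)))].  Because [int f = 0], these constants vanish
    when the system is integrated against [f], which leaves
    [int f s = lam kc Gamma_S + O(lam^2)] and [int f c = - lam ks Gamma_S + O(lam^2)]
    with [Gamma_S] the energy of [f] for the kernel [k_S] ([second_order]).  Since
    [kc = 1 - lam (L / pi) int f s] and [ks = lam (L / pi) int f c], one gets
    [kc (1 + lam^2 (L / pi) Gamma_S) = 1 + O(lam)] and [ks = O(lam)]
    ([cos_estimate], [sin_estimate]).

    The energy is also the integral over the times [r] in [[0, S]] of the pairing
    of [f] with [p_r * f], which Fourier inversion of [p_r] turns into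
    [(1/(2 pi)) int e^(-r|xi|) |fhat(xi)|^2 dxi]; by monotone convergence [Gamma_S]
    tends to [(1/(2 pi)) int |fhat(xi)|^2 / |xi| dxi] ([energy_cvg]).  The
    characteristic functions therefore tend to [1 / (1 + y^2 t Gamma / pi)], which
    is the one of the announced mixture: given [Z] it is Gaussian, and the Laplace
    transform of the exponential law of mean [t] at [b] is [1 / (1 + b t)]
    ([mixture_cos]).  The convergence of characteristic functions gives
    the convergence in law by mollifying the test function with a Cauchy kernel
    ([levy_continuity]).

    Two facts on the process are used.  Right continuity makes [(s, w) |-> X_s(w)]
    jointly measurable ([measurable_joint]).  The Markov property for
    functionals of the path is obtained from finite-dimensional laws only:
    independence of increments determines all the mixed moments
    [E (h(X_s) f(X_(s+u_1)) ... f(X_(s+u_k)))], hence the moments of the integral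
    of [f] along the path, hence its bounded power series ([trig_occ]). *)

(** * Real-valued integrals: domination, Fubini, changes of variable *)

Section Rintegral_tools.
Context d (T : measurableType d) (R : realType) (mu : {measure set T -> \bar R}).

Lemma integrable_dom (D : set T) (f g : T -> R) : measurable D ->
  measurable_fun D f -> mu.-integrable D (EFin \o g) ->
  (forall x, D x -> `|f x| <= g x) -> mu.-integrable D (EFin \o f).
Proof.
move=> mD mf ig fg; apply: (le_integrable mD _ _ ig).
  exact/measurable_EFinP.
by move=> x Dx /=; rewrite lee_fin (le_trans (fg x Dx))// ler_norm.
Qed.

Lemma integrable_mull (D : set T) (k : R) (f : T -> R) : measurable D ->
  mu.-integrable D (EFin \o f) -> mu.-integrable D (EFin \o (fun x => k * f x)).
Proof.
by move=> mD fi; under [X in _.-integrable _ X]funext => x do rewrite /= EFinM; exact: integrableZl.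
Qed.

Lemma integrable_mulr (D : set T) (k : R) (f : T -> R) : measurable D ->
  mu.-integrable D (EFin \o f) -> mu.-integrable D (EFin \o (fun x => f x * k)).
Proof.
by move=> mD fi; under [X in _.-integrable _ X]funext => x do rewrite /= EFinM; exact: integrableZr.
Qed.

Lemma Rint_EFin (D : set T) (f : T -> R) : measurable D ->
  mu.-integrable D (EFin \o f) ->
  (\int[mu]_(x in D) f x)%:E = (\int[mu]_(x in D) (f x)%:E)%E.
Proof. by move=> mD fi; rewrite /Rintegral fineK//; exact: integrable_fin_num. Qed.

(** Dominated convergence in the real-valued form used throughout; the integrability of
    the limit is returned with it. *)
Lemma Rdct (D : set T) (F : nat -> T -> R) (f g : T -> R) : measurable D ->
  (forall n, measurable_fun D (F n)) ->
  (forall x, D x -> F n x @[n --> \oo] --> f x) ->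
  mu.-integrable D (EFin \o g) ->
  (forall n x, D x -> `|F n x| <= g x) ->
  mu.-integrable D (EFin \o f) /\
  (\int[mu]_(x in D) F n x @[n --> \oo] --> \int[mu]_(x in D) f x).
Proof.
move=> mD mF Ff ig Fg.
have mf : measurable_fun D f by exact: (measurable_fun_cvg mF).
have [| | | | | fi _ cv] :=
  @dominated_convergence _ _ _ mu D mD (fun n => EFin \o F n) (EFin \o f) (EFin \o g).
- by move=> n; exact/measurable_EFinP.
- exact/measurable_EFinP.
- by apply/aeW => x Dx /=; apply/cvg_EFin; [exact: nearW|exact: Ff].
- by [].
- by apply/aeW => x n Dx /=; rewrite lee_fin Fg.
split => //; apply: fine_cvg.
by rewrite Rint_EFin.
Qed.

Lemma Rint_le_norm (D : set T) (f g : T -> R) : measurable D ->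
  measurable_fun D f -> mu.-integrable D (EFin \o g) ->
  (forall x, D x -> `|f x| <= g x) ->
  `|\int[mu]_(x in D) f x| <= \int[mu]_(x in D) g x.
Proof.
move=> mD mf ig fg; have fi := integrable_dom mD mf ig fg.
apply: (le_trans (le_normr_Rintegral mD fi)).
by apply: le_Rintegral => //; exact: integrable_norm.
Qed.

End Rintegral_tools.

Section fubini_dom.
Context d1 d2 (T1 : measurableType d1) (T2 : measurableType d2) (R : realType).
Variables (m1 : {sigma_finite_measure set T1 -> \bar R})
          (m2 : {sigma_finite_measure set T2 -> \bar R}).

Section setT.
Variables (F : T1 * T2 -> R) (g1 : T1 -> R) (g2 : T2 -> R).
Hypotheses (mF : measurable_fun setT F)
  (ig1 : m1.-integrable setT (EFin \o g1)) (ig2 : m2.-integrable setT (EFin \o g2))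
  (Fg : forall x y, `|F (x, y)| <= g1 x * g2 y).

Lemma integrable_pair1 x : m2.-integrable setT (EFin \o (fun y => F (x, y))).
Proof.
apply: (@integrable_dom _ _ _ m2 _ _ (fun y => g1 x * g2 y)) => //.
- exact: measurable_fun_pair2.
- by exact: integrable_mull.
Qed.

Lemma integrable_pair2 y : m1.-integrable setT (EFin \o (fun x => F (x, y))).
Proof.
apply: (@integrable_dom _ _ _ m1 _ _ (fun x => g2 y * g1 x)) => //.
- exact: measurable_fun_pair1.
- by exact: integrable_mull.
- by move=> x _; rewrite mulrC.
Qed.

(** The double integrals of signed functions met below are dominated in this way, with
    one exception ([Rfubini_sections]). *)
Lemma integrable_prod_dom : (m1 \x m2)%E.-integrable setT (EFin \o F).
Proof.
apply/integrable12ltyP; first exact/measurable_EFinP.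
apply: (@le_lt_trans _ _ (\int[m1]_x (`|g1 x| * \int[m2]_y `|g2 y|)%:E)%E).
  apply: ge0_le_integral => //=.
  - by move=> x _; exact: integral_ge0.
  - apply: (@measurable_fun_fubini_tonelli_F _ _ _ _ _ m2 (fun z => `|(F z)%:E|%E)) => //.
    by apply: measurableT_comp => //; exact/measurable_EFinP.
  - apply/measurable_EFinP; apply: measurable_funM => //.
    apply: measurableT_comp => //.
    by have /measurable_int/measurable_EFinP := ig1.
  - move=> x _; rewrite EFinM Rint_EFin//; last exact: integrable_norm.
    rewrite -ge0_integralZl//=.
    + apply: ge0_le_integral => //=.
      * apply/measurable_EFinP/measurableT_comp => //.
        exact: (measurable_fun_pair2 x mF).
      * apply/measurable_EFinP; apply: measurable_funM => //.
        by apply: measurableT_comp => //; have /measurable_int/measurable_EFinP := ig2.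
      * by move=> y _; rewrite -EFinM lee_fin -normrM (le_trans (Fg x y))// ler_norm.
    + apply/measurable_EFinP/measurableT_comp => //.
      by have /measurable_int/measurable_EFinP := ig2.
under eq_integral do rewrite mulrC EFinM.
rewrite ge0_integralZl//=.
- rewrite -Rint_EFin//; last exact: integrable_norm.
  by rewrite -EFinM ltry.
- apply/measurable_EFinP/measurableT_comp => //.
  by have /measurable_int/measurable_EFinP := ig1.
- by rewrite lee_fin; apply: Rintegral_ge0.
Qed.

Lemma integrable_fub1 :
  m1.-integrable setT (EFin \o (fun x => \int[m2]_y F (x, y))).
Proof.
have := integrable_fubini_F integrable_prod_dom.
by apply: eq_integrable => // x _ /=; rewrite /fubini_F Rint_EFin//; exact: integrable_pair1.
Qed.

Lemma integrable_fub2 :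
  m2.-integrable setT (EFin \o (fun y => \int[m1]_x F (x, y))).
Proof.
have iF := integrable_prod_dom.
have mG := measurable_fubini_G iF.
have : m2.-integrable setT (fun y => \int[m1]_x (EFin \o F) (x, y))%E.
  apply/integrableP; split => //.
  apply: le_lt_trans ((integrable21ltyP _ _ _).1 iF); last exact/measurable_EFinP.
  apply: ge0_le_integral => //.
  - exact: measurableT_comp.
  - apply: (@measurable_fun_fubini_tonelli_G _ _ _ _ _ m1 (abse \o (EFin \o F))) => //=.
    by apply: measurableT_comp => //; exact/measurable_EFinP.
  - move=> y _; apply: le_abse_integral => //.
    by apply/measurable_EFinP; exact: measurable_fun_pair1.
apply: eq_integrable => // y _ /=.
by rewrite Rint_EFin//; exact: integrable_pair2.
Qed.

Lemma Rfubini :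
  \int[m1]_x (\int[m2]_y F (x, y)) = \int[m2]_y (\int[m1]_x F (x, y)).
Proof.
have := Fubini integrable_prod_dom.
rewrite /Rintegral => H; congr fine.
transitivity (\int[m1]_x \int[m2]_y (EFin \o F) (x, y))%E.
  by apply: eq_integral => x _; rewrite -Rint_EFin//; exact: integrable_pair1.
rewrite H; apply: eq_integral => y _.
by rewrite -Rint_EFin//; exact: integrable_pair2.
Qed.

End setT.
End fubini_dom.

Section param.

(** The extended-real integral is a difference of two integrals of nonnegative
    functions, each measurable by Tonelli, and [fine] is measurable. *)
Lemma measurable_Rint_param d1 d2 (T1 : measurableType d1) (T2 : measurableType d2)
    (R : realType) (m2 : {sigma_finite_measure set T2 -> \bar R})
    (D : set T2) (F : T1 * T2 -> R) : measurable D -> measurable_fun setT F ->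
  measurable_fun setT (fun x => \int[m2]_(y in D) F (x, y)).
Proof.
move=> mD mF.
pose G (z : T1 * T2) := (F z * \1_D z.2)%:E.
have mG : measurable_fun setT G.
  apply/measurable_EFinP; apply: measurable_funM => //.
  apply: (@measurableT_comp _ _ _ _ _ _ (\1_D : T2 -> R) _ snd) => //.
apply: (measurableT_comp (f := fine)) => //.
rewrite (_ : (fun x => _) =
    (fun x => \int[m2]_y (G^\+)%E (x, y) - \int[m2]_y (G^\-)%E (x, y))%E); last first.
  apply/funext => x; rewrite integral_mkcond.
  transitivity (\int[m2]_y G (x, y))%E.
    apply: eq_integral => y _; rewrite patchE /G/= indicE.
    by case: ifP => _; rewrite ?mulr1 ?mulr0.
  rewrite integralE; congr (_ - _)%E; apply: eq_integral => y _.
    exact: (congr1 (fun h => h y) (funepos_comp G (pair x))).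
  exact: (congr1 (fun h => h y) (funeneg_comp G (pair x))).
apply: emeasurable_funB.
- apply: measurable_fun_fubini_tonelli_F => //; exact: measurable_funepos.
- apply: measurable_fun_fubini_tonelli_F => //; exact: measurable_funeneg.
Qed.

Lemma measurable_Rint_param2 d1 d2 (T1 : measurableType d1) (T2 : measurableType d2)
    (R : realType) (m1 : {sigma_finite_measure set T1 -> \bar R})
    (D : set T1) (F : T1 * T2 -> R) : measurable D -> measurable_fun setT F ->
  measurable_fun setT (fun y => \int[m1]_(x in D) F (x, y)).
Proof.
move=> mD mF; apply: (measurable_Rint_param m1 (F := fun z => F (z.2, z.1))) => //.
by apply: measurableT_comp => //; exact: measurable_fun_pair.
Qed.

End param.

Section fubini_on.
Context d1 d2 (T1 : measurableType d1) (T2 : measurableType d2) (R : realType).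
Variables (m1 : {sigma_finite_measure set T1 -> \bar R})
          (m2 : {sigma_finite_measure set T2 -> \bar R}).
Variables (D1 : set T1) (D2 : set T2) (mD1 : measurable D1) (mD2 : measurable D2).
Variables (F : T1 * T2 -> R) (g1 : T1 -> R) (g2 : T2 -> R).
Hypotheses (mF : measurable_fun setT F)
  (ig1 : m1.-integrable D1 (EFin \o g1)) (ig2 : m2.-integrable D2 (EFin \o g2))
  (Fg : forall x y, D1 x -> D2 y -> `|F (x, y)| <= g1 x * g2 y).

Let F' : T1 * T2 -> R := F \_ (D1 `*` D2).
Let h1 := fun x => `|(g1 \_ D1) x|.
Let h2 := fun y => `|(g2 \_ D2) y|.

Let mF' : measurable_fun setT F'.
Proof.
apply/measurable_restrict => //; first exact: measurableX.
exact: measurable_funTS.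
Qed.

Let ih1 : m1.-integrable setT (EFin \o h1).
Proof.
apply: integrable_norm; rewrite -restrict_EFin.
exact: ((integrable_mkcond _ mD1).1 ig1).
Qed.

Let ih2 : m2.-integrable setT (EFin \o h2).
Proof.
apply: integrable_norm; rewrite -restrict_EFin.
exact: ((integrable_mkcond _ mD2).1 ig2).
Qed.

Let F'h x y : `|F' (x, y)| <= h1 x * h2 y.
Proof.
rewrite /F' patchE; case: ifPn => [/set_mem[/= D1x D2y]|_].
  rewrite /h1 /h2 !patchE !mem_set// -normrM (le_trans (Fg D1x D2y))//.
  exact: ler_norm.
by rewrite normr0 /h1 /h2 mulr_ge0.
Qed.

Let F'1 x : \int[m2]_y F' (x, y) =
  ((fun x => \int[m2]_(y in D2) F (x, y)) \_ D1) x.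
Proof.
rewrite patchE; case: ifPn => [/set_mem D1x|D1x].
  rewrite [RHS]Rintegral_mkcond; apply: eq_Rintegral => y _.
  rewrite /F' !patchE; case: ifPn => [/set_mem[_ D2y]|].
    by rewrite mem_set.
  by case: ifPn => // /set_mem D2y; rewrite mem_set.
rewrite (_ : (fun y => F' (x, y)) = cst 0) ?Rintegral_cst ?mul0r//.
apply/funext => y; rewrite /F' patchE ifN//.
by apply: contra D1x => /set_mem[? _]; rewrite mem_set.
Qed.

Let F'2 y : \int[m1]_x F' (x, y) =
  ((fun y => \int[m1]_(x in D1) F (x, y)) \_ D2) y.
Proof.
rewrite patchE; case: ifPn => [/set_mem D2y|D2y].
  rewrite [RHS]Rintegral_mkcond; apply: eq_Rintegral => x _.
  rewrite /F' !patchE; case: ifPn => [/set_mem[D1x _]|].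
    by rewrite mem_set.
  by case: ifPn => // /set_mem D1x; rewrite mem_set.
rewrite (_ : (fun x => F' (x, y)) = cst 0) ?Rintegral_cst ?mul0r//.
apply/funext => x; rewrite /F' patchE ifN//.
by apply: contra D2y => /set_mem[_ ?]; rewrite mem_set.
Qed.

Lemma Rfubini_on :
  \int[m1]_(x in D1) (\int[m2]_(y in D2) F (x, y)) =
  \int[m2]_(y in D2) (\int[m1]_(x in D1) F (x, y)).
Proof.
rewrite [LHS]Rintegral_mkcond [RHS]Rintegral_mkcond.
transitivity (\int[m1]_x (\int[m2]_y F' (x, y))).
  by apply: eq_Rintegral => x _; rewrite F'1.
rewrite (Rfubini mF' ih1 ih2 F'h).
by apply: eq_Rintegral => x _; rewrite F'2.
Qed.

Lemma integrable_fub1_on :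
  m1.-integrable D1 (EFin \o (fun x => \int[m2]_(y in D2) F (x, y))).
Proof.
apply/(integrable_mkcond _ mD1).2; rewrite restrict_EFin.
have := integrable_fub1 mF' ih1 ih2 F'h.
by apply: eq_integrable => // x _ /=; rewrite F'1.
Qed.

Lemma integrable_fub2_on :
  m2.-integrable D2 (EFin \o (fun y => \int[m1]_(x in D1) F (x, y))).
Proof.
apply/(integrable_mkcond _ mD2).2; rewrite restrict_EFin.
have := integrable_fub2 mF' ih1 ih2 F'h.
by apply: eq_integrable => // y _ /=; rewrite F'2.
Qed.

End fubini_on.

Section reflection.
Context (R : realType).
Notation mu := (@lebesgue_measure R).

Lemma measurable_reflect (c : R) : measurable_fun [set: R] (fun x => c - x).
Proof. exact: measurable_funB. Qed.

(** The reflection [x |-> c - x] gives translations by composing two of them, so it is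
    the only change of variables proved directly. *)
Lemma lebesgue_reflect (c : R) (A : set R) : measurable A ->
  pushforward mu (fun x => c - x : measurableTypeR R) A = mu A.
Proof.
move=> mA; have mr := measurable_reflect c.
apply: esym; apply: lebesgue_measure_unique => // _ [[a b]] _ <-.
transitivity (mu `[c - b, c - a[%classic).
  rewrite /= !lebesgue_measure_itv/= !lte_fin ltrD2l ltrN2.
  by case: ifP => // _; rewrite -!EFinB; congr EFin; ring.
congr (mu _); apply/seteqP; split => x /=; rewrite !in_itv/= => /andP[? ?];
  apply/andP; split; lra.
Qed.

Lemma ge0_integral_reflect (c : R) (f : R -> \bar R) : measurable_fun setT f ->
  (forall x, (0 <= f x)%E) -> (\int[mu]_x f (c - x)%R = \int[mu]_x f x)%E.
Proof.
move=> mf f0.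
transitivity (\int[pushforward mu (fun x => (c - x)%R : measurableTypeR R)]_x f x)%E.
  rewrite ge0_integral_pushforward//; exact: measurable_reflect.
apply: eq_measure_integral; first exact: measurable_reflect.
by move=> ? A mA _; exact: lebesgue_reflect.
Qed.

Lemma integrable_reflect (c : R) (f : R -> R) : mu.-integrable setT (EFin \o f) ->
  mu.-integrable setT (EFin \o (fun x => f (c - x))).
Proof.
move=> fi; have /integrableP[mf foo] := fi.
have mf' : measurable_fun setT f by exact/measurable_EFinP.
apply/integrableP; split.
  apply/measurable_EFinP; apply: measurableT_comp => //; exact: measurable_reflect.
rewrite (ge0_integral_reflect c (f := fun x => `|(f x)%:E|%E))//.
exact: measurableT_comp.
Qed.

Lemma Rint_reflect (c : R) (f : R -> R) : mu.-integrable setT (EFin \o f) ->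
  \int[mu]_x f (c - x) = \int[mu]_x f x.
Proof.
move=> fi; congr fine.
transitivity (\int[pushforward mu (fun x => (c - x)%R : measurableTypeR R)]_x (f x)%:E)%E.
  rewrite integral_pushforward//.
  - exact: measurable_reflect.
  - by have /integrableP[] := fi.
  - exact: (integrable_reflect c fi).
apply: eq_measure_integral; first exact: measurable_reflect.
by move=> ? A mA _; exact: lebesgue_reflect.
Qed.

Lemma integrable_translate (c : R) (f : R -> R) : mu.-integrable setT (EFin \o f) ->
  mu.-integrable setT (EFin \o (fun x => f (x + c))).
Proof.
move=> /(integrable_reflect c)/(integrable_reflect 0).
by apply: eq_integrable => // x _ /=; congr (f _)%:E; ring.
Qed.

Lemma Rint_translate (c : R) (f : R -> R) : mu.-integrable setT (EFin \o f) ->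
  \int[mu]_x f (x + c) = \int[mu]_x f x.
Proof.
move=> fi; rewrite -(Rint_reflect c fi) -(Rint_reflect 0 (integrable_reflect c fi)).
by apply: eq_Rintegral => x _; congr f; ring.
Qed.

Lemma Rint_itv_translate (s T : R) (y : R -> R) :
  mu.-integrable `[s, T] (EFin \o y) ->
  \int[mu]_(r in `[s, T]) y r = \int[mu]_(u in `[0, T - s]) y (s + u).
Proof.
move=> yi; rewrite Rintegral_mkcond [RHS]Rintegral_mkcond.
rewrite -(@Rint_translate s); last first.
  by rewrite -restrict_EFin; apply/(integrable_mkcond _ _).1.
apply: eq_Rintegral => u _; rewrite !patchE !mem_setE !in_itv/=.
rewrite (_ : (s <= u + s <= T) = (0 <= u <= T - s)) 1?[s + u]addrC//.
by apply/idP/idP => /andP[? ?]; apply/andP; split; lra.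
Qed.

End reflection.

(** * Laws given by a density *)

Section density.
Context (R : realType).
Notation mu := (@lebesgue_measure R).

(** Layer-cake proof: [h y] is the Lebesgue measure of [[0, h y[], so both sides are
    integrals over the region below the graph of [h], and Tonelli reduces the claim to
    measures of sets. *)
Lemma ge0_integral_density (nu : {sigma_finite_measure set R -> \bar R})
    (p h : R -> R) : measurable_fun setT p -> (forall x, 0 <= p x) ->
  (forall A, measurable A -> nu A = \int[mu]_(x in A) (p x)%:E)%E ->
  measurable_fun setT h -> (forall x, 0 <= h x) ->
  (\int[nu]_x (h x)%:E = \int[mu]_x (h x * p x)%:E)%E.
Proof.
move=> mp p0 nuE mh h0.
pose E := [set z : R * R | 0 <= z.2 /\ z.2 < h z.1].
have mE : measurable E.
  rewrite (_ : E = (fun z : R * R => 0 <= z.2) @^-1` [set true] `&`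
    (fun z : R * R => z.2 < h z.1) @^-1` [set true]); last first.
    by apply/seteqP; split => z /= [].
  apply: measurableI; rewrite -[X in measurable X]setTI.
  - by apply: (measurable_fun_ler (measurable_cst _) measurable_snd).
  - apply: (measurable_fun_ltr measurable_snd) => //.
    exact: measurableT_comp.
have hE y : (\int[mu]_t (\1_E (y, t))%:E = (h y)%:E)%E.
  rewrite (_ : (fun t => (\1_E (y, t))%:E) = (fun t => (\1_(`[0, h y[%classic) t)%:E)); last first.
    apply/funext => t; congr EFin; rewrite !indicE; congr (_%:R); congr nat_of_bool.
    apply/idP/idP => [/set_mem/= [? ?]|/set_mem/=]; first by apply/mem_set; rewrite /= in_itv/=; apply/andP.
    by rewrite in_itv/= => /andP[? ?]; apply/mem_set.
  rewrite integral_indic//= setIT lebesgue_measure_itv/= lte_fin oppr0 adde0.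
  by case: (ltgtP 0 (h y)) (h0 y) => // <-.
transitivity (\int[nu]_y \int[mu]_t (\1_E (y, t))%:E)%E.
  by apply: eq_integral => y _; rewrite hE.
have mi : measurable_fun setT (fun z => (\1_E z)%:E : \bar R).
  by apply/measurable_EFinP; exact: measurable_indic.
rewrite (fubini_tonelli (m1 := nu) (m2 := mu) (fun z => (\1_E z)%:E))//.
transitivity (\int[mu]_t \int[mu]_y (\1_E (y, t) * p y)%:E)%E.
  apply: eq_integral => t _.
  have mEt : measurable (ysection E t) by exact: measurable_ysection.
  transitivity (\int[nu]_y (\1_(ysection E t) y)%:E)%E.
    by apply: eq_integral => y _; rewrite !indicE mem_ysection.
  transitivity (nu (ysection E t)); first by rewrite integral_indic// setIT.
  rewrite nuE// integral_mkcond.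
  apply: eq_integral => y _; rewrite patchE indicE mem_ysection.
  by case: ifP => _; rewrite ?mul1r ?mul0r.
rewrite -(fubini_tonelli (m1 := mu) (m2 := mu) (fun z => (\1_E z * p z.1)%:E))//=; last 2 first.
- apply/measurable_EFinP; apply: measurable_funM; first exact: measurable_indic.
  exact: measurableT_comp.
- by move=> z; rewrite lee_fin mulr_ge0.
apply: eq_integral => y _.
under eq_integral do rewrite mulrC EFinM.
rewrite ge0_integralZl//=.
- by rewrite hE -EFinM mulrC.
- exact: (measurable_fun_pair2 y mi).
- by rewrite lee_fin.
Qed.

End density.

Lemma Rint_prob_cst d (T : measurableType d) (R : realType) (P : probability T R)
  (c : R) : \int[P]_w c = c.
Proof.
rewrite Rintegral_cst// (_ : fine _ = 1) ?mulr1//.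
exact: (congr1 fine (probability_setT P)).
Qed.

Lemma integrable_bdd d (T : measurableType d) (R : realType) (P : probability T R)
  (h : T -> R) (M : R) : measurable_fun setT h -> (forall w, `|h w| <= M) ->
  P.-integrable setT (EFin \o h).
Proof.
move=> mh hM; apply: measurable_bounded_integrable => //.
- exact: (le_lt_trans (probability_le1 _ _) (ltry _)).
- exists M; split; first exact: num_real.
  by move=> x Mx y _; exact: le_trans (hM _) (ltW Mx).
Qed.

Lemma Rint_prob_le d (T : measurableType d) (R : realType) (P : probability T R)
  (h : T -> R) (M : R) : measurable_fun setT h -> (forall w, `|h w| <= M) ->
  `|\int[P]_w h w| <= M.
Proof.
move=> mh hM; rewrite -[leRHS](Rint_prob_cst P); apply: Rint_le_norm => //.
apply: (@integrable_bdd _ _ _ _ _ `|M|) => //.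
Qed.

Section law_density.
Context (R : realType).
Notation mu := (@lebesgue_measure R).

Lemma density_measure (p : R -> R) : (forall x, 0 <= p x) ->
  mu.-integrable setT (EFin \o p) ->
  exists nu : {finite_measure set R -> \bar R},
    forall A, measurable A -> nu A = (\int[mu]_(x in A) (p x)%:E)%E.
Proof.
move=> p0 ip.
pose m (A : set R) := (\int[mu]_(x in A) (p x)%:E)%E.
have m0 : m set0 = 0%E by rewrite /m integral_set0.
have m_ge0 A : (0 <= m A)%E by apply: integral_ge0 => x _; rewrite lee_fin.
have msa : semi_sigma_additive m.
  move=> /= A mA tA mUA; rewrite /m integral_bigcup//=; last first.
    exact: integrableS ip.
  by apply: is_cvg_ereal_nneg_natsum_cond => n _ _; exact: m_ge0.
have mfin : fin_num_fun m.
  move=> A mA; rewrite ge0_fin_numE//.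
  have /integrableP[_] := @integrableS _ (measurableTypeR R) R mu setT A _
    measurableT mA (@subsetT _ _) ip.
  by under eq_integral do rewrite /= ger0_norm//.
pose nu : {measure set R -> \bar R} := HB.pack m (isMeasure.Build _ _ _ m m0 m_ge0 msa).
pose nu' : {finite_measure set R -> \bar R} :=
  HB.pack m nu (Measure_isFinite.Build _ _ _ nu mfin).
by exists nu'.
Qed.

(** Open intervals form a generating family stable under intersection, so they determine
    the law. *)
Lemma law_density d (T : measurableType d) (P : probability T R) (Y : T -> R)
    (p : R -> R) : measurable_fun setT Y -> (forall x, 0 <= p x) ->
  mu.-integrable setT (EFin \o p) ->
  (forall a b, a < b -> P (Y @^-1` `]a, b[) = (\int[mu]_(x in `]a, b[) (p x)%:E)%E) ->
  forall B, measurable B -> P (Y @^-1` B) = (\int[mu]_(x in B) (p x)%:E)%E.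
Proof.
move=> mY p0 ip H B mB.
have [nu nuE] := density_measure p0 ip.
pose Pr : {RV P >-> R} := HB.pack Y (isMeasurableFun.Build _ _ _ _ Y mY).
rewrite -nuE//; transitivity (distribution P Pr B) => //.
pose G := [set A : set R | exists a b, A = `]a, b[%classic].
apply: (measure_unique G (fun n => `](- n%:R), n%:R[%classic)) => //.
- exact: RGenOpens.measurableE.
- move=> _ _ [a [b ->]] [a' [b' ->]]; exists (Num.max a a'), (Num.min b b').
  apply/seteqP; split => x /=; rewrite !in_itv/= gt_max lt_min.
    by move=> [/andP[-> ->] /andP[-> ->]].
  by move=> /andP[/andP[-> ->] /andP[-> ->]].
- by move=> n; eexists; eexists.
- apply/seteqP; split => // x _; exists (Num.trunc `|x|).+1 => //=.
  rewrite in_itv/= -ltr_norml.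
  have /andP[_] := truncn_itv (normr_ge0 x); exact.
- move=> _ [a [b ->]]; have [ab|ba] := ltP a b.
    by apply: (eq_trans (H _ _ ab)); apply: esym; exact: nuE.
  by rewrite set_itv_ge ?measure0// -leNgt.
- move=> k; exact: (le_lt_trans (probability_le1 _ _) (ltry _)).
Qed.

(** Reduced to the nonnegative case by adding the bound [M] to [h]. *)
Lemma expect_density d (T : measurableType d) (P : probability T R) (Y : T -> R)
    (p h : R -> R) (M : R) : measurable_fun setT Y -> (forall x, 0 <= p x) ->
  mu.-integrable setT (EFin \o p) ->
  (forall B, measurable B -> P (Y @^-1` B) = (\int[mu]_(x in B) (p x)%:E)%E) ->
  measurable_fun setT h -> (forall x, `|h x| <= M) ->
  mu.-integrable setT (EFin \o (fun x => h x * p x)) /\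
  \int[P]_w h (Y w) = \int[mu]_x (h x * p x).
Proof.
move=> mY p0 ip H mh hM.
have [nu nuE] := density_measure p0 ip.
have mp : measurable_fun setT p by have /measurable_int/measurable_EFinP := ip.
have ge0 (k : R -> R) : measurable_fun setT k -> (forall x, 0 <= k x) ->
    (\int[P]_w (k (Y w))%:E = \int[mu]_x (k x * p x)%:E)%E.
  move=> mk k0; rewrite -(ge0_integral_density mp p0 nuE mk k0).
  rewrite -(@ge0_integral_pushforward _ _ _ _ _ _ mY P setT (EFin \o k))//; last 2 first.
    exact/measurable_EFinP.
    by move=> x _; rewrite /= lee_fin.
  apply: eq_measure_integral => A mA _.
  by apply: (eq_trans (H A mA)); apply: esym; exact: nuE.
have ikp (k : R -> R) : measurable_fun setT k -> (forall x, `|k x| <= M) ->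
    mu.-integrable setT (EFin \o (fun x => k x * p x)).
  move=> mk kM; apply: (@integrable_dom _ _ _ mu _ _ (fun x => M * p x)) => //.
  - exact: measurable_funM.
  - by exact: integrable_mull.
  - by move=> x _; rewrite normrM (ger0_norm (p0 x)) ler_wpM2r.
have M0 : 0 <= M by exact: le_trans (hM 0).
have iP (k : R -> R) : measurable_fun setT k -> (forall x, `|k x| <= M) ->
    P.-integrable setT (EFin \o (k \o Y)).
  move=> mk kM; apply: (@integrable_bdd _ _ _ _ _ M); last by move=> w; exact: kM.
  exact: measurableT_comp.
split; first exact: ikp.
have e1 : \int[P]_w (h (Y w) + M) = \int[P]_w h (Y w) + M.
  rewrite RintegralD//; last 2 first.
  - exact: (iP h).
  - by apply: (iP (cst M)) => // x; rewrite ger0_norm.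
  by rewrite Rint_prob_cst.
have e2 : \int[mu]_x ((h x + M) * p x) = \int[mu]_x (h x * p x) + M.
  under eq_Rintegral do rewrite mulrDl.
  rewrite RintegralD//; last 2 first.
  - exact: ikp.
  - by apply: (ikp (cst M)) => // x; rewrite ger0_norm.
  congr (_ + _); rewrite -[RHS](Rint_prob_cst P M); congr fine.
  exact/esym/(ge0 (cst M)).
apply: (addIr M); rewrite -e1 -e2; congr fine; apply: ge0.
  exact: measurable_funD.
by move=> x; have := hM x; rewrite ler_norml => /andP[]; lra.
Qed.

End law_density.

(** * Integrals on intervals and exhaustion of the line *)

Section calculus.
Context (R : realType).
Notation mu := (@lebesgue_measure R).

Lemma cont_integrable_itv (f : R -> R) (a b : R) : continuous f ->
  mu.-integrable `[a, b] (EFin \o f).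
Proof.
move=> cf; apply: continuous_compact_integrable; first exact: segment_compact.
exact: continuous_subspaceT.
Qed.

Lemma ftc2 (f F : R -> R) (a b : R) : a <= b ->
  (forall x, a <= x <= b -> is_derive x 1 F (f x)) ->
  (forall x, a <= x <= b -> {for x, continuous f}) ->
  (\int[mu]_(x in `[a, b]) (f x)%:E = (F b - F a)%:E)%E.
Proof.
rewrite le_eqVlt => /predU1P[<-|ab] dF cf.
  by rewrite set_itv1 integral_set1 subrr.
have cF x : a <= x <= b -> {for x, continuous F}.
  by move=> /dF[dx _]; apply: differentiable_continuous; exact/derivable1_diffP.
rewrite (@continuous_FTC2 _ f F)//.
- apply: continuous_in_subspaceT => x; rewrite inE/= in_itv/=; exact: cf.
- split.
  + by move=> x; rewrite in_itv/= => /andP[ax xb]; have [] := dF x; rewrite ?(ltW ax) ?(ltW xb).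
  + by apply: cvg_at_right_filter; apply: cF; rewrite lexx ltW.
  + by apply: cvg_at_left_filter; apply: cF; rewrite lexx ltW.
- move=> x; rewrite in_itv/= => /andP[ax xb]; rewrite derive1E.
  by apply: derive_val; apply: dF; rewrite (ltW ax) (ltW xb).
Qed.

Lemma Rftc2 (f F : R -> R) (a b : R) : a <= b ->
  (forall x, a <= x <= b -> is_derive x 1 F (f x)) ->
  (forall x, a <= x <= b -> {for x, continuous f}) ->
  \int[mu]_(x in `[a, b]) f x = F b - F a.
Proof. by move=> ab dF cf; rewrite /Rintegral (ftc2 ab dF cf). Qed.

Lemma bigcup_itv_sym : \bigcup_n `[(- n%:R : R), n%:R]%classic = setT.
Proof.
apply/seteqP; split => // x _; exists (Num.trunc `|x|).+1 => //=.
rewrite in_itv/= -ler_norml.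
by have /andP[_ /ltW] := truncn_itv (normr_ge0 x).
Qed.

(** Monotone convergence along the intervals [[-n, n]]. *)
Lemma integrable_exhaust (f : R -> R) (C : R) : measurable_fun setT f ->
  (forall x, 0 <= f x) ->
  (forall n : nat, (\int[mu]_(x in `[(- n%:R)%R, n%:R]) (f x)%:E <= C%:E)%E) ->
  mu.-integrable setT (EFin \o f).
Proof.
move=> mf f0 fC; apply/integrableP; split; first exact/measurable_EFinP.
apply: (@le_lt_trans _ _ C%:E); last exact: ltry.
under eq_integral do rewrite /= ger0_norm//.
pose I n : set (measurableTypeR R) := `[(- n%:R : R), n%:R]%classic.
have ndI : nondecreasing_seq I.
  move=> m n mn; apply/subsetPset => x; rewrite /I /= !in_itv/= => /andP[? ?].
  have mnR : (m%:R : R) <= n%:R by rewrite ler_nat.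
  apply/andP; split; lra.
have mfI n : measurable_fun (I n) (EFin \o f).
  by apply/measurable_funTS/measurable_EFinP.
have f0I n x : I n x -> (0 <= (EFin \o f) x)%E by move=> _; rewrite lee_fin.
have := @ge0_nondecreasing_set_cvg_integral _ _ _ I (EFin \o f) mu ndI
  (fun=> measurable_itv _) mfI f0I.
rewrite bigcup_itv_sym => cv.
apply: (cvge_to_le cv); exact: nearW.
Qed.

Lemma Rint_exhaust (f : R -> R) : mu.-integrable setT (EFin \o f) ->
  \int[mu]_(x in `[(- n%:R)%R, n%:R]) f x @[n --> \oo] --> \int[mu]_x f x.
Proof.
move=> fi.
have mf : measurable_fun setT f by have /measurable_int/measurable_EFinP := fi.
under eq_fun do rewrite Rintegral_mkcond.
apply: (proj2 (@Rdct _ _ _ mu setT (fun n => f \_ `[(- n%:R)%R, n%:R]%classic) f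
  (fun x => `|f x|) _ _ _ _ _)) => //.
- by move=> n; apply/measurable_restrict => //; exact: measurable_funTS.
- move=> x _; apply: cvg_near_cst.
  exists (Num.trunc `|x|).+1 => // n /= xn; rewrite patchE mem_setE in_itv/=.
  rewrite -ler_norml (le_trans _ (_ : (Num.trunc `|x|).+1%:R <= _))// ?ler_nat//.
  by have /andP[_ /ltW] := truncn_itv (normr_ge0 x).
- exact: integrable_norm.
- by move=> n x _; rewrite patchE; case: ifP => // _; rewrite normr0.
Qed.

End calculus.

(** * The Cauchy density and its Fourier transform *)

(** The density at [z] of the symmetric 1-stable law at time [s]. *)
Definition cauchy (R : realType) (s z : R) : R := s / (pi * (s ^+ 2 + z ^+ 2)).

(** Inversion is discontinuous at 0 but equals [x * (x^2)^(-1)] there as well, and real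
    powers are measurable. *)
Lemma measurable_invr (R : realType) : measurable_fun [set: R] (fun x : R => x^-1).
Proof.
rewrite (_ : (fun x : R => x^-1) = fun x => x * ((x ^+ 2) `^ (-1))).
  apply: measurable_funM => //.
  apply: (measurableT_comp (@measurable_powR R (-1))).
  exact: measurable_funX.
apply/funext => x; rewrite powR_inv1 ?sqr_ge0//.
by have [->|x0] := eqVneq x 0; [rewrite invr0 mul0r|field].
Qed.

Lemma cvg_nat_unique (R : realType) (u : nat -> R) (a b : R) :
  u n @[n --> \oo] --> a -> u n @[n --> \oo] --> b -> a = b.
Proof. by move=> /cvg_lim <- // /cvg_lim <-. Qed.

Section cauchy.
Context (R : realType).
Notation mu := (@lebesgue_measure R).
Implicit Types s z y x : R.

Lemma sum_sq_gt0 s z : 0 < s -> 0 < s ^+ 2 + z ^+ 2.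
Proof. by move=> s0; rewrite ltr_wpDr ?sqr_ge0 ?exprn_gt0. Qed.

Lemma cauchy_ge0 s z : 0 < s -> 0 <= cauchy s z.
Proof.
move=> s0; apply: divr_ge0; first exact: ltW.
by apply: mulr_ge0; [exact: pi_ge0|exact: ltW (sum_sq_gt0 z s0)].
Qed.

Lemma cauchyN s z : cauchy s (- z) = cauchy s z.
Proof. by rewrite /cauchy sqrrN. Qed.

Lemma cauchy_le s z : 0 < s -> cauchy s z <= (pi * s)^-1.
Proof.
move=> s0; have p0 := pi_gt0 R; have h := sum_sq_gt0 z s0.
have e : (pi * s)^-1 = s / (pi * s ^+ 2).
  by move: p0; generalize (pi : R) => p p0; field; rewrite !gt_eqF.
rewrite e /cauchy ler_wpM2l ?(ltW s0)// lef_pV2 ?posrE ?mulr_gt0 ?exprn_gt0//.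
by rewrite ler_wpM2l ?(ltW p0)// lerDl sqr_ge0.
Qed.

Lemma continuous_cauchy s : 0 < s -> continuous (@cauchy R s).
Proof.
move=> s0 z; rewrite /cauchy.
apply: cvgM; first exact: cvg_cst.
apply: cvgV; first by rewrite mulf_neq0 ?gt_eqF ?pi_gt0 ?sum_sq_gt0.
apply: cvgM; first exact: cvg_cst.
apply: cvgD; first exact: cvg_cst.
exact: exprn_continuous.
Qed.

Lemma measurable_cauchy2 d (T : measurableType d) (a b : T -> R) :
  measurable_fun setT a -> measurable_fun setT b ->
  measurable_fun setT (fun w => cauchy (a w) (b w)).
Proof.
move=> ma mb; rewrite /cauchy; apply: measurable_funM => //.
apply: (measurableT_comp (@measurable_invr R)).
apply: measurable_funM => //.
by apply: measurable_funD; exact: measurable_funX.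
Qed.

Lemma is_derive_atan_cauchy s z : 0 < s ->
  is_derive z 1 (fun z : R => atan (z / s) / pi) (cauchy s z).
Proof.
move=> s0; have p0 := pi_gt0 R; have h := sum_sq_gt0 z s0.
apply: is_derive_eq; rewrite /cauchy /GRing.scale /=.
move: p0; generalize (pi : R) => p p0.
by field; rewrite !gt_eqF.
Qed.

Lemma Rint_cauchy_itv s (b : R) : 0 < s -> 0 <= b ->
  \int[mu]_(z in `[- b, b]) cauchy s z = 2 * atan (b / s) / pi.
Proof.
move=> s0 b0; have ab : - b <= b by lra.
rewrite (Rftc2 ab (fun x _ => is_derive_atan_cauchy x s0) (fun x _ => continuous_cauchy s0 (x:=x))).
by rewrite mulNr atanN; ring.
Qed.

Lemma integrable_cauchy s : 0 < s -> mu.-integrable setT (EFin \o cauchy s).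
Proof.
move=> s0; have p0 := pi_gt0 R.
apply: (@integrable_exhaust _ _ 1).
- exact: (continuous_measurable_fun (continuous_cauchy s0)).
- by move=> x; exact: cauchy_ge0.
- move=> n; rewrite -Rint_EFin//; last exact: (cont_integrable_itv _ _ (continuous_cauchy s0)).
  rewrite Rint_cauchy_itv// lee_fin ler_pdivrMr// mul1r.
  have := atan_ltpi2 (n%:R / s); lra.
Qed.

Lemma cvg_natM (M : R) : 0 < M -> n%:R * M @[n --> \oo] --> +oo.
Proof.
move=> M0; apply/cvgryPge => A; have /cvgryPge h := @cvgr_idn R.
by apply: filterS (h (A / M)) => n; rewrite ler_pdivrMr.
Qed.

Lemma cvg_atan_scaled s : 0 < s -> atan (n%:R / s) @[n --> \oo] --> (pi / 2 : R).
Proof.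
move=> s0.
apply: (@cvg_comp _ _ _ (fun n : nat => n%:R / s) (@atan R) _ (pinfty_nbhs R)).
  2: exact: cvgy_atan.
by apply: cvg_natM; rewrite invr_gt0.
Qed.

Lemma Rint_cauchy s : 0 < s -> \int[mu]_z cauchy s z = 1.
Proof.
move=> s0; have p0 := pi_gt0 R.
have cv := Rint_exhaust (integrable_cauchy s0).
have e : 2 * (pi / 2) / pi = 1 :> R.
  by move: p0; generalize (pi : R) => p p0; field; rewrite gt_eqF.
rewrite -[RHS]e; apply: (cvg_nat_unique cv); under eq_fun do rewrite Rint_cauchy_itv//.
apply: cvgM; last exact: cvg_cst.
by apply: cvgM; [exact: cvg_cst|exact: cvg_atan_scaled].
Qed.

Lemma is_derive_expcos (s y x : R) : s ^+ 2 + y ^+ 2 != 0 ->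
  is_derive x 1 (fun x : R => expR (- s * x) *
     (y * sin (x * y) - s * cos (x * y)) / (s ^+ 2 + y ^+ 2))
  (expR (- s * x) * cos (x * y)).
Proof.
move=> h; apply: is_derive_eq; rewrite /GRing.scale /=; field.
exact: h.
Qed.

Lemma Rint_expcos_itv s y (n : nat) : 0 < s ->
  \int[mu]_(x in `[(- n%:R)%R, n%:R]) (expR (- s * `|x|) * cos (x * y)) =
  2 * s / (s ^+ 2 + y ^+ 2) +
  2 * (expR (- s * n%:R) * (y * sin (n%:R * y) - s * cos (n%:R * y))) / (s ^+ 2 + y ^+ 2).
Proof.
move=> s0; have h := sum_sq_gt0 y s0.
have cf : continuous (fun x : R => expR (- s * `|x|) * cos (x * y)).
  move=> x; apply: cvgM; last first.
    apply: continuous_comp; last exact: continuous_cos.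
    by apply: cvgM; [exact: cvg_id|exact: cvg_cst].
  apply: continuous_comp; last exact: continuous_expR.
  by apply: cvgM; [exact: cvg_cst|exact: norm_continuous].
have ci (r : R) : continuous (fun x : R => expR (r * x) * cos (x * y)).
  move=> x; apply: cvgM; last first.
    apply: continuous_comp; last exact: continuous_cos.
    by apply: cvgM; [exact: cvg_id|exact: cvg_cst].
  apply: continuous_comp; last exact: continuous_expR.
  by apply: cvgM; [exact: cvg_cst|exact: cvg_id].
have fi a b := @cont_integrable_itv _ _ a b cf.
have := @Rintegral_itvB _ _ (BLeft (- n%:R)) (BRight n%:R) 0 (fi _ _).
rewrite !bnd_simp oppr_le0 ler0n => /(_ isT isT) /eqP.
rewrite subr_eq => /eqP ->.
rewrite Rintegral_itv_obnd_cbnd; last by apply: integrableS (fi 0 n%:R) => //;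
  apply: subset_itvr; rewrite bnd_simp.
have -> : \int[mu]_(x in `[0, n%:R]) (expR (- s * `|x|) * cos (x * y)) =
    \int[mu]_(x in `[0, n%:R]) (expR (- s * x) * cos (x * y)).
  by apply: eq_Rintegral => x; rewrite inE/= in_itv/= => /andP[x0 _]; rewrite ger0_norm.
have -> : \int[mu]_(x in `[(- n%:R)%R, 0]) (expR (- s * `|x|) * cos (x * y)) =
    \int[mu]_(x in `[(- n%:R)%R, 0]) (expR (- (- s) * x) * cos (x * y)).
  by apply: eq_Rintegral => x; rewrite inE/= in_itv/= => /andP[_ x0];
    rewrite ler0_norm// mulrN !mulNr opprK.
have hs : s ^+ 2 + y ^+ 2 != 0 by rewrite gt_eqF.
have hNs : (- s) ^+ 2 + y ^+ 2 != 0 by rewrite sqrrN gt_eqF.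
rewrite (Rftc2 (ler0n _ n) (fun x _ => is_derive_expcos x hs) (fun x _ => ci (- s) x)).
have n0 : - n%:R <= 0 :> R by rewrite oppr_le0.
rewrite (Rftc2 n0 (fun x _ => is_derive_expcos x hNs) (fun x _ => ci (- - s) x)).
rewrite !mulr0 !mul0r !expR0 !sin0 !cos0 !mulNr !sinN !cosN !mulrN !sqrrN !opprK.
field; rewrite gt_eqF//.
Qed.

Lemma integrable_expN s : 0 < s ->
  mu.-integrable setT (EFin \o (fun x => expR (- s * `|x|))).
Proof.
move=> s0.
have cf : continuous (fun x : R => expR (- s * `|x|)).
  move=> x; apply: continuous_comp; last exact: continuous_expR.
  by apply: cvgM; [exact: cvg_cst|exact: norm_continuous].
apply: (@integrable_exhaust _ _ (2 / s)).
- exact: continuous_measurable_fun.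
- by move=> x; exact: expR_ge0.
- move=> n; rewrite -Rint_EFin//; last exact: (cont_integrable_itv _ _ cf).
  have := Rint_expcos_itv 0 n s0; under eq_Rintegral do rewrite mulr0 cos0 mulr1.
  move=> ->; rewrite mul0r mulr0 cos0 expr0n/= addr0 sub0r mulr1 lee_fin.
  have -> : 2 * s / s ^+ 2 = 2 / s by field; rewrite gt_eqF.
  rewrite gerDl mulrN mulrN mulNr oppr_le0 divr_ge0 ?sqr_ge0//.
  by rewrite !mulr_ge0 ?expR_ge0// ltW.
Qed.

Lemma integrable_expcos s y : 0 < s ->
  mu.-integrable setT (EFin \o (fun x => expR (- s * `|x|) * cos (x * y))).
Proof.
move=> s0; apply: (integrable_dom _ _ (integrable_expN s0)) => //.
  apply: measurable_funM.
    by have /measurable_int/measurable_EFinP := integrable_expN s0.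
  apply: continuous_measurable_fun => x.
  apply: continuous_comp; last exact: continuous_cos.
  by apply: cvgM; [exact: cvg_id|exact: cvg_cst].
move=> x _; rewrite normrM ger0_norm ?expR_ge0// ler_piMr ?expR_ge0//.
by rewrite ler_norml cos_geN1 cos_le1.
Qed.

Lemma cvg_expN_nat s : 0 < s -> expR (- s * n%:R) @[n --> \oo] --> (0 : R).
Proof.
move=> s0.
under eq_fun do rewrite mulNr mulrC.
apply: (@cvg_comp _ _ _ (fun n : nat => n%:R * s) (fun x => expR (- x)) _ (pinfty_nbhs R)).
  exact: cvg_natM.
exact: cvgr_expR.
Qed.

(** Fourier inversion for the Cauchy density: its characteristic function is
    [e^(-s|x|)]. *)
Lemma Rint_expcos s y : 0 < s ->
  \int[mu]_x (expR (- s * `|x|) * cos (x * y)) = 2 * pi * cauchy s y.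
Proof.
move=> s0; have h := sum_sq_gt0 y s0; have p0 := pi_gt0 R.
have cv := Rint_exhaust (integrable_expcos y s0).
apply: (cvg_nat_unique cv).
under eq_fun do rewrite Rint_expcos_itv//.
have -> : 2 * pi * cauchy s y = 2 * s / (s ^+ 2 + y ^+ 2) + 0.
  by rewrite addr0 /cauchy; move: p0; generalize (pi : R) => p p0; field; rewrite !gt_eqF.
apply: cvgD; first exact: cvg_cst.
have -> : 0 = 2 * 0 / (s ^+ 2 + y ^+ 2) :> R by rewrite mulr0 mul0r.
apply: cvgM; last exact: cvg_cst.
apply: cvgM; first exact: cvg_cst.
apply: (@squeeze_cvgr _ _ _ _ (fun n => - (expR (- s * n%:R) * (`|y| + s)))
   (fun n => expR (- s * n%:R) * (`|y| + s))).
- near=> n; rewrite -ler_norml normrM (ger0_norm (expR_ge0 _)) ler_wpM2l ?expR_ge0//.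
  rewrite (le_trans (ler_normB _ _))// !normrM (gtr0_norm s0) lerD//.
    by rewrite ler_piMr// ler_norml sin_geN1 sin_le1.
  by rewrite ler_piMr ?(ltW s0)// ler_norml cos_geN1 cos_le1.
- rewrite -oppr0; apply: cvgN; rewrite -(mul0r (`|y| + s)); apply: cvgM; last exact: cvg_cst.
  exact: cvg_expN_nat.
- rewrite -(mul0r (`|y| + s)); apply: cvgM; last exact: cvg_cst.
  exact: cvg_expN_nat.
Unshelve. all: by end_near. Qed.

End cauchy.

(** * Convergence of characteristic functions implies convergence in law *)

Section heine.
Context (R : realType).

Lemma heine (h : R -> R) (r : R) : continuous h ->
  (forall x, r < `|x| -> h x = 0) ->
  forall e : R, 0 < e -> exists2 dl : R, 0 < dl & forall x y : R, `|x - y| <= dl -> `|h x - h y| <= e.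
Proof.
move=> ch h0 e e0.
have cK : compact (`[- r - 1, r + 1]%classic : set R) by exact: segment_compact.
have /compact_near_coveringP cov := cK.
have H : forall x, `[- r - 1, r + 1]%classic x ->
    \forall x' \near x & dl \near (0 : R)^'+, forall y, `|x' - y| <= dl -> `|h x' - h y| <= e.
  move=> x _.
  have e20 : 0 < e / 2 by rewrite divr_gt0.
  have /cvgrPdist_le/(_ _ e20)/nbhs_ballP[eta /= eta0 Heta] := ch x.
  (* half of [eta] for moving [x'] off [x], half for the increment [dl] *)
  exists (ball x (eta / 2), [set d | d < eta / 2]); first split => /=.
  - by apply/nbhsx_ballx; rewrite divr_gt0.
  - by apply: nbhs_right_lt; rewrite divr_gt0.
  move=> [x' dl] /= [xx' dle] y yd.
  have hx' : `|h x - h x'| <= e / 2.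
    apply: Heta; apply: le_ball xx'; lra.
  have hy : `|h x - h y| <= e / 2.
    apply: Heta; rewrite /ball/= in xx' *.
    have -> : x - y = (x - x') + (x' - y) by ring.
    by rewrite (le_lt_trans (ler_normD _ _))//; lra.
  have -> : h x' - h y = (h x - h y) - (h x - h x') by ring.
  rewrite (le_trans (ler_normB _ _))//; lra.
have nd := cov R (0 : R)^'+ (fun dl x => forall y, `|x - y| <= dl -> `|h x - h y| <= e) _ H.
near (0 : R)^'+ => dl.
have d0 : 0 < dl by near: dl; exact: nbhs_right_gt.
have d1 : dl < 1 by near: dl; exact: nbhs_right_lt.
have Hd : (`[- r - 1, r + 1]%classic : set R) `<=`
   (fun x => forall y, `|x - y| <= dl -> `|h x - h y| <= e).
  by near: dl; exact: nd.
exists dl => // x y xy.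
have [xr|xr] := leP `|x| (r + 1).
  by apply: Hd => //=; rewrite in_itv/= -opprD -ler_norml.
rewrite !h0 ?subrr ?normr0 ?(ltW e0)//; last lra.
have : `|x| <= `|x - y| + `|y| by rewrite -[in leLHS](subrK y x) ler_normD.
lra.
Unshelve. all: by end_near. Qed.

End heine.

Section smoothing.
Context (R : realType).
Notation mu := (@lebesgue_measure R).

Lemma integrable_mul_bdd d (T : measurableType d) (m : {measure set T -> \bar R})
    (g k : T -> R) (M : R) : measurable_fun setT g -> (forall x, `|g x| <= M) ->
  m.-integrable setT (EFin \o k) -> m.-integrable setT (EFin \o (fun x => g x * k x)).
Proof.
move=> mg gM ik; have mk : measurable_fun setT k by have /measurable_int/measurable_EFinP := ik.
apply: (@integrable_dom _ _ _ m _ _ (fun x => M * `|k x|)) => //.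
- exact: measurable_funM.
- by apply: integrable_mull => //; exact: integrable_norm.
- by move=> x _; rewrite normrM ler_wpM2r.
Qed.

Lemma integrable_mul_bddR (g k : R -> R) (M : R) : measurable_fun setT g ->
  (forall x, `|g x| <= M) -> mu.-integrable setT (EFin \o k) ->
  mu.-integrable setT (EFin \o (fun x => g x * k x)).
Proof. by move=> mg gM ik; exact: (@integrable_mul_bdd _ (measurableTypeR R) mu g k M). Qed.

Lemma cauchy_tail s (dl : R) : 0 < s -> 0 <= dl ->
  \int[mu]_z (\1_(~` `[- dl, dl]%classic) z * cauchy s z) = 1 - 2 * atan (dl / s) / pi.
Proof.
move=> s0 d0.
have ic := integrable_cauchy s0.
rewrite -[X in X - _](Rint_cauchy s0) -Rint_cauchy_itv// [X in _ - X]Rintegral_mkcond.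
rewrite -RintegralB//; last first.
  rewrite -restrict_EFin; apply/(integrable_mkcond _ _).1 => //.
  exact: integrableS ic.
apply: eq_Rintegral => z _; rewrite patchE indicE in_setC.
by case: ifP => _ /=; rewrite ?mul0r ?mul1r ?subrr ?subr0.
Qed.

(** The Cauchy densities form an approximate identity: on [|z| <= dl] the uniform
    continuity of [g] is used, and outside it the mass [1 - 2 atan (dl / s) / pi] is
    small. *)
Lemma cauchy_smooth (g : R -> R) (M : R) : measurable_fun setT g ->
  (forall x, `|g x| <= M) ->
  (forall e : R, 0 < e -> exists2 dl : R, 0 < dl & forall x y : R, `|x - y| <= dl -> `|g x - g y| <= e) ->
  forall e : R, 0 < e -> exists2 s0 : R, 0 < s0 & forall s y : R, 0 < s -> s <= s0 ->
    `|\int[mu]_a (g a * cauchy s (y - a)) - g y| <= e.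
Proof.
move=> mg gM ug e e0; have p0 := pi_gt0 R.
have M0 : 0 <= M by exact: le_trans (gM 0).
have [dl dl0 Hdl] := ug (e / 2) ltac:(lra).
have [s0 s00 Hs0] : exists2 s0 : R, 0 < s0 & 2 * M * (1 - 2 * atan (dl / s0) / pi) <= e / 2.
  have dV0 : 0 < dl^-1 by rewrite invr_gt0.
  have cv : 2 * M * (1 - 2 * atan (n%:R / dl^-1) / pi) @[n --> \oo] --> 2 * M * (1 - 2 * (pi / 2) / pi).
    apply: cvgM; first exact: cvg_cst.
    apply: cvgB; first exact: cvg_cst.
    apply: cvgM; last exact: cvg_cst.
    by apply: cvgM; [exact: cvg_cst|exact: cvg_atan_scaled].
  rewrite (_ : 2 * M * (1 - 2 * (pi / 2) / pi) = 0) in cv; last first.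
    by move: p0; generalize (pi : R) => p p0; field; rewrite gt_eqF.
  have e20 : 0 < e / 2 by lra.
  have /cvgrPdist_le/(_ _ e20)[N _ HN] := cv.
  have /= := HN N.+1 (leqnSn _); rewrite sub0r normrN => HN1.
  exists (N.+1%:R^-1); first by rewrite invr_gt0.
  by apply: le_trans HN1; rewrite !invrK [dl * _]mulrC ler_norm.
exists s0 => // s y sp ss0.
have icr := integrable_reflect y (integrable_cauchy sp).
have mgr : measurable_fun setT (fun z : R => g (y - z)).
  by apply: measurableT_comp => //; exact: measurable_reflect.
have i1 : mu.-integrable setT (EFin \o (fun a : R => g a * cauchy s (y - a))).
  exact: (integrable_mul_bddR mg gM icr).
rewrite -(Rint_reflect y i1).
have yz (z : R) : y - (y - z) = z by ring.
under eq_Rintegral do rewrite yz.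
have ic := integrable_cauchy sp.
rewrite (_ : g y = \int[mu]_z (g y * cauchy s z)); last first.
  by rewrite RintegralZl// Rint_cauchy// mulr1.
rewrite -RintegralB//; last 2 first.
- exact: (@integrable_mul_bddR (fun z => g (y - z)) _ M mgr _ ic).
- exact: (@integrable_mul_bddR (fun=> g y) _ M _ _ ic).
set A := ~` `[- dl, dl]%classic.
have mA : measurable A by apply: measurableC.
have itail : mu.-integrable setT (EFin \o (fun z : R => \1_A z * cauchy s z)).
  apply: (@integrable_mul_bddR _ _ 1) => // z.
  by rewrite indicE; case: (_ \in _); rewrite ?normr1 ?normr0.
apply: (@le_trans _ _ (\int[mu]_z (e / 2 * cauchy s z + 2 * M * (\1_A z * cauchy s z)))).
  apply: Rint_le_norm => //.
  - apply: measurable_funB; apply: measurable_funM => //; exact: measurable_cauchy2.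
  - apply: (@integrableD _ _ _ mu setT _ (EFin \o (fun z : R => e / 2 * cauchy s z))
      (EFin \o (fun z : R => 2 * M * (\1_A z * cauchy s z)))) => //.
    + by exact: integrable_mull.
    + by exact: integrable_mull.
  - move=> z _; rewrite -mulrBl normrM (ger0_norm (cauchy_ge0 z sp)).
    rewrite [2 * M * (_ * _)]mulrA -mulrDl.
    rewrite ler_wpM2r ?cauchy_ge0// indicE.
    have [zA|zA] := boolP (z \in A).
      rewrite mulr1 (le_trans (ler_normB _ _))//.
      have := gM (y - z); have := gM y; lra.
    rewrite mulr0 addr0; apply: Hdl.
    rewrite (_ : y - z - y = - z) ?normrN; last by ring.
    move: zA; rewrite /A in_setC negbK inE/= in_itv/= => ?; by rewrite ler_norml.
rewrite RintegralD//; last 2 first.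
- by exact: integrable_mull.
- by exact: integrable_mull.
rewrite [X in X + _]RintegralZl// [X in _ + X]RintegralZl// Rint_cauchy// cauchy_tail ?(ltW dl0)// mulr1.
suff : 2 * M * (1 - 2 * atan (dl / s) / pi) <= e / 2 by lra.
apply: le_trans Hs0; rewrite ler_wpM2l ?mulr_ge0// lerD2l lerN2.
rewrite ler_wpM2r ?invr_ge0 ?(ltW p0)// ler_wpM2l//.
apply: le_atan; rewrite ler_wpM2l ?(ltW dl0)// lef_pV2 ?posrE//.
Qed.

End smoothing.

Section levy.
Context (R : realType).
Notation mu := (@lebesgue_measure R).

Lemma measurable_cos : measurable_fun [set: R] (@cos R).
Proof. exact: (continuous_measurable_fun (@continuous_cos R)). Qed.

Lemma measurable_sin : measurable_fun [set: R] (@sin R).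
Proof. exact: (continuous_measurable_fun (@continuous_sin R)). Qed.

Lemma norm_cos_le1 (x : R) : `|cos x| <= 1.
Proof. by rewrite ler_norml cos_geN1 cos_le1. Qed.

Lemma norm_sin_le1 (x : R) : `|sin x| <= 1.
Proof. by rewrite ler_norml sin_geN1 sin_le1. Qed.

(** The smoothed law of [Y] at [a] is an absolutely convergent integral of its
    characteristic function; this is what turns convergence of characteristic functions
    into convergence of smoothed laws. *)
Lemma expect_cauchy d (T : measurableType d) (P : probability T R) (Y : T -> R) s (a : R) :
  measurable_fun setT Y -> 0 < s ->
  2 * pi * \int[P]_w cauchy s (Y w - a) =
  \int[mu]_x (expR (- s * `|x|) * \int[P]_w cos (x * (Y w - a))).
Proof.
move=> mY s0.
have mYa : measurable_fun setT (fun w => Y w - a) by exact: measurable_funB.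
rewrite -RintegralZl//; last first.
  apply: (@integrable_bdd _ _ _ _ _ (pi * s)^-1).
    exact: measurable_cauchy2.
  by move=> w; rewrite ger0_norm ?cauchy_ge0 ?cauchy_le.
transitivity (\int[P]_w (\int[mu]_x (expR (- s * `|x|) * cos (x * (Y w - a))))).
  by apply: eq_Rintegral => w _; rewrite Rint_expcos.
pose F (z : T * R) : R := expR (- s * `|z.2|) * cos (z.2 * (Y z.1 - a)).
have mF : measurable_fun setT F.
  apply: measurable_funM.
    apply: (measurableT_comp (f := expR)); first exact: measurable_expR.
    apply: measurable_funM => //; exact: measurableT_comp.
  apply: (measurableT_comp (f := cos)); first exact: measurable_cos.
  apply: measurable_funM => //; apply: measurable_funB => //; exact: measurableT_comp.
have := @Rfubini _ _ T (measurableTypeR R) R P mu F (cst 1) (fun x => expR (- s * `|x|)) mF.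
move=> ->.
- apply: eq_Rintegral => x _; rewrite /F/= RintegralZl//.
  apply: (@integrable_bdd _ _ _ _ _ 1); last by move=> w; exact: norm_cos_le1.
  apply: (measurableT_comp (f := cos)); first exact: measurable_cos.
  by apply: measurable_funM.
- by apply: (@integrable_bdd _ _ _ _ _ 1) => // w; rewrite normr1.
- exact: integrable_expN.
- move=> w x; rewrite /F/= mul1r normrM ger0_norm ?expR_ge0// ler_piMr ?expR_ge0//.
  exact: norm_cos_le1.
Qed.

Lemma cvg_expect_cauchy d (T : measurableType d) (P : probability T R) (Y : nat -> T -> R)
    d' (T' : measurableType d') (Q : probability T' R) (Y' : T' -> R) s (a : R) :
  (forall n, measurable_fun setT (Y n)) -> measurable_fun setT Y' ->
  (forall x, \int[P]_w cos (x * Y n w) @[n --> \oo] --> \int[Q]_w cos (x * Y' w)) ->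
  (forall x, \int[P]_w sin (x * Y n w) @[n --> \oo] --> \int[Q]_w sin (x * Y' w)) ->
  0 < s ->
  \int[P]_w cauchy s (Y n w - a) @[n --> \oo] --> \int[Q]_w cauchy s (Y' w - a).
Proof.
move=> mY mY' cc cs s0; have p0 := pi_gt0 R.
have split d0 (T0 : measurableType d0) (P0 : probability T0 R) (U : T0 -> R) (x : R) :
    measurable_fun setT U ->
    \int[P0]_w cos (x * (U w - a)) =
    cos (x * a) * \int[P0]_w cos (x * U w) + sin (x * a) * \int[P0]_w sin (x * U w).
  move=> mU.
  have mxU : measurable_fun setT (fun w => x * U w) by exact: measurable_funM.
  have ic : P0.-integrable setT (EFin \o (fun w => cos (x * U w))).
    apply: (@integrable_bdd _ _ _ _ _ 1); last by move=> w; exact: norm_cos_le1.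
    by apply: (measurableT_comp (f := cos)) => //; exact: measurable_cos.
  have is' : P0.-integrable setT (EFin \o (fun w => sin (x * U w))).
    apply: (@integrable_bdd _ _ _ _ _ 1); last by move=> w; exact: norm_sin_le1.
    by apply: (measurableT_comp (f := sin)) => //; exact: measurable_sin.
  rewrite -!RintegralZl// -RintegralD//.
  - by apply: eq_Rintegral => w _; rewrite mulrBr cosB [cos (x * a) * _]mulrC [sin (x * a) * _]mulrC.
  - by exact: integrable_mull.
  - by exact: integrable_mull.
have e d0 (T0 : measurableType d0) (P0 : probability T0 R) (U : T0 -> R) :
    measurable_fun setT U ->
    \int[P0]_w cauchy s (U w - a) =
      (2 * pi)^-1 * \int[mu]_x (expR (- s * `|x|) * \int[P0]_w cos (x * (U w - a))).
  by move=> mU; rewrite -expect_cauchy// mulKf// mulf_neq0// gt_eqF.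
rewrite e//; under eq_fun do rewrite e//.
apply: cvgM; first exact: cvg_cst.
have mpart d0 (T0 : measurableType d0) (P0 : probability T0 R) (U : T0 -> R) :
    measurable_fun setT U ->
    measurable_fun [set: R] (fun x => expR (- s * `|x|) * \int[P0]_w cos (x * (U w - a))).
  move=> mU; apply: measurable_funM.
    by have /measurable_int/measurable_EFinP := integrable_expN s0.
  apply: (@measurable_Rint_param _ _ R T0 R P0 setT
    (fun z => cos (z.1 * (U z.2 - a)))) => //.
  apply: (measurableT_comp (f := cos)); first exact: measurable_cos.
  apply: measurable_funM => //; apply: measurable_funB => //; exact: measurableT_comp.
have mcos d0 (T0 : measurableType d0) (U : T0 -> R) (x : R) :
    measurable_fun setT U -> measurable_fun setT (fun w => cos (x * (U w - a))).
  move=> mU; apply: (measurableT_comp (f := cos)); first exact: measurable_cos.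
  by apply: measurable_funM => //; exact: measurable_funB.
apply: (proj2 (@Rdct _ _ _ mu setT
  (fun n x => expR (- s * `|x|) * \int[P]_w cos (x * (Y n w - a))) _
  (fun x => expR (- s * `|x|)) _ _ _ _ _)) => //.
- by move=> n; exact: mpart.
- move=> x _; apply: cvgM; first exact: cvg_cst.
  rewrite split//; under eq_fun do rewrite split//.
  by apply: cvgD; apply: cvgM; [exact: cvg_cst|exact: cc|exact: cvg_cst|exact: cs].
- exact: integrable_expN.
- move=> n x _; rewrite normrM ger0_norm ?expR_ge0// ler_piMr ?expR_ge0//.
  by apply: Rint_prob_le; [exact: mcos|move=> w; exact: norm_cos_le1].
Qed.

End levy.

Section levy_continuity_section.
Context (R : realType).
Notation mu := (@lebesgue_measure R).

Lemma integrable_supp (g : R -> R) (r M : R) : measurable_fun setT g ->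
  (forall x, `|g x| <= M) -> (forall x, r < `|x| -> g x = 0) ->
  mu.-integrable setT (EFin \o g).
Proof.
move=> mg gM g0.
apply: (@integrable_dom _ _ _ mu _ _ (fun x => M * \1_(`[- r, r]%classic) x)) => //.
  by apply: integrable_mull => //; exact: integrable_indic_itv.
move=> x _; rewrite indicE; have [xr|xr] := leP `|x| r.
  by rewrite mem_set ?mulr1//= in_itv/= -ler_norml.
by rewrite g0// normr0 mulr_ge0// (le_trans _ (gM 0)).
Qed.

(** The choice of [s0] does not depend on the probability space nor on [U], so that it
    serves a whole sequence of laws at once. *)
Lemma smooth_approx (g : R -> R) (r M : R) : continuous g ->
  (forall x, `|g x| <= M) -> (forall x, r < `|x| -> g x = 0) ->
  forall e : R, 0 < e -> exists2 s0 : R, 0 < s0 & forall s, 0 < s -> s <= s0 ->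
  forall d (T : measurableType d) (P : probability T R) (U : T -> R), measurable_fun setT U ->
  `|\int[P]_w g (U w) - \int[mu]_a (g a * \int[P]_w cauchy s (U w - a))| <= e.
Proof.
move=> cg gM g0 e e0.
have mg : measurable_fun setT g by exact: continuous_measurable_fun.
have ig := integrable_supp mg gM g0.
have [s0 s00 Hs] := cauchy_smooth mg gM (heine cg g0) e0.
exists s0 => // s s_gt0 ss0 d T P U mU.
pose F (z : T * R) : R := g z.2 * cauchy s (U z.1 - z.2).
have mF : measurable_fun setT F.
  apply: measurable_funM; first exact: measurableT_comp.
  apply: measurable_cauchy2 => //; apply: measurable_funB => //.
  exact: measurableT_comp.
have i1 : P.-integrable setT (EFin \o cst (pi * s)^-1).
  by apply: (@integrable_bdd _ _ _ _ _ `|(pi * s)^-1|).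
have i2 : mu.-integrable setT (EFin \o (fun x => `|g x|)) by exact: integrable_norm.
have Fg w x : `|F (w, x)| <= cst (pi * s)^-1 w * `|g x|.
  rewrite /F/= normrM mulrC ler_wpM2r// ger0_norm ?cauchy_ge0//.
  exact: cauchy_le.
have -> : \int[mu]_a (g a * \int[P]_w cauchy s (U w - a)) =
    \int[P]_w (\int[mu]_a (g a * cauchy s (U w - a))).
  rewrite (@Rfubini _ _ T (measurableTypeR R) R P mu F _ _ mF i1 i2 Fg).
  apply: eq_Rintegral => a _; rewrite -RintegralZl//.
  apply: (@integrable_bdd _ _ _ _ _ (pi * s)^-1).
    by apply: measurable_cauchy2 => //; exact: measurable_funB.
  by move=> w; rewrite ger0_norm ?cauchy_ge0 ?cauchy_le.
have mgU : measurable_fun setT (fun w => g (U w)) by exact: measurableT_comp.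
have mI : measurable_fun setT (fun w => \int[mu]_a (g a * cauchy s (U w - a))).
  exact: (@measurable_Rint_param _ _ T (measurableTypeR R) R mu setT F).
have B w : `|g (U w) - \int[mu]_a (g a * cauchy s (U w - a))| <= e.
  by rewrite distrC; exact: Hs.
rewrite -RintegralB//; last 2 first.
- by apply: (@integrable_bdd _ _ _ _ _ M) => // w; exact: gM.
- apply: (@integrable_bdd _ _ _ _ _ (M + e)) => // w.
  have := ler_normB (g (U w)) (g (U w) - \int[mu]_a (g a * cauchy s (U w - a))).
  rewrite subKr => /le_trans; apply; apply: lerD; [exact: gM|exact: B].
apply: Rint_prob_le => //; exact: measurable_funB.
Qed.

Section cvg.
Context d (T : measurableType d) (P : probability T R) (Y : nat -> T -> R)
    d' (T' : measurableType d') (Q : probability T' R) (Y' : T' -> R).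
Hypotheses (mY : forall n, measurable_fun setT (Y n)) (mY' : measurable_fun setT Y')
  (cc : forall x, \int[P]_w cos (x * Y n w) @[n --> \oo] --> \int[Q]_w cos (x * Y' w))
  (cs : forall x, \int[P]_w sin (x * Y n w) @[n --> \oo] --> \int[Q]_w sin (x * Y' w)).

Lemma levy_compact (g : R -> R) (r M : R) : continuous g ->
  (forall x, `|g x| <= M) -> (forall x, r < `|x| -> g x = 0) ->
  \int[P]_w g (Y n w) @[n --> \oo] --> \int[Q]_w g (Y' w).
Proof.
move=> cg gM g0; apply/cvgrPdist_le => e e0.
have mg : measurable_fun setT g by exact: continuous_measurable_fun.
have ig := integrable_supp mg gM g0.
have e30 : 0 < e / 3 by lra.
have [s s0 /(_ s s0 (lexx s)) Hs] := smooth_approx cg gM g0 e30.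
have mI d0 (T0 : measurableType d0) (P0 : probability T0 R) (U : T0 -> R) :
    measurable_fun setT U -> measurable_fun [set: R] (fun a => \int[P0]_w cauchy s (U w - a)).
  move=> mU; apply: (@measurable_Rint_param _ _ R T0 R P0 setT
    (fun z => cauchy s (U z.2 - z.1))) => //.
  by apply: measurable_cauchy2 => //; apply: measurable_funB => //; exact: measurableT_comp.
have cv : \int[mu]_a (g a * \int[P]_w cauchy s (Y n w - a)) @[n --> \oo] -->
    \int[mu]_a (g a * \int[Q]_w cauchy s (Y' w - a)).
  apply: (proj2 (@Rdct _ _ _ mu setT
    (fun n a => g a * \int[P]_w cauchy s (Y n w - a)) _
    (fun a => (pi * s)^-1 * `|g a|) _ _ _ _ _)) => //.
  - by move=> n; apply: measurable_funM => //; exact: mI.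
  - move=> a _; apply: cvgM; first exact: cvg_cst.
    exact: cvg_expect_cauchy.
  - by apply: integrable_mull => //; exact: integrable_norm.
  - move=> n a _; rewrite normrM mulrC ler_wpM2r//.
    apply: Rint_prob_le; last by move=> w; rewrite ger0_norm ?cauchy_ge0 ?cauchy_le.
    by apply: measurable_cauchy2 => //; exact: measurable_funB.
have /cvgrPdist_le/(_ _ e30) := cv; apply: filterS => n Hn.
have h1 := Hs _ _ P _ (mY n).
have h2 := Hs _ _ Q _ mY'.
rewrite distrC in h1.
set a1 := \int[Q]_w _ in h2 *; set b1 := \int[mu]_a _ in h2 Hn.
set c1 := \int[mu]_a _ in Hn h1; set f1 := \int[P]_w _ in h1 *.
have -> : a1 - f1 = (a1 - b1) + ((b1 - c1) + (c1 - f1)) by ring.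
rewrite (le_trans (ler_normD _ _))//.
have := ler_normD (b1 - c1) (c1 - f1); lra.
Qed.

(** A continuous function equal to 1 on [[-r, r]] and to 0 outside [[-r-1, r+1]]. *)
Definition cutoff (r x : R) : R := Num.max 0 (Num.min 1 (r + 1 - `|x|)).

Lemma cutoff_ge0 r x : 0 <= cutoff r x.
Proof. by rewrite le_max lexx. Qed.

Lemma cutoff_le1 r x : cutoff r x <= 1.
Proof. by rewrite ge_max ler01 ge_min lexx. Qed.

Lemma cutoff_in r x : `|x| <= r -> cutoff r x = 1.
Proof.
move=> xr; rewrite /cutoff min_l; last lra.
by rewrite max_r.
Qed.

Lemma cutoff_out r x : r + 1 < `|x| -> cutoff r x = 0.
Proof. by move=> xr; rewrite /cutoff max_l// ge_min; apply/orP; right; lra. Qed.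

Lemma continuous_cutoff r : continuous (cutoff r).
Proof.
move=> x; apply: (continuous_max (f := fun=> 0) (g := fun x => Num.min 1 (r + 1 - `|x|))).
  exact: cst_continuous.
apply: (continuous_min (f := fun=> 1) (g := fun x => r + 1 - `|x|)).
  exact: cst_continuous.
by apply: cvgB; [exact: cvg_cst|exact: norm_continuous].
Qed.

(** No mass escapes: the cutoff has compact support, so its expectations converge, to a
    value close to 1; this makes the sequence tight and reduces bounded test functions
    to compactly supported ones. *)
Lemma levy_continuity (g : R -> R) (M : R) : continuous g -> (forall x, `|g x| <= M) ->
  \int[P]_w g (Y n w) @[n --> \oo] --> \int[Q]_w g (Y' w).
Proof.
move=> cg gM; apply/cvgrPdist_le => e e0.
have M0 : 0 <= M by exact: le_trans (gM 0).
have mk r : measurable_fun setT (cutoff r).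
  exact: (continuous_measurable_fun (@continuous_cutoff r)).
have mg : measurable_fun setT g by exact: continuous_measurable_fun.
have k1 r x : `|cutoff r x| <= 1 by rewrite ger0_norm ?cutoff_ge0 ?cutoff_le1.
(* [M + 1] rather than [M], which may be 0 *)
pose dl := e / (4 * (M + 1)).
have dl0 : 0 < dl by rewrite /dl divr_gt0//; lra.
have Mdl : M * dl <= e / 4.
  have -> : e / 4 = (M + 1) * dl by rewrite /dl; field; rewrite gt_eqF//; lra.
  by rewrite ler_wpM2r ?(ltW dl0)//; lra.
have [r Hr] : exists r : R, `|1 - \int[Q]_w cutoff r (Y' w)| <= dl.
  have cv : \int[Q]_w cutoff n%:R (Y' w) @[n --> \oo] --> \int[Q]_w (fun=> 1 : R) w.
    apply: (proj2 (@Rdct _ _ _ Q setT (fun n w => cutoff n%:R (Y' w)) (fun=> 1)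
      (fun=> 1) _ _ _ _ _)) => //.
    - by move=> n; exact: measurableT_comp.
    - move=> w _; apply: cvg_near_cst.
      exists (Num.trunc `|Y' w|).+1 => // n /= wn; apply: cutoff_in.
      rewrite (le_trans _ (_ : (Num.trunc `|Y' w|).+1%:R <= _))// ?ler_nat//.
      by have /andP[_ /ltW] := truncn_itv (normr_ge0 (Y' w)).
    - by apply: (@integrable_bdd _ _ _ _ _ 1) => // w; rewrite normr1.
  rewrite Rint_prob_cst in cv.
  have /cvgrPdist_le/(_ _ dl0)[N _ HN] := cv.
  by exists N%:R; have := HN N (leqnn N).
have cvk : \int[P]_w cutoff r (Y n w) @[n --> \oo] --> \int[Q]_w cutoff r (Y' w).
  apply: (@levy_compact _ (r + 1) 1) => //; first exact: continuous_cutoff.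
  by move=> x; exact: cutoff_out.
have cvg' : \int[P]_w (g (Y n w) * cutoff r (Y n w)) @[n --> \oo] -->
    \int[Q]_w (g (Y' w) * cutoff r (Y' w)).
  apply: (@levy_compact (fun x => g x * cutoff r x) (r + 1) M) => //.
  - by move=> x; apply: cvgM; [exact: cg|exact: continuous_cutoff].
  - by move=> x; rewrite normrM -[leRHS]mulr1 ler_pM.
  - by move=> x xr; rewrite cutoff_out ?mulr0.
have rest d0 (T0 : measurableType d0) (P0 : probability T0 R) (U : T0 -> R) :
    measurable_fun setT U ->
    `|\int[P0]_w g (U w) - \int[P0]_w (g (U w) * cutoff r (U w))| <=
    M * (1 - \int[P0]_w cutoff r (U w)).
  move=> mU.
  have mgU : measurable_fun setT (g \o U) by exact: measurableT_comp.
  have mkU : measurable_fun setT (cutoff r \o U) by exact: measurableT_comp.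
  have ik : P0.-integrable setT (EFin \o (cutoff r \o U)).
    by apply: (@integrable_bdd _ _ _ _ _ 1) => // w; exact: k1.
  have i1 : P0.-integrable setT (EFin \o (fun=> 1)).
    by apply: (@integrable_bdd _ _ _ _ _ 1) => // w; rewrite normr1.
  rewrite -RintegralB//; last 2 first.
  - by apply: (@integrable_bdd _ _ _ _ _ M) => // w; exact: gM.
  - apply: (@integrable_bdd _ _ _ _ _ M); first exact: measurable_funM.
    by move=> w; rewrite normrM -[leRHS]mulr1 ler_pM.
  rewrite -[X in _ * (X - _)](Rint_prob_cst P0) -RintegralB// -RintegralZl//; last first.
    exact: (integrableB _ i1 ik).
  apply: Rint_le_norm => //.
  - by apply: measurable_funB => //; exact: measurable_funM.
  - by apply: integrable_mull => //; exact: (integrableB _ i1 ik).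
  - move=> w _; rewrite -[X in X - _]mulr1 -mulrBr normrM.
    rewrite (ger0_norm (_ : 0 <= 1 - cutoff r (U w))) ?subr_ge0 ?cutoff_le1//.
    by rewrite ler_wpM2r ?subr_ge0 ?cutoff_le1.
have e40 : 0 < e / 4 by lra.
have /cvgrPdist_le/(_ _ e40) H1 := cvg'.
have /cvgrPdist_le/(_ _ dl0) H2 := cvk.
near=> n.
have h1 := rest _ _ P _ (mY n).
have h2 := rest _ _ Q _ mY'.
have H1' : `|\int[Q]_w (g (Y' w) * cutoff r (Y' w)) - \int[P]_w (g (Y n w) * cutoff r (Y n w))| <= e / 4.
  by near: n; exact: H1.
have H2' : `|\int[Q]_w cutoff r (Y' w) - \int[P]_w cutoff r (Y n w)| <= dl by near: n; exact: H2.
rewrite distrC in h1.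
set a1 := \int[Q]_w g (Y' w) in h2 *; set b1 := \int[Q]_w (_ * _) in h2 H1'.
set c1 := \int[P]_w (_ * _) in H1' h1; set f1 := \int[P]_w g (Y n w) in h1 *.
set kq := \int[Q]_w _ in H2' Hr h2; set kp := \int[P]_w _ in H2' h1.
have -> : a1 - f1 = (a1 - b1) + ((b1 - c1) + (c1 - f1)) by ring.
have q1 : M * (1 - kq) <= M * dl by rewrite ler_wpM2l// (le_trans (ler_norm _)).
have q2 : M * (1 - kp) <= M * (dl + dl).
  rewrite ler_wpM2l//; have := le_trans (ler_norm _) Hr; have := le_trans (ler_norm _) H2'; lra.
rewrite (le_trans (ler_normD _ _))//.
have := ler_normD (b1 - c1) (c1 - f1).
rewrite mulrDr in q2; lra.
Unshelve. all: by end_near. Qed.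

End cvg.
End levy_continuity_section.

(** * The law with characteristic function exp(-t|x|) is a Cauchy law *)

Section cauchy_law.
Context (R : realType).
Notation mu := (@lebesgue_measure R).
Context d (T : measurableType d) (P : probability T R) (Y : T -> R) (t c : R).
Hypotheses (mY : measurable_fun setT Y) (t0 : 0 < t)
  (hc : forall x, \int[P]_w cos (x * Y w) = expR (- (t * `|x|)))
  (hs : forall x, \int[P]_w sin (x * Y w) = 0).
Let U w := c + Y w.

Let mU : measurable_fun setT U.
Proof. exact: measurable_funD. Qed.

Let E_smooth s a : 0 < s -> \int[P]_w cauchy s (U w - a) = cauchy (s + t) (c - a).
Proof.
move=> s0; have p0 := pi_gt0 R.
have tp : (2 * pi : R) != 0 by rewrite mulf_neq0// gt_eqF.
apply: (mulfI tp); rewrite expect_cauchy// -Rint_expcos ?addr_gt0//.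
apply: eq_Rintegral => x _.
have mxY : measurable_fun setT (fun w => x * Y w) by exact: measurable_funM.
have ic : P.-integrable setT (EFin \o (fun w => cos (x * Y w))).
  apply: (@integrable_bdd _ _ _ _ _ 1); last by move=> w; exact: norm_cos_le1.
  by apply: (measurableT_comp (f := cos)) => //; exact: measurable_cos.
have is' : P.-integrable setT (EFin \o (fun w => sin (x * Y w))).
  apply: (@integrable_bdd _ _ _ _ _ 1); last by move=> w; exact: norm_sin_le1.
  by apply: (measurableT_comp (f := sin)) => //; exact: measurable_sin.
have -> : \int[P]_w cos (x * (U w - a)) =
    cos (x * (c - a)) * \int[P]_w cos (x * Y w) - sin (x * (c - a)) * \int[P]_w sin (x * Y w).
  rewrite -!RintegralZl// -RintegralB//.
  - apply: eq_Rintegral => w _; rewrite /U -cosD; congr cos; ring.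
  - by exact: integrable_mull.
  - by exact: integrable_mull.
rewrite hc hs mulr0 subr0.
have -> : expR (- (s + t) * `|x|) = expR (- s * `|x|) * expR (- (t * `|x|)).
  by rewrite -expRD; congr expR; ring.
ring.
Qed.

(** Smoothing [U] by a Cauchy variable of scale [s] gives the Cauchy density of scale [s
    + t]; then [s] tends to 0. *)
Lemma expect_compact (g : R -> R) (r M : R) : continuous g ->
  (forall x, `|g x| <= M) -> (forall x, r < `|x| -> g x = 0) ->
  \int[P]_w g (U w) = \int[mu]_a (g a * cauchy t (a - c)).
Proof.
move=> cg gM g0.
have mg : measurable_fun setT g by exact: continuous_measurable_fun.
have ig := integrable_supp mg gM g0.
pose q (n : nat) := \int[mu]_a (g a * cauchy (n.+1%:R^-1 + t) (c - a)).
have cq : q n @[n --> \oo] --> \int[mu]_a (g a * cauchy t (a - c)).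
  apply: (proj2 (@Rdct _ _ _ mu setT
    (fun (n : nat) a => g a * cauchy (n.+1%:R^-1 + t) (c - a)) _
    (fun a => (pi * t)^-1 * `|g a|) _ _ _ _ _)) => //.
  - move=> n; apply: measurable_funM => //; apply: measurable_cauchy2 => //.
    exact: measurable_funB.
  - move=> a _; apply: cvgM; first exact: cvg_cst.
    have -> : c - a = - (a - c) by ring.
    under eq_fun do rewrite cauchyN.
    rewrite /cauchy.
    have cv : (n.+1%:R^-1 + t : R) @[n --> \oo] --> t.
      rewrite -[X in _ --> X]add0r; apply: cvgD; last exact: cvg_cst.
      exact: cvg_harmonic.
    apply: cvgM => //; apply: cvgV.
      by rewrite mulf_neq0 ?gt_eqF ?pi_gt0 ?sum_sq_gt0.
    apply: cvgM; first exact: cvg_cst.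
    apply: cvgD; last exact: cvg_cst.
    by under eq_fun do rewrite expr2; rewrite expr2; exact: cvgM.
  - by apply: integrable_mull => //; exact: integrable_norm.
  - move=> n a _; rewrite normrM mulrC ler_wpM2r//.
    have nt0 : 0 < n.+1%:R^-1 + t by rewrite addr_gt0// invr_gt0.
    rewrite ger0_norm ?cauchy_ge0// (le_trans (cauchy_le _ nt0))//.
    rewrite lef_pV2 ?posrE ?mulr_gt0 ?pi_gt0// ler_wpM2l ?pi_ge0//.
    by rewrite lerDr invr_ge0.
apply/eqP; rewrite -subr_eq0 -normr_le0; apply/ler_addgt0Pl => e e0; rewrite addr0.
have e20 : 0 < e / 2 by lra.
have [s0 s00 Hs] := smooth_approx cg gM g0 e20.
have /cvgrPdist_le/(_ _ e20) H1 := cq.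
have /cvgrPdist_le/(_ _ s00) H2 : (n.+1%:R^-1 : R) @[n --> \oo] --> (0 : R) by exact: cvg_harmonic.
near \oo => n.
have h1 : `|\int[mu]_a (g a * cauchy t (a - c)) - q n| <= e / 2 by near: n; exact: H1.
have h2' : `|0 - n.+1%:R^-1 : R| <= s0 by near: n; exact: H2.
have h2 : n.+1%:R^-1 <= s0 by move: h2'; rewrite sub0r normrN ger0_norm ?invr_ge0.
have n0 : 0 < n.+1%:R^-1 :> R by rewrite invr_gt0.
have := Hs _ n0 h2 _ _ P _ mU.
under [X in _ - X]eq_Rintegral do rewrite E_smooth//.
rewrite -/(q n) => h3; rewrite distrC in h1.
rewrite -(subrK (q n) (\int[P]_w _)) -addrA (le_trans (ler_normD _ _))//; lra.
Unshelve. all: by end_near. Qed.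

(** The laws agree on continuous functions with compact support; these increase to
    indicators of open intervals. *)
Lemma cauchy_law B : measurable B ->
  P ((fun w => c + Y w) @^-1` B) = (\int[mu]_(z in B) (cauchy t (z - c))%:E)%E.
Proof.
apply: law_density => //.
- by move=> x; exact: cauchy_ge0.
- exact: (integrable_translate (- c) (integrable_cauchy t0)).
move=> a b ab.
(* trapezoids increasing to the indicator of the open interval *)
pose g (k : nat) x : R := Num.min 1 (k%:R * Num.max 0 (Num.min (x - a) (b - x))).
have g_ge0 k x : 0 <= g k x by rewrite le_min ler01 mulr_ge0// le_max lexx.
have g_le1 k x : g k x <= 1 by rewrite ge_min lexx.
have g_out k x : ~ `]a, b[%classic x -> g k x = 0.
  move=> xab; have hm : Num.min (x - a) (b - x) <= 0.
    rewrite leNgt lt_min !subr_gt0; apply/negP => H; apply: xab => /=.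
    by rewrite in_itv.
  by rewrite /g (max_l hm) mulr0 min_r.
have cg k : continuous (g k).
  move=> x; apply: (continuous_min (f := fun=> 1) (g := fun x => k%:R * Num.max 0 (Num.min (x - a) (b - x)))).
    exact: cst_continuous.
  apply: cvgM; first exact: cvg_cst.
  apply: (continuous_max (f := fun=> 0) (g := fun x => (Num.min (x - a) (b - x)))).
    exact: cst_continuous.
  apply: (continuous_min (f := fun x => x - a) (g := fun x => b - x)).
    by apply: cvgB; [exact: cvg_id|exact: cvg_cst].
  by apply: cvgB; [exact: cvg_cst|exact: cvg_id].
have mg k : measurable_fun setT (g k) by exact: continuous_measurable_fun.
have cvg_g x : g k x @[k --> \oo] --> (\1_(`]a, b[%classic) x : R).
  have [xab|xab] := boolP (x \in `]a, b[).
    have xx := xab; rewrite in_itv/= in xab.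
    rewrite indicE mem_set//=; apply: cvg_near_cst.
    set m := Num.min (x - a) (b - x).
    have m0 : 0 < m by rewrite lt_min !subr_gt0.
    exists (Num.trunc m^-1).+1 => // k /= hk; rewrite /g -/m max_r ?(ltW m0)// min_l//.
    rewrite -ler_pdivrMr// div1r (le_trans _ (_ : (Num.trunc m^-1).+1%:R <= _))// ?ler_nat//.
    have mV0 : 0 <= m^-1 by rewrite invr_ge0 ltW.
    by have /andP[_ /ltW] := truncn_itv mV0.
  rewrite indicE memNset//=; last exact/negP.
  have gx0 k : g k x = 0 by apply: g_out; exact/negP.
  under eq_fun do rewrite gx0.
  exact: cvg_cst.
have mab : measurable (`]a, b[%classic : set R) by exact: measurable_itv.
have lhs : \int[P]_w g k (U w) @[k --> \oo] --> \int[P]_w (\1_(`]a, b[%classic) (U w) : R).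
  apply: (proj2 (@Rdct _ _ _ P setT (fun k w => g k (U w)) _ (fun=> 1) _ _ _ _ _)) => //.
  - by move=> k; exact: measurableT_comp.
  - by apply: (@integrable_bdd _ _ _ _ _ 1) => // w; rewrite normr1.
  - by move=> k w _; rewrite ger0_norm.
have ic := integrable_translate (- c) (integrable_cauchy t0).
have mc : measurable_fun [set: R] (fun z : R => cauchy t (z - c)).
  by have /measurable_int/measurable_EFinP := ic.
have rhs : \int[mu]_z (g k z * cauchy t (z - c)) @[k --> \oo] -->
    \int[mu]_z (\1_(`]a, b[%classic) z * cauchy t (z - c)).
  apply: (proj2 (@Rdct _ _ _ mu setT (fun k z => g k z * cauchy t (z - c)) _
     (fun z => cauchy t (z - c)) _ _ _ _ _)) => //.
  - by move=> k; exact: (measurable_funM (mg k) mc).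
  - by move=> z _; apply: cvgM; [exact: cvg_g|exact: cvg_cst].
  - move=> k z _; rewrite normrM (ger0_norm (g_ge0 _ _)) (ger0_norm (cauchy_ge0 _ t0)).
    by apply: ler_piMl; rewrite ?cauchy_ge0.
have e : \int[P]_w (\1_(`]a, b[%classic) (U w) : R) =
         \int[mu]_z (\1_(`]a, b[%classic) z * cauchy t (z - c)).
  apply: (cvg_nat_unique lhs); apply: cvg_trans rhs; apply: near_eq_cvg; apply: nearW => k.
  rewrite (@expect_compact (g k) (Num.max `|a| `|b|) 1)//.
  - by move=> x; rewrite ger0_norm.
  - move=> x; rewrite gt_max => /andP[xa xb]; apply: g_out; rewrite /= in_itv/=.
    move=> /andP[ax bx]; have := ler_norm a; have := ler_norm b.
    have := ler_norm (- a); rewrite normrN; have := ler_norm (- b); rewrite normrN.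
    by case: (lerP 0 x) xa xb => hx; [rewrite (ger0_norm hx)|rewrite (ltr0_norm hx)]; lra.
transitivity ((\int[P]_w (\1_(`]a, b[%classic) (U w) : R))%:E).
  rewrite Rint_EFin//; last first.
    apply: (@integrable_bdd _ _ _ _ _ 1); first by apply: measurableT_comp.
    by move=> w; rewrite indicE; case: (_ \in _); rewrite ?normr1 ?normr0.
  transitivity (\int[P]_w (\1_(U @^-1` `]a, b[) w)%:E)%E => //.
  rewrite integral_indic// ?setIT//.
  by rewrite -[X in measurable X]setTI; exact: mU.
rewrite e Rint_EFin//; last first.
  apply: (@integrable_mul_bddR _ _ _ 1) => // x.
  by rewrite indicE; case: (_ \in _); rewrite ?normr1 ?normr0.
rewrite [RHS]integral_mkcond; apply: eq_integral => z _; rewrite patchE indicE.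
by case: ifP => _; rewrite ?mul1r ?mul0r.
Qed.

End cauchy_law.

(** * Occupation integrals are determined by mixed moments *)

Section occupation.
Context (R : realType).
Notation mu := (@lebesgue_measure R).

Lemma integrable_itv_bdd (f : R -> R) (a b M : R) : measurable_fun setT f ->
  (forall x, `|f x| <= M) -> mu.-integrable `[a, b] (EFin \o f).
Proof.
move=> mf fM; apply: measurable_bounded_integrable => //.
- rewrite /= lebesgue_measure_itv/=; case: ifP => // _; exact: ltry.
- exact: measurable_funTS.
- exists M; split; first exact: num_real.
  by move=> x Mx y _; exact: le_trans (fM _) (ltW Mx).
Qed.

Context d (T : measurableType d) (P : probability T R) (Y : R * T -> R) (M S : R).
Hypotheses (mY : measurable_fun setT Y) (YM : forall z, `|Y z| <= M) (S0 : 0 <= S).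

Definition occ (w : T) : R := \int[mu]_(u in `[0, S]) Y (u, w).

Lemma measurable_occ : measurable_fun setT occ.
Proof. exact: (@measurable_Rint_param2 _ _ (measurableTypeR R) T R mu `[0, S]%classic Y). Qed.

Lemma integrable_occ w : mu.-integrable `[0, S] (EFin \o (fun u => Y (u, w))).
Proof.
apply: (@integrable_itv_bdd _ _ _ M) => //.
exact: (measurable_fun_pair1 w mY).
Qed.

Lemma occ_bdd w : `|occ w| <= M * S.
Proof.
have -> : M * S = \int[mu]_(u in `[0, S]) M.
  by rewrite Rintegral_cst//= lebesgue_measure_itv/= lte_fin;
     case: ltgtP S0 => // [_|<-] _ /=; rewrite ?subr0 ?mulr0.
apply: Rint_le_norm => //.
- by apply: measurable_funTS; exact: (measurable_fun_pair1 w mY).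
- by apply: (@integrable_itv_bdd _ _ _ `|M|).
Qed.

Lemma expect_mul_occ (Z : T -> R) (C : R) : measurable_fun setT Z -> (forall w, `|Z w| <= C) ->
  \int[P]_w (Z w * occ w) = \int[mu]_(u in `[0, S]) (\int[P]_w (Z w * Y (u, w))).
Proof.
move=> mZ ZC.
transitivity (\int[P]_w (\int[mu]_(u in `[0, S]) (Z w * Y (u, w)))).
  by apply: eq_Rintegral => w _; rewrite RintegralZl//; exact: integrable_occ.
pose F (z : T * R) := Z z.1 * Y (z.2, z.1).
have mF : measurable_fun setT F.
  apply: measurable_funM; first exact: measurableT_comp.
  by apply: measurableT_comp => //; exact: measurable_fun_pair.
have i1 : P.-integrable setT (EFin \o cst (C * M)).
  by apply: (@integrable_bdd _ _ _ _ _ `|C * M|).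
have i2 : mu.-integrable `[0, S] (EFin \o cst 1).
  by apply: (@integrable_itv_bdd _ _ _ 1) => // x; rewrite normr1.
apply: (@Rfubini_on _ _ T (measurableTypeR R) R P mu setT `[0, S]%classic
  measurableT (measurable_itv _) F _ _ mF i1 i2) => w u _ _.
by rewrite /F/= mulr1 normrM ler_pM.
Qed.

End occupation.

Section moments.
Context (R : realType).
Notation mu := (@lebesgue_measure R).

Lemma cvg_sin_series (x : R) : series (sin_coeff x) n @[n --> \oo] --> sin x.
Proof. by rewrite unlock; exact: is_cvg_series_sin_coeff. Qed.

Lemma cvg_cos_series (x : R) : series (cos_coeff x) n @[n --> \oo] --> cos x.
Proof. by rewrite unlock; exact: is_cvg_series_cos_coeff. Qed.

Lemma series_exp_le (x : R) n : 0 <= x -> series (exp_coeff x) n <= expR x.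
Proof.
move=> x0; rewrite /expR; apply: nondecreasing_cvgn_le; last exact: is_cvg_series_exp_coeff.
apply/nondecreasing_seqP => m; rewrite /series/= big_nat_recr//= lerDl.
by rewrite /exp_coeff/= divr_ge0 ?exprn_ge0.
Qed.

Lemma series_trig_le (a : nat -> R -> R) (x : R) n :
  (forall k, `|a k x| <= exp_coeff `|x| k) ->
  `|\sum_(0 <= k < n) a k x| <= expR `|x|.
Proof.
move=> H; apply: le_trans (series_exp_le n (normr_ge0 x)).
rewrite (le_trans (ler_norm_sum _ _ _))// /series/=.
by apply: ler_sum => k _; exact: H.
Qed.

Lemma sin_coeff_le (x : R) k : `|sin_coeff x k| <= exp_coeff `|x| k.
Proof.
rewrite /sin_coeff /exp_coeff/= !normrM normfV !normrX normrN1 expr1n mulr1.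
rewrite (ger0_norm (ler0n _ _)) (ger0_norm (ler0n _ _)).
by case: (odd k); rewrite ?mul1r// !mul0r divr_ge0// exprn_ge0.
Qed.

Lemma cos_coeff_le (x : R) k : `|cos_coeff x k| <= exp_coeff `|x| k.
Proof.
rewrite /cos_coeff /exp_coeff/= -exprnP !normrM normfV !normrX normrN1 expr1n mulr1.
rewrite (ger0_norm (ler0n _ _)) (ger0_norm (ler0n _ _)).
by case: (odd k); rewrite /= ?mul1r// !mul0r divr_ge0// exprn_ge0.
Qed.

Context d1 (T1 : measurableType d1) (P1 : probability T1 R) (Y1 : R * T1 -> R) (V1 : T1 -> R)
        d2 (T2 : measurableType d2) (P2 : probability T2 R) (Y2 : R * T2 -> R) (V2 : T2 -> R)
        (M K S : R).
Hypotheses (mY1 : measurable_fun setT Y1) (YM1 : forall z, `|Y1 z| <= M)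
  (mY2 : measurable_fun setT Y2) (YM2 : forall z, `|Y2 z| <= M)
  (mV1 : measurable_fun setT V1) (VK1 : forall z, `|V1 z| <= K)
  (mV2 : measurable_fun setT V2) (VK2 : forall z, `|V2 z| <= K) (S0 : 0 <= S).
Hypothesis H : forall us : seq R, all (fun u => 0 <= u) us ->
  \int[P1]_w (V1 w * \prod_(u <- us) Y1 (u, w)) =
  \int[P2]_w (V2 w * \prod_(u <- us) Y2 (u, w)).

Let K0 d (T : measurableType d) (P : probability T R) (V : T -> R) (VK : forall z, `|V z| <= K) : 0 <= K.
Proof. by apply: le_trans (VK point). Qed.

Let meas d (T : measurableType d) (P : probability T R) (V : T -> R) (Y : R * T -> R)
   (mV : measurable_fun setT V) (mY : measurable_fun setT Y) (us : seq R) m :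
  measurable_fun setT (fun w => V w * \prod_(u <- us) Y (u, w) * occ Y S w ^+ m).
Proof.
apply: measurable_funM; last by apply: measurable_funX; exact: measurable_occ.
apply: measurable_funM => //; elim: us => [|u us IH].
  under eq_fun do rewrite big_nil.
  exact: measurable_cst.
under eq_fun do rewrite big_cons.
by apply: measurable_funM => //; exact: (measurable_fun_pair2 u mY).
Qed.

Let bdd d (T : measurableType d) (P : probability T R) (V : T -> R) (Y : R * T -> R)
   (mY : measurable_fun setT Y)
   (VK : forall z, `|V z| <= K) (YM : forall z, `|Y z| <= M) (us : seq R) m w :
  `|V w * \prod_(u <- us) Y (u, w) * occ Y S w ^+ m| <= K * M ^+ size us * (M * S) ^+ m.
Proof.
rewrite !normrM normrX; apply: ler_pM => //; first last.
- by rewrite lerXn2r ?nnegrE// ?(le_trans (normr_ge0 _) (occ_bdd mY YM S0 w))//; exact: occ_bdd.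
- apply: ler_pM => //; elim: us => [|u us IH]; first by rewrite big_nil normr1 expr0.
  by rewrite big_cons normrM exprS ler_pM.
Qed.

(** Expanding one factor [occ] as an integral over [u] and exchanging integrals replaces
    a power of [occ] by one more time in the list, so equality of the mixed moments
    propagates by induction. *)
Lemma moments_occ m (us : seq R) : all (fun u => 0 <= u) us ->
  \int[P1]_w (V1 w * \prod_(u <- us) Y1 (u, w) * occ Y1 S w ^+ m) =
  \int[P2]_w (V2 w * \prod_(u <- us) Y2 (u, w) * occ Y2 S w ^+ m).
Proof.
elim: m us => [|m IH] us us0.
  under eq_Rintegral do rewrite expr0 mulr1.
  under [RHS]eq_Rintegral do rewrite expr0 mulr1.
  exact: H.
under eq_Rintegral do rewrite exprSr mulrA.
under [RHS]eq_Rintegral do rewrite exprSr mulrA.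
rewrite (@expect_mul_occ _ _ _ P1 Y1 M S mY1 YM1 _ _ (meas P1 mV1 mY1 us m) (bdd P1 mY1 VK1 YM1 us m)).
rewrite (@expect_mul_occ _ _ _ P2 Y2 M S mY2 YM2 _ _ (meas P2 mV2 mY2 us m) (bdd P2 mY2 VK2 YM2 us m)).
apply: eq_Rintegral => u; rewrite inE/= in_itv/= => /andP[u0 _].
transitivity (\int[P1]_w (V1 w * \prod_(v <- u :: us) Y1 (v, w) * occ Y1 S w ^+ m)).
  by apply: eq_Rintegral => w _; rewrite big_cons; ring.
rewrite IH; last by rewrite /= u0.
by apply: eq_Rintegral => w _; rewrite big_cons; ring.
Qed.

(** On a bounded variable an entire power series converges boundedly, so the moments
    determine the expectation of the sum. *)
Lemma trig_occ (a : nat -> R) (phi : R -> R) :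
  (forall x, \sum_(0 <= k < n) a k * x ^+ k @[n --> \oo] --> phi x) ->
  (forall k x, `|a k * x ^+ k| <= exp_coeff `|x| k) ->
  \int[P1]_w (V1 w * phi (occ Y1 S w)) = \int[P2]_w (V2 w * phi (occ Y2 S w)).
Proof.
move=> cv ale.
pose s n x := \sum_(0 <= k < n) a k * x ^+ k.
have ms n d (T : measurableType d) (P : probability T R) (V : T -> R) (Y : R * T -> R) :
   measurable_fun setT V -> measurable_fun setT Y ->
   measurable_fun setT (fun w => V w * s n (occ Y S w)).
  move=> mV mY; apply: measurable_funM => //; rewrite /s.
  elim: n => [|n IH]; first by under eq_fun do rewrite big_geq//; exact: measurable_cst.
  under eq_fun do rewrite big_nat_recr//=.
  apply: measurable_funD => //; apply: measurable_funM => //.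
  by apply: measurable_funX; exact: measurable_occ.
have bs n d (T : measurableType d) (P : probability T R) (V : T -> R) (Y : R * T -> R) w :
   measurable_fun setT Y -> (forall z, `|V z| <= K) -> (forall z, `|Y z| <= M) ->
   `|V w * s n (occ Y S w)| <= K * expR (M * S).
  move=> mY VK YM; rewrite normrM ler_pM//.
  apply: (le_trans (series_trig_le (a := fun k x => a k * x ^+ k) n (fun k => ale k _))).
  by rewrite ler_expR; exact: occ_bdd.
have lim d (T : measurableType d) (P : probability T R) (V : T -> R) (Y : R * T -> R) :
   measurable_fun setT V -> measurable_fun setT Y ->
   (forall z, `|V z| <= K) -> (forall z, `|Y z| <= M) ->
   \int[P]_w (V w * s n (occ Y S w)) @[n --> \oo] --> \int[P]_w (V w * phi (occ Y S w)).
  move=> mV mY VK YM.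
  apply: (proj2 (@Rdct _ _ _ P setT (fun n w => V w * s n (occ Y S w)) _
    (fun=> K * expR (M * S)) _ _ _ _ _)) => //.
  - by move=> n; exact: ms.
  - by move=> w _; apply: cvgM; [exact: cvg_cst|exact: cv].
  - by apply: (@integrable_bdd _ _ _ _ _ `|K * expR (M * S)|).
  - by move=> n w _; exact: bs.
have e n : \int[P1]_w (V1 w * s n (occ Y1 S w)) = \int[P2]_w (V2 w * s n (occ Y2 S w)).
  elim: n => [|n IH].
    rewrite /s; under eq_Rintegral do rewrite big_geq// mulr0.
    under [RHS]eq_Rintegral do rewrite big_geq// mulr0.
    by rewrite !Rint_prob_cst.
  have sS d (T : measurableType d) (P : probability T R) (V : T -> R) (Y : R * T -> R) :
     measurable_fun setT V -> measurable_fun setT Y ->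
     (forall z, `|V z| <= K) -> (forall z, `|Y z| <= M) ->
     \int[P]_w (V w * s n.+1 (occ Y S w)) =
     \int[P]_w (V w * s n (occ Y S w)) +
     a n * \int[P]_w (V w * \prod_(u <- [::]) Y (u, w) * occ Y S w ^+ n).
    move=> mV mY VK YM.
    have iV : P.-integrable setT
      (EFin \o (fun w => V w * \prod_(u <- [::]) Y (u, w) * occ Y S w ^+ n)).
      apply: (@integrable_bdd _ _ _ _ _ (K * M ^+ 0 * (M * S) ^+ n)).
        exact: (meas P mV mY).
      exact: (bdd P mY VK YM [::]).
    rewrite -RintegralZl// -RintegralD//; last 2 first.
    - apply: (@integrable_bdd _ _ _ _ _ (K * expR (M * S))); first exact: ms.
      by move=> w; exact: bs.
    - by exact: integrable_mull.
    apply: eq_Rintegral => w _; rewrite big_nil mulr1 /s big_nat_recr//=; ring.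
  by rewrite !sS// IH moments_occ.
apply: (cvg_nat_unique (lim _ _ P1 V1 Y1 mV1 mY1 VK1 YM1)).
under eq_fun do rewrite e.
exact: lim.
Qed.

Lemma sin_occ : \int[P1]_w (V1 w * sin (occ Y1 S w)) = \int[P2]_w (V2 w * sin (occ Y2 S w)).
Proof.
apply: (@trig_occ (fun k => (odd k)%:R * (-1) ^+ k.-1./2 / k`!%:R) sin).
- move=> x; have := @cvg_sin_series x; apply: cvg_trans; apply: near_eq_cvg; apply: nearW => n.
  rewrite /series/=; apply: eq_bigr => k _; rewrite /sin_coeff/=; ring.
- move=> k x; apply: le_trans (sin_coeff_le x k); rewrite /sin_coeff/=.
  rewrite le_eqVlt; apply/orP; left; apply/eqP; congr (`|_|); ring.
Qed.

Lemma cos_occ : \int[P1]_w (V1 w * cos (occ Y1 S w)) = \int[P2]_w (V2 w * cos (occ Y2 S w)).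
Proof.
apply: (@trig_occ (fun k => (~~ odd k)%:R * (-1) ^+ k./2 / k`!%:R) cos).
- move=> x; have := @cvg_cos_series x; apply: cvg_trans; apply: near_eq_cvg; apply: nearW => n.
  rewrite /series/=; apply: eq_bigr => k _; rewrite /cos_coeff/= -exprnP; ring.
- move=> k x; apply: le_trans (cos_coeff_le x k); rewrite /cos_coeff/= -exprnP.
  rewrite le_eqVlt; apply/orP; left; apply/eqP; congr (`|_|); ring.
Qed.

End moments.

(** * Independence *)

Section independence.
Context (R : realType) d (T : measurableType d) (P : probability T R).

(** Independence says that the joint law is the product law; the rest is Fubini. *)
Lemma expect_indep d1 d2 (T1 : measurableType d1) (T2 : measurableType d2)
    (W : T -> T1) (D : T -> T2) (Phi : T1 * T2 -> R) (M : R) :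
  measurable_fun setT W -> measurable_fun setT D ->
  (forall A B, measurable A -> measurable B ->
     P (W @^-1` A `&` D @^-1` B) = (P (W @^-1` A) * P (D @^-1` B))%E) ->
  measurable_fun setT Phi -> (forall z, `|Phi z| <= M) ->
  \int[P]_w Phi (W w, D w) = \int[P]_w (\int[P]_v Phi (W w, D v)).
Proof.
move=> mW mD H mPhi PhiM.
have mWD : measurable_fun setT (fun w => (W w, D w)) by exact: measurable_fun_pair.
pose rW : {RV P >-> T1} := HB.pack W (isMeasurableFun.Build _ _ _ _ W mW).
pose rD : {RV P >-> T2} := HB.pack D (isMeasurableFun.Build _ _ _ _ D mD).
pose rWD : {RV P >-> (T1 * T2)%type} :=
  HB.pack (fun w => (W w, D w)) (isMeasurableFun.Build _ _ _ _ _ mWD).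
have M0 : 0 <= M by exact: le_trans (PhiM point).
have iPhi : (distribution P rW \x distribution P rD)%E.-integrable setT (EFin \o Phi).
  apply: (@integrable_prod_dom _ _ T1 T2 R (distribution P rW) (distribution P rD) Phi
    (cst M) (cst 1)) => //.
  - by apply: (@integrable_bdd _ _ _ _ _ `|M|).
  - by apply: (@integrable_bdd _ _ _ _ _ 1) => // x; rewrite normr1.
  - by move=> x y; rewrite /= mulr1.
have push d0 (T0 : measurableType d0) (r : {RV P >-> T0}) (h : T0 -> R) :
    measurable_fun setT h -> (forall x, `|h x| <= M) ->
    \int[distribution P r]_x h x = \int[P]_w h (r w).
  move=> mh hM; congr fine; rewrite integral_distribution//.
  - exact/measurable_EFinP.
  - apply: (@integrable_bdd _ _ _ _ _ M) => //.
    by apply: measurableT_comp.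
transitivity (\int[distribution P rWD]_z Phi z); first by rewrite push.
transitivity (\int[(distribution P rW \x distribution P rD)%E]_z Phi z).
  congr fine; apply: eq_measure_integral => A mA _.
  apply: esym; apply: product_measure_unique => // B C mB mC.
transitivity (\int[distribution P rW]_x (\int[distribution P rD]_y Phi (x, y))).
  rewrite /Rintegral -(integral12_prod_meas1 iPhi); congr fine.
  apply: eq_integral => x _; rewrite /fubini_F -Rint_EFin//.
  apply: (@integrable_bdd _ _ _ _ _ M) => //.
  exact: (measurable_fun_pair2 x mPhi).
rewrite push//.
- apply: eq_Rintegral => w _; rewrite push//.
  exact: (measurable_fun_pair2 (W w) mPhi).
- exact: (@measurable_Rint_param _ _ T1 T2 R (distribution P rD) setT Phi).
- move=> x; apply: Rint_prob_le => //.
  exact: (measurable_fun_pair2 x mPhi).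
Qed.

Lemma indep_sigma (C : set (set T)) (E : set T) : setI_closed C ->
  C `<=` measurable -> C setT -> measurable E ->
  (forall A, C A -> P (A `&` E) = (P A * P E)%E) ->
  forall A, <<s C >> A -> P (A `&` E) = (P A * P E)%E.
Proof.
move=> CI Cm CT mE H A sA.
have PE0 : 0 <= fine (P E) by rewrite fine_ge0.
have PEf : P E \is a fin_num by exact: fin_num_measure.
rewrite muleC -(fineK PEf).
apply: (@g_sigma_algebra_measure_unique _ _ _ C Cm (fun=> setT) _ _
  (mrestr P mE) (mscale (NngNum PE0) P)) => //.
- by apply/seteqP; split => // x _; exists 0%N.
- move=> B CB; rewrite /mrestr /mscale; apply: (eq_trans (H B CB)).
  by rewrite muleC -[in LHS](fineK PEf).
- move=> k; rewrite /mrestr; apply: (le_lt_trans (probability_le1 _ _) (ltry _)).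
  exact: measurableI.
Qed.

Lemma has_law_expect d' (T' : measurableType d') (P' : probability T' R)
    (Y : T -> R) (Y' : {RV P' >-> R}) (h : R -> R) (M : R) :
  measurable_fun setT Y -> has_law P Y (distribution P' Y') ->
  measurable_fun setT h -> (forall x, `|h x| <= M) ->
  \int[P]_w h (Y w) = \int[P']_w h (Y' w).
Proof.
move=> mY HY mh hM.
pose rY : {RV P >-> R} := HB.pack Y (isMeasurableFun.Build _ _ _ _ Y mY).
transitivity (\int[distribution P rY]_x h x).
  congr fine; rewrite integral_distribution//.
  - exact/measurable_EFinP.
  - by apply: (@integrable_bdd _ _ _ _ _ M) => //; exact: measurableT_comp.
transitivity (\int[distribution P' Y']_x h x).
  congr fine; apply: eq_measure_integral => A mA _.
  exact: HY.
congr fine; rewrite integral_distribution//.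
- exact/measurable_EFinP.
- by apply: (@integrable_bdd _ _ _ _ _ M) => //; exact: measurableT_comp.
Qed.

End independence.

(** * Joint measurability and the one-step Markov property *)

Section levy_increments.
Context (R : realType) d (T : measurableType d) (P : probability T R)
  (X : R -> {RV P >-> R}) (hX : levy_process X).

(** The process starts at 0 only almost surely; subtracting the initial value makes
    every identity hold for every [w]. *)
Definition Xo (s : R) (w : T) : R := X s w - X 0 w.

Lemma Xo0 w : Xo 0 w = 0.
Proof. by rewrite /Xo subrr. Qed.

Lemma measurable_X s : measurable_fun setT (X s : T -> R).
Proof. exact: measurable_funPT. Qed.

Lemma measurable_Xo s : measurable_fun setT (Xo s).
Proof. by apply: measurable_funB; exact: measurable_X. Qed.

Section joint.
Let m (k : nat) : R := k.+1%:R.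
Let grid (k : nat) (u : R) : nat := (Num.trunc (m k * Num.max 0 u)).+1.

Let m0 k : 0 < m k. Proof. by rewrite ltr0n. Qed.

Let grid_itv k u : Num.max 0 u < (grid k u)%:R / m k <= Num.max 0 u + (m k)^-1.
Proof.
have h : 0 <= m k * Num.max 0 u by rewrite mulr_ge0 ?(ltW (m0 k))// le_max lexx.
have /andP[h1 h2] := truncn_itv h.
rewrite ltr_pdivlMr ?m0// mulrC h2/= ler_pdivrMr ?m0// mulrDl mulVf ?gt_eqF ?m0//.
by rewrite /grid -natr1 lerD2r [leRHS]mulrC.
Qed.

Let measurable_grid k j : measurable [set u : R | grid k u = j.+1].
Proof.
have -> : [set u : R | grid k u = j.+1] =
    ((fun u : R => j%:R <= m k * Num.max 0 u) @^-1` [set true]) `&`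
    ((fun u : R => m k * Num.max 0 u < j.+1%:R) @^-1` [set true]).
  apply/seteqP; split => u /=.
    have h : 0 <= m k * Num.max 0 u by rewrite mulr_ge0 ?(ltW (m0 k))// le_max lexx.
    by move=> [<-]; have /andP[] := truncn_itv h.
  move=> [h1 h2]; rewrite /grid; congr S; apply: truncn_def.
  by rewrite h1 h2.
have mm : measurable_fun [set: R] (fun u : R => m k * Num.max 0 u).
  by apply: measurable_funM => //; exact: measurable_maxr.
apply: measurableI; rewrite -[X in measurable X]setTI.
- exact: (measurable_fun_ler (measurable_cst _) mm).
- exact: (measurable_fun_ltr mm (measurable_cst _)).
Qed.

Let approx k (z : R * T) : R := X ((grid k z.1)%:R / m k) z.2.

Let measurable_approx k : measurable_fun setT (approx k).
Proof.
move=> _ B mB; rewrite setTI.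
have -> : approx k @^-1` B = \bigcup_j
    ([set u : R | grid k u = j.+1] `*` (X (j.+1%:R / m k) @^-1` B)).
  apply/seteqP; split => [[u w]/= H|[u w] [j _] /= [gj]].
    exists (Num.trunc (m k * Num.max 0 u)) => //=.
  by rewrite /approx/= gj.
apply: bigcupT_measurable => j; apply: measurableX; first exact: measurable_grid.
by rewrite -[X in measurable X]setTI; exact: measurable_X.
Qed.

(** The approximations [X] at the next point of the grid of mesh [1/(k+1)] are jointly
    measurable, and converge by right continuity. The maximum with 0 makes all times
    admissible. *)
Lemma measurable_joint : measurable_fun setT (fun z : R * T => X (Num.max 0 z.1) z.2).
Proof.
apply: (measurable_fun_cvg measurable_approx) => z _.
have [rc _] := levy_cadlag hX z.2.
have u0 : 0 <= Num.max 0 z.1 by rewrite le_max lexx.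
have /cvg_at_rightP := rc _ u0; apply.
split=> [k|]; first by have /andP[] := grid_itv k z.1.
apply: (@squeeze_cvgr _ _ _ _ (fun=> Num.max 0 z.1) (fun k => Num.max 0 z.1 + (m k)^-1)).
- by apply: nearW => k; have /andP[/ltW -> ->] := grid_itv k z.1.
- exact: cvg_cst.
- rewrite -[X in _ --> X]addr0; apply: cvgD; first exact: cvg_cst.
  exact: cvg_harmonic.
Qed.

Lemma measurable_Xo_joint d0 (T0 : measurableType d0) (a : T0 -> R) (b : T0 -> T) :
  measurable_fun setT a -> measurable_fun setT b -> (forall z, 0 <= a z) ->
  measurable_fun setT (fun z => Xo (a z) (b z)).
Proof.
move=> ma mb a0; apply: measurable_funB; last exact: (measurableT_comp (measurable_X 0)).
rewrite (_ : (fun z => _) = (fun z => X (Num.max 0 z.1) z.2) \o (fun z => (a z, b z))).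
  by apply: (measurableT_comp measurable_joint); exact: measurable_fun_pair.
by apply/funext => z /=; rewrite max_r.
Qed.

End joint.

Section step.
Variable tau : nat -> R.
Hypotheses (tau0 : tau 0%N = 0) (tau_mono : forall i j, (i <= j)%N -> tau i <= tau j).
Let D (i : nat) (w : T) : R := X (tau i.+1) w - X (tau i) w.

Let mD i : measurable_fun setT (D i).
Proof. by apply: measurable_funB; exact: measurable_X. Qed.

Let cyl (n : nat) : set (set T) := [set A | exists B : nat -> set R,
  (forall i, measurable (B i)) /\ A = \bigcap_(i in `I_n) (D i @^-1` B i)].

Let cyl_indep n A E : cyl n A -> measurable E ->
  P (A `&` D n @^-1` E) = (P A * P (D n @^-1` E))%E.
Proof.
move=> [B [mB ->]] mE.
have H := @levy_independent _ _ _ _ _ hX n.+1 tau.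
rewrite tau0 in H; have {}H := H (lexx _) tau_mono.
pose J0 : {fset 'I_n.+1} := [fset i in 'I_n.+1 | (i < n)%N]%fset.
pose B' (i : 'I_n.+1) := if (i < n)%N then B i else E.
have mB' i : measurable (B' i) by rewrite /B'; case: ifP.
have H0 := H J0 B' mB'.
have H1 := H (ord_max |` J0)%fset B' mB'.
have maxJ0 : ord_max \notin J0 by rewrite !inE/= ltnn.
rewrite big_fsetU1//= -H0 in H1.
have e0 : \bigcap_(i in [set` J0]) (fun w => X (tau i.+1) w - X (tau i) w) @^-1` B' i =
    \bigcap_(i in `I_n) (D i @^-1` B i).
  apply/seteqP; split => w /= Hw.
    move=> i /= ni; have ni' := ltnW ni.
    have := Hw (Ordinal (ni' : (i < n.+1)%N)); rewrite /= /B' /= ni; apply.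
    by rewrite !inE.
  move=> i; rewrite /= !inE/= => ni; rewrite /B' ni.
  exact: (Hw i).
have e1 : \bigcap_(i in [set` (ord_max |` J0)%fset])
    (fun w => X (tau i.+1) w - X (tau i) w) @^-1` B' i =
    (\bigcap_(i in `I_n) (D i @^-1` B i)) `&` D n @^-1` E.
  rewrite set_fsetU1 bigcap_setU1 e0 setIC; congr (_ `&` _).
  by rewrite /B' /= ltnn.
rewrite -e1 -e0 H1 muleC; congr (_ * P _)%E.
by rewrite /B' /= ltnn.
Qed.

Let cylI n : setI_closed (cyl n).
Proof.
move=> _ _ [B [mB ->]] [B' [mB' ->]]; exists (fun i => B i `&` B' i); split.
  by move=> i; exact: measurableI.
by rewrite -bigcapI; apply: eq_bigcapr => i _; rewrite preimage_setI.
Qed.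

Let cyl_measurable n : cyl n `<=` measurable.
Proof.
move=> _ [B [mB ->]]; apply: bigcap_measurableType => i _.
by rewrite -[X in measurable X]setTI; exact: mD.
Qed.

Let cylT n : cyl n setT.
Proof.
exists (fun=> setT); split => //; apply/seteqP; split => //.
Qed.

Let sigma_indep n A E : <<s cyl n >> A -> measurable E ->
  P (A `&` D n @^-1` E) = (P A * P (D n @^-1` E))%E.
Proof.
move=> sA mE; apply: (indep_sigma (@cylI n) (@cyl_measurable n) (cylT n)) => //.
- by rewrite -[X in measurable X]setTI; exact: mD.
- by move=> B cB; exact: cyl_indep.
Qed.

Let D_sigma n i : (i < n)%N ->
  measurable_fun [set: g_sigma_algebraType (cyl n)] (D i : g_sigma_algebraType (cyl n) -> R).
Proof.
move=> ni _ B mB; rewrite setTI; apply: sub_sigma_algebra.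
exists (fun j => if j == i then B else setT); split; first by move=> j; case: ifP.
apply/seteqP; split => w /=; first by move=> Bw j _ /=; case: eqP => // ->.
by move=> /(_ i ni); rewrite /= eqxx.
Qed.

Let Xo_sum j w : Xo (tau j) w = \sum_(i < j) D i w.
Proof.
have e := telescope_sumr (fun i => X (tau i) w) (leq0n j).
by rewrite tau0 big_mkord in e.
Qed.

Let Xo_sigma n j : (j <= n)%N ->
  measurable_fun [set: g_sigma_algebraType (cyl n)] (Xo (tau j) : g_sigma_algebraType (cyl n) -> R).
Proof.
move=> jn; rewrite (_ : Xo (tau j) = fun w => \sum_(i < j) D i w); last first.
  by apply/funext => w; exact: Xo_sum.
apply: measurable_sum => i; apply: D_sigma.
exact: leq_trans (ltn_ord i) jn.
Qed.

(** The past up to [tau n] is measurable for the sigma-algebra generated by the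
    increments before [tau n], which is independent of the next increment. *)
Lemma markov_step n (h : nat -> R -> R) (k : R -> R) (Mh Mk : R) :
  (forall j, measurable_fun setT (h j)) -> measurable_fun setT k ->
  (forall w, `|\prod_(j < n.+1) h j (Xo (tau j) w)| <= Mh) -> (forall x, `|k x| <= Mk) ->
  \int[P]_w (\prod_(j < n.+1) h j (Xo (tau j) w) * k (Xo (tau n.+1) w)) =
  \int[P]_w (\prod_(j < n.+1) h j (Xo (tau j) w) *
     \int[P]_v k (Xo (tau n) w + Xo (tau n.+1 - tau n) v)).
Proof.
move=> mh mk hM kM.
have Mh0 : 0 <= Mh by exact: le_trans (hM point).
(* [V] is bounded along the process only, while [expect_indep] wants a bounded function of the pair: truncating at the bound changes nothing. *)
pose clip x : R := Num.max (- Mh) (Num.min Mh x).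
have clipE x : `|x| <= Mh -> clip x = x.
  by rewrite ler_norml => /andP[x1 x2]; rewrite /clip (min_r x2) (max_r x1).
have clip_le x : `|clip x| <= Mh.
  by rewrite ler_norml /clip le_max lexx/= ge_max ge_min lexx andbT; lra.
have mclip : measurable_fun setT clip.
  apply: (measurable_maxr (measurable_cst _)).
  by apply: (measurable_minr (measurable_cst _)).
pose V w := \prod_(j < n.+1) h j (Xo (tau j) w).
have VE w : clip (V w) = V w by apply: clipE; exact: hM.
pose W w := (V w, Xo (tau n) w).
have sW : measurable_fun [set: g_sigma_algebraType (cyl n)] (W : g_sigma_algebraType (cyl n) -> R * R).
  apply: measurable_fun_pair; last exact: Xo_sigma.
  apply: measurable_prod => j _; apply: measurableT_comp => //.
  by apply: Xo_sigma; rewrite -ltnS.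
have mW : measurable_fun setT W.
  apply: measurable_fun_pair; last exact: measurable_Xo.
  apply: measurable_prod => j _; apply: measurableT_comp => //.
  exact: measurable_Xo.
pose Phi (z : (R * R) * R) : R := clip z.1.1 * k (z.1.2 + z.2).
have mPhi : measurable_fun setT Phi.
  apply: measurable_funM.
    by apply: measurableT_comp => //; exact: measurableT_comp.
  apply: measurableT_comp => //; apply: measurable_funD => //.
  exact: measurableT_comp.
have PhiM z : `|Phi z| <= Mh * Mk by rewrite normrM ler_pM.
transitivity (\int[P]_w Phi (W w, D n w)).
  apply: eq_Rintegral => w _; rewrite /Phi /= VE; congr (_ * k _).
  by rewrite !Xo_sum big_ord_recr.
rewrite (@expect_indep _ _ _ P _ _ _ _ W (D n) Phi (Mh * Mk))//; last first.
  move=> A E mA mE; apply: sigma_indep => //.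
  by have := sW measurableT A mA; rewrite setTI.
apply: eq_Rintegral => w _; rewrite /Phi/= VE.
have dt0 : 0 <= tau n.+1 - tau n by rewrite subr_ge0 tau_mono.
have tn0 : 0 <= tau n by rewrite -tau0 tau_mono.
have mkw : measurable_fun setT (fun x : R => k (Xo (tau n) w + x)).
  by apply: measurableT_comp => //; exact: measurable_funD.
rewrite RintegralZl//; last first.
  apply: (@integrable_bdd _ _ _ _ _ Mk) => //.
  exact: (measurableT_comp mkw (mD n)).
congr (_ * _).
have L1 := levy_stationary hX tn0 dt0.
have L2 := levy_stationary hX (lexx 0) dt0.
rewrite addrC subrK in L1; rewrite add0r in L2.
rewrite (has_law_expect (mD n) L1 mkw (fun x => kM _)).
rewrite -(has_law_expect _ L2 mkw (fun x => kM _))//.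
exact: measurable_Xo.
Qed.

End step.
End levy_increments.

(** * The Markov property for occupation integrals *)

Definition bdd_meas d (T : measurableType d) (R : realType) (g : T -> R) :=
  measurable_fun setT g /\ exists M, forall x, `|g x| <= M.

Section bdd_meas.
Context (R : realType) d (T : measurableType d).
Implicit Types g h : T -> R.

Lemma bdd_measM g h : bdd_meas g -> bdd_meas h -> bdd_meas (fun x => g x * h x).
Proof.
move=> [mg [M gM]] [mh [N hN]]; split; first exact: measurable_funM.
by exists (M * N) => x; rewrite normrM ler_pM.
Qed.

Lemma bdd_meas_cst (c : R) : bdd_meas (fun _ : T => c).
Proof. by split; [exact: measurable_cst|exists `|c|]. Qed.

Lemma bdd_meas_prod n (h : 'I_n -> T -> R) : (forall i, bdd_meas (h i)) ->
  bdd_meas (fun x => \prod_(i < n) h i x).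
Proof.
elim: n h => [|n IH] h H.
  by under eq_fun do rewrite big_ord0; exact: bdd_meas_cst.
under eq_fun do rewrite big_ord_recr/=.
by apply: bdd_measM => //; exact: IH.
Qed.

Lemma bdd_meas_seq I (h : I -> T -> R) (s : seq I) : (forall i, bdd_meas (h i)) ->
  bdd_meas (fun x => \prod_(i <- s) h i x).
Proof.
move=> H; elim: s => [|i s IH].
  by under eq_fun do rewrite big_nil; exact: bdd_meas_cst.
by under eq_fun do rewrite big_cons; exact: bdd_measM.
Qed.

Lemma bdd_meas_integrable (P : probability T R) g : bdd_meas g ->
  P.-integrable setT (EFin \o g).
Proof. by move=> [mg [M gM]]; exact: (@integrable_bdd _ _ _ _ _ M). Qed.

Lemma bdd_meas_comp d' (T' : measurableType d') (g : T -> R) (f : T' -> T) :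
  bdd_meas g -> measurable_fun setT f -> bdd_meas (g \o f).
Proof.
move=> [mg [M gM]] mf; split; first exact: measurableT_comp.
by exists M => x; exact: gM.
Qed.

Lemma bdd_meas_Rint d' (T' : measurableType d') (P : probability T' R) (F : T * T' -> R) :
  bdd_meas F -> bdd_meas (fun x => \int[P]_v F (x, v)).
Proof.
move=> [mF [M FM]]; split; first exact: (@measurable_Rint_param _ _ T T' R P setT F).
by exists M => x; apply: Rint_prob_le => //; exact: (measurable_fun_pair2 x mF).
Qed.

End bdd_meas.

Section product_probability.
Context (R : realType) d1 (T1 : measurableType d1) (P1 : probability T1 R)
  d2 (T2 : measurableType d2) (P2 : probability T2 R).

Lemma prod_setT : (P1 \x P2)%E setT = 1%E.
Proof.
rewrite -setXTT; transitivity (P1 setT * P2 setT)%E; first exact: product_measure1E.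
by rewrite !probability_setT mule1.
Qed.

Definition prodP : probability (T1 * T2)%type R :=
  HB.pack (P1 \x P2)%E (Measure_isProbability.Build _ _ _ (P1 \x P2)%E prod_setT).

Lemma Rint_prodP (F : T1 * T2 -> R) : bdd_meas F ->
  \int[prodP]_z F z = \int[P1]_x (\int[P2]_y F (x, y)).
Proof.
move=> [mF [M FM]].
have i1 : P1.-integrable setT (EFin \o cst M) by apply: (@integrable_bdd _ _ _ _ _ `|M|).
have i2 : P2.-integrable setT (EFin \o cst 1).
  by apply: (@integrable_bdd _ _ _ _ _ 1) => // x; rewrite normr1.
have FM' x y : `|F (x, y)| <= cst M x * cst 1 y by rewrite mulr1.
have iF := integrable_prod_dom mF i1 i2 FM'.
transitivity (fine (\int[(P1 \x P2)%E]_z (F z)%:E)%E) => //.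
rewrite -(integral12_prod_meas1 iF) /Rintegral; congr fine.
apply: eq_integral => x _; rewrite /fubini_F -Rint_EFin//.
exact: (integrable_pair1 mF i2 FM').
Qed.

End product_probability.

Section markov.
Context (R : realType) d (T : measurableType d) (P : probability T R)
  (X : R -> {RV P >-> R}) (hX : levy_process X).
Notation Xo := (Xo X).

(** The expectation of the product of the [g] along the path started from [y], where
    each pair of the list gives the time elapsed since the previous one and the function
    evaluated there. *)
Fixpoint chain (l : seq (R * (R -> R))) (y : R) : R :=
  match l with
  | [::] => 1
  | (r, g) :: l' => \int[P]_v (g (y + Xo r v) * chain l' (y + Xo r v))
  end.

Fixpoint path_prod (l : seq (R * (R -> R))) (s : R) (w : T) : R :=
  match l with
  | [::] => 1
  | (r, g) :: l' => g (Xo (s + r) w) * path_prod l' (s + r) w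
  end.

Fixpoint nonneg_gaps (l : seq (R * (R -> R))) : Prop :=
  match l with
  | [::] => True
  | (r, g) :: l' => [/\ 0 <= r, bdd_meas g & nonneg_gaps l']
  end.

Lemma bdd_meas_chain l : nonneg_gaps l -> bdd_meas (chain l).
Proof.
elim: l => [|[r g] l IH] /=; first by move=> _; exact: bdd_meas_cst.
move=> [r0 bg gl].
have bk : bdd_meas (fun y => g y * chain l y) by apply: bdd_measM => //; exact: IH.
apply: (@bdd_meas_Rint _ _ R _ T P (fun z => g (z.1 + Xo r z.2) * chain l (z.1 + Xo r z.2))).
apply: (bdd_meas_comp (f := fun z : R * T => z.1 + Xo r z.2) bk).
apply: measurable_funD => //.
exact: (measurableT_comp (measurable_Xo X r)).
Qed.

(** Peeling the list from the front: the one-step Markov property [markov_step] is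
    applied at the first gap, with all earlier factors kept as functions of the past. *)
Lemma path_prod_chain l n (tau : nat -> R) (h : nat -> R -> R) : nonneg_gaps l ->
  tau 0%N = 0 -> (forall i j, (i <= j)%N -> tau i <= tau j) ->
  (forall j, bdd_meas (h j)) ->
  \int[P]_w (\prod_(j < n.+1) h j (Xo (tau j) w) * path_prod l (tau n) w) =
  \int[P]_w (\prod_(j < n.+1) h j (Xo (tau j) w) * chain l (Xo (tau n) w)).
Proof.
elim: l n tau h => [//|[r g] l IH] n tau h /= [r0 bg gl] t0 tm bh.
pose tau' i := if (i <= n)%N then tau i else tau n + r.
(* the first element of the list becomes the time of index [n + 1] *)
pose h' i := if (i <= n)%N then h i else g.
have t0' : tau' 0%N = 0 by rewrite /tau'.
have tm' i j : (i <= j)%N -> tau' i <= tau' j.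
  move=> ij; rewrite /tau'; case: (leqP j n) => jn.
    by rewrite (leq_trans ij jn) tm.
  case: (leqP i n) => // i_n; rewrite -[leLHS]addr0 lerD// tm//.
have bh' j : bdd_meas (h' j) by rewrite /h'; case: ifP.
have tn : tau' n = tau n by rewrite /tau' leqnn.
have tn1 : tau' n.+1 = tau n + r by rewrite /tau' ltnn.
have pE w : \prod_(j < n.+1) h' j (Xo (tau' j) w) = \prod_(j < n.+1) h j (Xo (tau j) w).
  apply: eq_bigr => j _; have jn : (j <= n)%N by rewrite -ltnS.
  by rewrite /h' /tau' jn.
transitivity (\int[P]_w (\prod_(j < n.+2) h' j (Xo (tau' j) w) * path_prod l (tau' n.+1) w)).
  apply: eq_Rintegral => w _; rewrite [in RHS]big_ord_recr/= pE tn1 mulrA.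
  by rewrite /h' ltnn.
rewrite (IH n.+1 tau' h' gl t0' tm' bh').
have bk : bdd_meas (fun y => g y * chain l y).
  by apply: bdd_measM => //; exact: bdd_meas_chain.
have [mk [Mk kM]] := bk.
have bV : bdd_meas (fun w => \prod_(j < n.+1) h' j (Xo (tau' j) w)).
  apply: bdd_meas_prod => j; apply: (bdd_meas_comp (f := Xo (tau' j)) (bh' j)).
  exact: measurable_Xo.
have [_ [Mh hM]] := bV.
have mh' j : measurable_fun setT (h' j) by have [] := bh' j.
have := @markov_step _ _ _ _ _ hX tau' t0' tm' n h' _ Mh Mk mh' mk hM kM.
rewrite tn1 tn (_ : tau n + r - tau n = r); last by ring.
move=> E.
transitivity (\int[P]_w (\prod_(j < n.+1) h' j (Xo (tau' j) w) *
    (g (Xo (tau n + r) w) * chain l (Xo (tau n + r) w)))).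
  apply: eq_Rintegral => w _; rewrite big_ord_recr/= tn1 -mulrA.
  by congr (_ * (_ * _)); rewrite /h' ltnn.
by rewrite E; apply: eq_Rintegral => w _; rewrite pE.
Qed.

Fixpoint gaps (f : R -> R) (a : R) (us : seq R) : seq (R * (R -> R)) :=
  match us with
  | [::] => [::]
  | u :: us' => (u - a, f) :: gaps f u us'
  end.

Lemma good_gaps f a us : bdd_meas f -> path <=%R a us -> nonneg_gaps (gaps f a us).
Proof.
move=> bf; elim: us a => [//|u us IH] a /= /andP[au pu]; split=> //.
  by rewrite subr_ge0.
exact: IH.
Qed.

Lemma path_prod_gaps f a us s w :
  path_prod (gaps f a us) (s + a) w = \prod_(u <- us) f (Xo (s + u) w).
Proof.
elim: us a => [|u us IH] a /=; first by rewrite big_nil.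
rewrite big_cons (_ : s + a + (u - a) = s + u); last by ring.
by rewrite IH.
Qed.

Lemma chain_shift f a us y z :
  chain (gaps f a us) (y + z) = chain (gaps (fun x => f (y + x)) a us) z.
Proof.
elim: us a z => [//|u us IH] a z /=.
by apply: eq_Rintegral => v _; rewrite -addrA IH.
Qed.

(** The times are first sorted, since [chain] expects successive gaps. *)
Lemma mixed_moments (h f : R -> R) (s : R) (us : seq R) : 0 <= s ->
  bdd_meas h -> bdd_meas f -> all (fun u => 0 <= u) us ->
  \int[P]_w (h (Xo s w) * \prod_(u <- us) f (Xo (s + u) w)) =
  \int[P]_w (h (Xo s w) * \int[P]_v \prod_(u <- us) f (Xo s w + Xo u v)).
Proof.
move=> s0 bh bf us0.
pose vs := sort <=%R us.
have pvs : perm_eq us vs by rewrite perm_sym perm_sort.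
have ps : path <=%R 0 vs.
  rewrite path_min_sorted; first exact: sort_le_sorted.
  apply/allP => u; rewrite mem_sort => uus; exact: (allP us0).
transitivity (\int[P]_w (h (Xo s w) * path_prod (gaps f 0 vs) s w)).
  apply: eq_Rintegral => w _; rewrite (perm_big _ pvs)/=; congr (_ * _).
  by rewrite -[in RHS](addr0 s) path_prod_gaps.
have gl := good_gaps bf ps.
pose tau i : R := if i is 0%N then 0 else s.
pose expect_occ i : R -> R := if i is 0%N then fun=> 1 else h.
have tm i j : (i <= j)%N -> tau i <= tau j.
  by case: i j => [|i] [|j].
have bhh j : bdd_meas (expect_occ j) by case: j => [|j] //=; exact: bdd_meas_cst.
have := path_prod_chain 1 gl (erefl : tau 0%N = 0) tm bhh.
under eq_Rintegral => w _ do rewrite !big_ord_recl big_ord0 /= mul1r mulr1.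
under [X in _ = X -> _]eq_Rintegral => w _ do rewrite !big_ord_recl big_ord0 /= mul1r mulr1.
move=> ->.
apply: eq_Rintegral => w _; congr (_ * _).
rewrite -[in LHS](addr0 (Xo s w)) chain_shift.
set f' := fun x => f (Xo s w + x).
have bf' : bdd_meas f'.
  by apply: (bdd_meas_comp (f := fun x => Xo s w + x) bf); exact: measurable_funD.
have gl' := good_gaps bf' ps.
have := path_prod_chain 0 gl' (erefl : (fun _ : nat => 0 : R) 0%N = 0) (fun _ _ _ => lexx 0)
  (fun _ => @bdd_meas_cst _ _ _ 1).
under eq_Rintegral => v _ do rewrite !big_ord_recl big_ord0 /= mul1r mul1r.
under [X in _ = X -> _]eq_Rintegral => v _ do rewrite !big_ord_recl big_ord0 /= mul1r mul1r Xo0.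
rewrite Rint_prob_cst => <-.
apply: eq_Rintegral => v _; rewrite (perm_big _ pvs)/=.
have := path_prod_gaps f' 0 vs 0 v; rewrite (add0r (0 : R)) => ->.
by apply: eq_bigr => u _; rewrite add0r.
Qed.

Definition occX (f : R -> R) (s S : R) (w : T) : R :=
  \int[lebesgue_measure]_(u in `[0, S]) f (Xo (s + u) w).

Section functional.
Variables (f h : R -> R) (M s S x : R).
Hypotheses (mf : measurable_fun setT f) (fM : forall x, `|f x| <= M) (bh : bdd_meas h)
  (s0 : 0 <= s) (S0 : 0 <= S).

Let Y1 (z : R * T) : R := f (x + Xo (s + Num.max 0 z.1) z.2).
Let Y2 (z : R * (T * T)) : R := f (x + (Xo s z.2.1 + Xo (Num.max 0 z.1) z.2.2)).

Let max0 (u : R) : 0 <= Num.max 0 u. Proof. by rewrite le_max lexx. Qed.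

Let mY1 : measurable_fun setT Y1.
Proof.
apply: measurableT_comp => //; apply: measurable_funD => //.
apply: (measurable_Xo_joint hX) => //.
- by apply: measurable_funD => //; apply: measurable_maxr.
- by move=> z; rewrite addr_ge0.
Qed.

Let mY2 : measurable_fun setT Y2.
Proof.
apply: measurableT_comp => //; apply: measurable_funD => //; apply: measurable_funD.
  apply: (measurableT_comp (measurable_Xo X s)).
  by apply: (measurableT_comp (f := fst)).
apply: (measurable_Xo_joint hX) => //.
- by apply: measurable_maxr.
- by apply: (measurableT_comp (f := snd)).
Qed.

Let V1 (w : T) : R := h (Xo s w).
Let V2 (z : T * T) : R := h (Xo s z.1).

Let bV1 : bdd_meas V1.
Proof. by apply: (bdd_meas_comp (f := Xo s) bh); exact: measurable_Xo. Qed.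

Let bV2 : bdd_meas V2.
Proof.
apply: (bdd_meas_comp (f := fun z => Xo s z.1) bh).
exact: (measurableT_comp (measurable_Xo X s)).
Qed.

Let H (us : seq R) : all (fun u => 0 <= u) us ->
  \int[P]_w (V1 w * \prod_(u <- us) Y1 (u, w)) =
  \int[prodP P P]_w (V2 w * \prod_(u <- us) Y2 (u, w)).
Proof.
move=> us0.
have bf' : bdd_meas (fun y => f (x + y)).
  split; last by exists M => y.
  by apply: measurableT_comp => //; exact: measurable_funD.
rewrite Rint_prodP; last first.
  apply: bdd_measM => //; apply: bdd_meas_seq => u.
  split; last by exists M => y; exact: fM.
  exact: (measurable_fun_pair2 u mY2).
have maxE u : u \in us -> Num.max 0 u = u.
  by move=> uus; rewrite max_r//; exact: (allP us0).
transitivity (\int[P]_w (h (Xo s w) * \prod_(u <- us) f (x + Xo (s + u) w))).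
  apply: eq_Rintegral => w _; congr (_ * _); apply: eq_big_seq => u uus.
  by rewrite /Y1/= maxE.
rewrite (mixed_moments s0 bh bf' us0); apply: eq_Rintegral => w _.
rewrite -RintegralZl//; last first.
  apply: bdd_meas_integrable; apply: bdd_meas_seq => u.
  split; last by exists M => y; exact: fM.
  apply: measurableT_comp => //; apply: measurable_funD => //; apply: measurable_funD => //.
  exact: measurable_Xo.
apply: eq_Rintegral => v _; congr (_ * _); apply: eq_big_seq => u uus.
by rewrite /Y2/= maxE.
Qed.

Let occ1 w : occ Y1 S w = occX (fun y => f (x + y)) s S w.
Proof.
apply: eq_Rintegral => u; rewrite inE/= in_itv/= => /andP[u0 _].
by rewrite /Y1/= max_r.
Qed.

Let occ2 w v : occ Y2 S (w, v) = occX (fun y => f (x + Xo s w + y)) 0 S v.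
Proof.
apply: eq_Rintegral => u; rewrite inE/= in_itv/= => /andP[u0 _].
by rewrite /Y2/= max_r// add0r addrA.
Qed.

Let markov_gen (phi : R -> R) : (forall y, `|phi y| <= 1) -> measurable_fun setT phi ->
  \int[P]_w (V1 w * phi (occ Y1 S w)) = \int[prodP P P]_w (V2 w * phi (occ Y2 S w)) ->
  \int[P]_w (h (Xo s w) * phi (occX (fun y => f (x + y)) s S w)) =
  \int[P]_w (h (Xo s w) * \int[P]_v phi (occX (fun y => f (x + Xo s w + y)) 0 S v)).
Proof.
move=> phi1 mphi.
under eq_Rintegral do rewrite occ1.
move=> ->.
have mo : measurable_fun setT (fun w => phi (occ Y2 S w)).
  by apply: measurableT_comp => //; exact: measurable_occ.
rewrite Rint_prodP; last first.
  by apply: bdd_measM => //; split => //; exists 1 => z; exact: phi1.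
have ip w : P.-integrable setT (EFin \o (fun v => phi (occ Y2 S (w, v)))).
  apply: (@integrable_bdd _ _ _ _ _ 1); last by move=> z; exact: phi1.
  exact: (measurable_fun_pair2 w mo).
apply: eq_Rintegral => w _; rewrite /V2 /= (RintegralZl _ measurableT (ip w)).
congr (_ * _); apply: eq_Rintegral => v _; congr (phi _); exact: occ2.
Qed.

(** The variables are compared through their mixed moments: on the left the path after
    time [s], on the right an independent copy of the path started from [x + Xo s w]. *)
Lemma markov_cos :
  \int[P]_w (h (Xo s w) * cos (occX (fun y => f (x + y)) s S w)) =
  \int[P]_w (h (Xo s w) * \int[P]_v cos (occX (fun y => f (x + Xo s w + y)) 0 S v)).
Proof.
have [mV1 _] := bV1; have [mV2 _] := bV2; have [_ [K hK]] := bh.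
apply: markov_gen; [exact: norm_cos_le1|exact: measurable_cos|].
exact: (@cos_occ _ _ _ P Y1 V1 _ _ (prodP P P) Y2 V2 M K S mY1 (fun=> fM _) mY2 (fun=> fM _)
  mV1 (fun=> hK _) mV2 (fun=> hK _) S0 H).
Qed.

Lemma markov_sin :
  \int[P]_w (h (Xo s w) * sin (occX (fun y => f (x + y)) s S w)) =
  \int[P]_w (h (Xo s w) * \int[P]_v sin (occX (fun y => f (x + Xo s w + y)) 0 S v)).
Proof.
have [mV1 _] := bV1; have [mV2 _] := bV2; have [_ [K hK]] := bh.
apply: markov_gen; [exact: norm_sin_le1|exact: measurable_sin|].
exact: (@sin_occ _ _ _ P Y1 V1 _ _ (prodP P P) Y2 V2 M K S mY1 (fun=> fM _) mY2 (fun=> fM _)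
  mV1 (fun=> hK _) mV2 (fun=> hK _) S0 H).
Qed.

End functional.
End markov.

(** * Inverse square roots as dominating functions *)

Section square_roots_section.
Context (R : realType).
Notation mu := (@lebesgue_measure R).

(** Used to change the value of a kernel at its singularity. *)
Lemma Rint_ae_pt (c : R) (h1 h2 : R -> R) : measurable_fun setT h1 -> measurable_fun setT h2 ->
  (forall z, z != c -> h1 z = h2 z) -> \int[mu]_z h1 z = \int[mu]_z h2 z.
Proof.
move=> m1 m2 H; congr fine; apply: ae_eq_integral => //.
- exact/measurable_EFinP.
- exact/measurable_EFinP.
- exists [set c]; split.
  + exact: measurable_set1.
  + exact: lebesgue_measure_set1.
  + move=> z /= Hz; apply: contrapT => zc; apply: Hz => _ /=.
    by rewrite H//; apply/eqP.
Qed.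

Lemma measurable_Rint_itv d (T0 : measurableType d) (a b : T0 -> R) (G : T0 * R -> R) :
  measurable_fun setT a -> measurable_fun setT b -> measurable_fun setT G ->
  measurable_fun setT (fun z => \int[mu]_(r in `[a z, b z]) G (z, r)).
Proof.
move=> ma mb mG.
pose E := [set z : T0 * R | a z.1 <= z.2 /\ z.2 <= b z.1].
have mE : measurable E.
  have -> : E = ((fun z : T0 * R => a z.1 <= z.2) @^-1` [set true]) `&`
     ((fun z : T0 * R => z.2 <= b z.1) @^-1` [set true]).
    by apply/seteqP; split => z /= [].
  have ma1 : measurable_fun setT (fun z : T0 * R => a z.1) by exact: measurableT_comp.
  have mb1 : measurable_fun setT (fun z : T0 * R => b z.1) by exact: measurableT_comp.
  apply: measurableI; rewrite -[X in measurable X]setTI.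
  - exact: (measurable_fun_ler ma1 measurable_snd).
  - exact: (measurable_fun_ler measurable_snd mb1).
rewrite (_ : (fun z => _) = (fun z => \int[mu]_r (\1_E (z, r) * G (z, r)))).
  apply: (@measurable_Rint_param _ _ T0 (measurableTypeR R) R mu setT
    (fun z => \1_E z * G z)) => //.
  by apply: measurable_funM => //; exact: measurable_indic.
apply/funext => z; rewrite Rintegral_mkcond; apply: eq_Rintegral => r _.
rewrite patchE indicE; case: ifPn => [/set_mem|/negP zr].
  by rewrite /= in_itv/= => /andP[h1 h2]; rewrite mem_set ?mul1r.
rewrite memNset ?mul0r// => -[/= h1 h2]; apply: zr; apply/mem_set.
by rewrite /= in_itv/= h1.
Qed.

Definition isqrt (z : R) : R := (Num.sqrt z)^-1.

Lemma isqrt_ge0 z : 0 <= isqrt z.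
Proof. by rewrite invr_ge0 sqrtr_ge0. Qed.

Lemma isqrt_le0 z : z <= 0 -> isqrt z = 0.
Proof. by move=> z0; rewrite /isqrt ler0_sqrtr// invr0. Qed.

Lemma measurable_sqrt : measurable_fun [set: R] (@Num.sqrt R).
Proof. exact: (continuous_measurable_fun (@sqrt_continuous R)). Qed.

Lemma measurable_isqrt : measurable_fun [set: R] isqrt.
Proof. by apply: (measurableT_comp (@measurable_invr R)); exact: measurable_sqrt. Qed.

Lemma isqrt_itv (a b : R) : 0 < a -> a <= b ->
  (\int[mu]_(s in `[a, b]) (isqrt s)%:E = (2 * Num.sqrt b - 2 * Num.sqrt a)%:E)%E.
Proof.
move=> a0 ab; apply: (ftc2 (F := fun x => 2 * Num.sqrt x)) => //.
- move=> x /andP[ax _]; have x0 : 0 < x by exact: lt_le_trans ax.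
  have H := is_derive1_sqrt x0.
  apply: is_derive_eq; rewrite /isqrt /GRing.scale/=.
  have : Num.sqrt x != 0 by rewrite gt_eqF// sqrtr_gt0.
  move=> h; field; exact: h.
- move=> x /andP[ax _]; have x0 : 0 < x by exact: lt_le_trans ax.
  apply: cvgV; last exact: sqrt_continuous.
  by rewrite gt_eqF// sqrtr_gt0.
Qed.

(** Monotone convergence along [[1/(n+1), S]], where the antiderivative is [2 sqrt]. *)
Lemma isqrt_int (S : R) : 0 <= S ->
  mu.-integrable `]0, S] (EFin \o isqrt) /\ \int[mu]_(s in `]0, S]) isqrt s <= 2 * Num.sqrt S.
Proof.
move=> S0.
pose I n : set (measurableTypeR R) := `[n.+1%:R^-1, S]%classic.
have ndI : nondecreasing_seq I.
  move=> m n mn; apply/subsetPset => x; rewrite /I /= !in_itv/= => /andP[h1 ->].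
  by rewrite andbT (le_trans _ h1)// lef_pV2 ?posrE// ler_nat.
have mI n : measurable_fun (I n) (EFin \o isqrt).
  by apply/measurable_funTS/measurable_EFinP; exact: measurable_isqrt.
have ge0I n x : I n x -> (0 <= (EFin \o isqrt) x)%E by move=> _; rewrite lee_fin isqrt_ge0.
have UI : \bigcup_n I n = `]0, S]%classic.
  apply/seteqP; split => [x [n _]|x]; rewrite /I/= !in_itv/=.
    by move=> /andP[h ->]; rewrite (lt_le_trans _ h)// invr_gt0.
  move=> /andP[x0 xS]; exists (Num.trunc x^-1) => //; rewrite /= in_itv/= xS andbT.
  have xV0 : 0 <= x^-1 by rewrite invr_ge0 ltW.
  have /andP[_ /ltW h] := truncn_itv xV0.
  by rewrite -[leRHS]invrK lef_pV2 ?posrE ?invr_gt0.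
have cv := @ge0_nondecreasing_set_cvg_integral _ _ _ I (EFin \o isqrt) mu ndI
  (fun=> measurable_itv _) mI ge0I.
rewrite UI in cv.
have le : (\int[mu]_(s in `]0%R, S]) (isqrt s)%:E <= (2 * Num.sqrt S)%:E)%E.
  apply: (cvge_to_le cv); apply: nearW => n; rewrite /I.
  have [h|h] := leP (n.+1%:R^-1) S.
    rewrite isqrt_itv// ?invr_gt0// lee_fin gerBl mulr_ge0//.
  by rewrite set_itv_ge ?integral_set0 ?lee_fin ?mulr_ge0 ?sqrtr_ge0// bnd_simp -ltNge.
have i : mu.-integrable `]0, S] (EFin \o isqrt).
  apply/integrableP; split.
    by apply/measurable_EFinP/measurable_funTS; exact: measurable_isqrt.
  under eq_integral do rewrite /= ger0_norm ?isqrt_ge0//.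
  by apply: (le_lt_trans le); exact: ltry.
by split => //; rewrite -lee_fin Rint_EFin.
Qed.

(** The singularity [|z|^(-1/2)] near the origin, which is integrable; the remainder is
    at most 1 ([isqrt_le1]). *)
Definition isq1 (z : R) : R := isqrt `|z| * \1_(`[-1, 1]%classic) z.

Lemma isq1_int : mu.-integrable setT (EFin \o isq1) /\ \int[mu]_z isq1 z <= 4.
Proof.
have [i le] := isqrt_int ler01.
pose q : R -> R := isqrt \_ `]0, 1]%classic.
have iq : mu.-integrable setT (EFin \o q).
  by rewrite -restrict_EFin; apply/(integrable_mkcond _ _).1.
have iqr := integrable_reflect 0 iq.
have e z : isq1 z = q z + q (0 - z).
  rewrite /isq1 /q !patchE indicE !mem_setE !in_itv/= sub0r.
  case: (ltrgtP z 0) => z0.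
  - have -> : (-1 <= z <= 1) = (- z <= 1).
      by apply/idP/idP => [/andP[? ?]|?]; [lra|apply/andP; split; lra].
    rewrite (ltr0_norm z0) /= oppr_gt0 z0/= add0r.
    by case: (- z <= 1); rewrite ?mulr1 ?mulr0.
  - have -> : (-1 <= z <= 1) = (z <= 1).
      by apply/idP/idP => [/andP[? ?]|?]; [lra|apply/andP; split; lra].
    rewrite (gtr0_norm z0) /= oppr_gt0 (lt_gtF z0)/= addr0.
    by case: (z <= 1); rewrite ?mulr1 ?mulr0.
  - by rewrite z0 normr0 isqrt_le0// mul0r oppr0 ltxx/= addr0.
have -> : isq1 = (fun z => q z + q (0 - z)) by apply/funext => z; exact: e.
split; first exact: (integrableD _ iq iqr).
rewrite RintegralD// Rint_reflect// -Rintegral_mkcond.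
rewrite sqrtr1 in le; lra.
Qed.

Lemma isqrt_le1 (z : R) : isqrt `|z| <= 1 + isq1 z.
Proof.
rewrite /isq1 indicE mem_setE in_itv/= -ler_norml.
have [z1|z1] := leP `|z| 1; first by rewrite mulr1 lerDr.
rewrite mulr0 addr0 /isqrt invf_le1 ?sqrtr_gt0 ?(lt_trans _ z1)//.
by rewrite -[leLHS]sqrtr1 ler_sqrt ?(lt_trans _ z1)// ltW.
Qed.

End square_roots_section.

(** * Duhamel formula along a path *)

Section pathwise.
Context (R : realType).
Notation mu := (@lebesgue_measure R).
Variables (y : R -> R) (B S : R).
Hypotheses (my : measurable_fun setT y) (yB : forall s, `|y s| <= B) (S0 : 0 <= S).
Variables (H h : R -> R).
Hypotheses (mh : measurable_fun setT h) (h1 : forall a, `|h a| <= 1)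
  (hL : forall a b, `|h a - h b| <= `|a - b|)
  (HT : forall a b, `|H b - H a - h a * (b - a)| <= (b - a) ^+ 2).

Let tail (s : R) : R := \int[mu]_(r in `[s, S]) y r.

Let B0 : 0 <= B. Proof. exact: le_trans (yB 0). Qed.

Let yi a b : mu.-integrable `[a, b] (EFin \o y).
Proof. exact: (@integrable_itv_bdd _ _ _ _ B). Qed.

Let mtail : measurable_fun [set: R] tail.
Proof.
apply: (@measurable_Rint_itv _ _ R (fun s => s) (fun=> S) (fun z => y z.2)) => //.
exact: measurableT_comp.
Qed.

Let int_bound (g : R -> R) (C a b : R) : a <= b -> measurable_fun setT g ->
  (forall s, a <= s <= b -> `|g s| <= C) -> `|\int[mu]_(s in `[a, b]) g s| <= C * (b - a).
Proof.
move=> ab mg gC.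
have -> : C * (b - a) = \int[mu]_(u in `[a, b]) C.
  rewrite Rintegral_cst//= lebesgue_measure_itv/= lte_fin.
  by move: ab; rewrite le_eqVlt => /predU1P[<-|->]; rewrite ?ltxx ?subrr ?mulr0.
apply: Rint_le_norm => //.
- exact: measurable_funTS.
- by apply: (@integrable_itv_bdd _ _ _ _ `|C|).
Qed.

Let split_itv (g : R -> R) (a b c : R) : a <= b -> b <= c ->
  mu.-integrable `[a, c] (EFin \o g) ->
  \int[mu]_(s in `[a, c]) g s = \int[mu]_(s in `[a, b]) g s + \int[mu]_(s in `[b, c]) g s.
Proof.
move=> ab bc ig.
have := @Rintegral_itvB _ g (BLeft a) (BRight c) b ig.
rewrite !bnd_simp => /(_ ab bc) e.
rewrite -(@Rintegral_itv_obnd_cbnd _ b (BRight c)); last first.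
  by apply: integrableS ig => //; apply: subset_itvr; rewrite bnd_simp.
by rewrite -e; ring.
Qed.

Let Phi s := H (tail s) + \int[mu]_(r in `[0, s]) (y r * h (tail r)).

Let myh : measurable_fun [set: R] (fun r => y r * h (tail r)).
Proof. by apply: measurable_funM => //; exact: measurableT_comp. Qed.

Let yhi a b : mu.-integrable `[a, b] (EFin \o (fun r => y r * h (tail r))).
Proof.
apply: (@integrable_itv_bdd _ _ _ _ B) => // r.
by rewrite normrM -[leRHS]mulr1 ler_pM.
Qed.

Let tail_diff a b : a <= b -> b <= S -> tail a - tail b = \int[mu]_(r in `[a, b]) y r.
Proof. by move=> ab bS; rewrite /tail (split_itv ab bS)// addrK. Qed.

Let Phi_diff a b : 0 <= a -> a <= b -> b <= S -> `|Phi b - Phi a| <= 2 * B ^+ 2 * (b - a) ^+ 2.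
Proof.
move=> a0 ab bS; have ba0 : 0 <= b - a by rewrite subr_ge0.
have tb u v : a <= u -> u <= v -> v <= b -> `|tail u - tail v| <= B * (b - a).
  move=> au uv vb; rewrite tail_diff//; last exact: le_trans bS.
  apply: (le_trans (int_bound uv my (fun s _ => yB s))).
  by rewrite ler_wpM2l//; lra.
have e1 : Phi b - Phi a = (H (tail b) - H (tail a) - h (tail a) * (tail b - tail a)) +
   \int[mu]_(r in `[a, b]) (y r * (h (tail r) - h (tail a))).
  rewrite /Phi (split_itv a0 ab)//.
  have -> : \int[mu]_(r in `[a, b]) (y r * (h (tail r) - h (tail a))) =
    \int[mu]_(r in `[a, b]) (y r * h (tail r)) - h (tail a) * \int[mu]_(r in `[a, b]) y r.
    rewrite -RintegralZl// -RintegralB//.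
    - by apply: eq_Rintegral => r _; ring.
    - by exact: integrable_mull.
  by rewrite -tail_diff//; ring.
rewrite e1 (le_trans (ler_normD _ _))//.
have q1 : `|H (tail b) - H (tail a) - h (tail a) * (tail b - tail a)| <= B ^+ 2 * (b - a) ^+ 2.
  apply: (le_trans (HT _ _)); rewrite -exprMn -[leLHS](real_normK (num_real _)).
  rewrite lerXn2r ?nnegrE ?mulr_ge0// distrC.
  exact: tb.
have q2 : `|\int[mu]_(r in `[a, b]) (y r * (h (tail r) - h (tail a)))| <= B ^+ 2 * (b - a) ^+ 2.
  have -> : B ^+ 2 * (b - a) ^+ 2 = (B * (B * (b - a))) * (b - a) by ring.
  apply: int_bound => //.
    apply: measurable_funM => //; apply: measurable_funB => //.
    exact: measurableT_comp.
  move=> s /andP[as_ sb]; rewrite normrM ler_pM// (le_trans (hL _ _))// distrC.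
  exact: tb.
lra.
Qed.

(** With [tail s = int_s^S y], the function [H (tail s) + int_0^s y h(tail)] has zero
    derivative, [h] being the derivative of [H]; it is differentiable only in an
    integrated sense as [y] is merely bounded, so instead its increment over an interval
    of length [dl] is shown to be [O(dl^2)], and [[0, S]] is cut into many equal pieces. *)
Lemma duhamel_gen :
  H (tail 0) - H 0 = \int[mu]_(s in `[0, S]) (y s * h (tail s)).
Proof.
have tS : tail S = 0 by rewrite /tail set_itv1 Rintegral_set1.
have P0 : Phi 0 = H (tail 0) by rewrite /Phi set_itv1 Rintegral_set1 addr0.
have PS : Phi S = H 0 + \int[mu]_(s in `[0, S]) (y s * h (tail s)) by rewrite /Phi tS.
suff : Phi S = Phi 0 by rewrite P0 PS => <-; ring.
(* [n + 1] steps of length [S / (n + 1)], each contributing at most [2 B^2] times its square *)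
pose C := 2 * B ^+ 2 * S ^+ 2.
have key n : `|Phi S - Phi 0| <= C * n.+1%:R^-1.
  pose t (i : nat) : R := i%:R * (S / n.+1%:R).
  have n0 : 0 < n.+1%:R :> R by rewrite ltr0n.
  have dS : 0 <= S / n.+1%:R by rewrite divr_ge0.
  have tn : t n.+1 = S by rewrite /t; field; rewrite gt_eqF.
  have t0 : t 0%N = 0 by rewrite /t mul0r.
  have step k : (k <= n.+1)%N -> `|Phi (t k) - Phi 0| <= k%:R * (2 * B ^+ 2 * (S / n.+1%:R) ^+ 2).
    elim: k => [|k IH] kn; first by rewrite t0 subrr normr0 mul0r.
    have -> : Phi (t k.+1) - Phi 0 = (Phi (t k.+1) - Phi (t k)) + (Phi (t k) - Phi 0) by ring.
    rewrite (le_trans (ler_normD _ _))// -natr1 mulrDl mul1r addrC lerD//; first exact: IH (ltnW kn).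
    have e : t k.+1 - t k = S / n.+1%:R by rewrite /t -natr1; ring.
    rewrite -e; apply: Phi_diff.
    - by rewrite mulr_ge0.
    - by rewrite -subr_ge0 e.
    - by rewrite -tn ler_wpM2r// ler_nat.
  have := step n.+1 (leqnn _); rewrite tn => /le_trans; apply.
  rewrite le_eqVlt; apply/orP; left; apply/eqP; rewrite /C; field.
  by rewrite gt_eqF.
apply/eqP; rewrite -subr_eq0 -normr_le0.
have cv : C * n.+1%:R^-1 @[n --> \oo] --> (C * 0 : R).
  by apply: cvgM; [exact: cvg_cst|exact: cvg_harmonic].
rewrite mulr0 in cv.
apply: (@ler_cvg_to _ _ _ _ (fun=> `|Phi S - Phi 0|) _ _ _ _ cv); first exact: cvg_cst.
exact: nearW.
Qed.

End pathwise.

(** * Elementary inequalities *)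

Section trig_ineq.
Context (R : realType).

Lemma mvt_any (F G : R -> R) (a b : R) : (forall x : R, is_derive x 1 F (G x)) ->
  exists c, `|c - a| <= `|b - a| /\ F b - F a = G c * (b - a).
Proof.
move=> dF.
have cF : continuous F.
  by move=> x; have [dx _] := dF x; apply: differentiable_continuous; exact/derivable1_diffP.
have [ab|ba|->] := ltrgtP a b.
- have [|c] := @MVT _ F G a b ab (fun x _ => dF x).
    exact: continuous_subspaceT.
  rewrite in_itv/= => /andP[ac cb] ->; exists c; split => //.
  by rewrite !ger0_norm; lra.
- have [|c] := @MVT _ F G b a ba (fun x _ => dF x).
    exact: continuous_subspaceT.
  rewrite in_itv/= => /andP[bc ca] e; exists c; split.
    by rewrite !ler0_norm; lra.
  by rewrite -[LHS]opprB e; ring.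
- by exists b; split; [rewrite !subrr normr0|rewrite !subrr mulr0].
Qed.

Lemma cos_lip (a b : R) : `|cos a - cos b| <= `|a - b|.
Proof.
have [c [_ ->]] := mvt_any b a (@is_derive_cos R).
by rewrite normrM normrN ler_piMl// norm_sin_le1.
Qed.

Lemma sin_lip (a b : R) : `|sin a - sin b| <= `|a - b|.
Proof.
have [c [_ ->]] := mvt_any b a (@is_derive_sin R).
by rewrite normrM ler_piMl// norm_cos_le1.
Qed.

Lemma sin_taylor (a b : R) : `|sin b - sin a - cos a * (b - a)| <= (b - a) ^+ 2.
Proof.
have [c [ca ->]] := mvt_any a b (@is_derive_sin R).
rewrite -mulrBl normrM -(real_normK (num_real (b - a))) expr2 ler_wpM2r//.
exact: le_trans (cos_lip _ _) ca.
Qed.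

Lemma cos_taylor (a b : R) : `|cos b - cos a - (- sin a) * (b - a)| <= (b - a) ^+ 2.
Proof.
have [c [ca ->]] := mvt_any a b (@is_derive_cos R).
rewrite -mulrBl normrM -(real_normK (num_real (b - a))) expr2 ler_wpM2r//.
rewrite -opprD normrN; exact: le_trans (sin_lip _ _) ca.
Qed.

(** With [a = sqrt S] and [b = sqrt (S - s)] this is [2 ln (a / b) <= 2 (a / b - 1) (a +
    b) / a]. *)
Lemma ln_ratio_le (s S : R) : 0 < s -> s < S ->
  ln (S / (S - s)) / s <= 2 * isqrt S * isqrt (S - s).
Proof.
move=> s0 sS; have S0 : 0 < S by lra.
have d0 : 0 < S - s by lra.
rewrite ler_pdivrMr//.
set a := Num.sqrt S; set b := Num.sqrt (S - s).
have a0 : 0 < a by rewrite sqrtr_gt0.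
have b0 : 0 < b by rewrite sqrtr_gt0.
have ea : S = a ^+ 2 by rewrite sqr_sqrtr// ltW.
have eb : S - s = b ^+ 2 by rewrite sqr_sqrtr// ltW.
have es : s = a ^+ 2 - b ^+ 2 by rewrite -ea -eb; ring.
have ba : b <= a by rewrite ler_sqrt; lra.
rewrite /isqrt -/a -/b {1}ea eb -expr_div_n lnXn ?divr_gt0//.
have h : ln (a / b) <= a / b - 1.
  have := @le_ln1Dx R (a / b - 1); rewrite (addrC 1) subrK; apply.
  by rewrite ltrBrDl subrr divr_gt0.
rewrite es mulr2n.
have -> : 2 / a / b * (a ^+ 2 - b ^+ 2) = 2 * (a / b - 1) * ((a + b) / a).
  by field; rewrite !gt_eqF.
have h2 : 1 <= (a + b) / a by rewrite ler_pdivlMr// mul1r lerDl ltW.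
have h0 : 0 <= a / b - 1 by rewrite subr_ge0 ler_pdivlMr// mul1r.
have : 2 * (a / b - 1) * 1 <= 2 * (a / b - 1) * ((a + b) / a) by rewrite ler_wpM2l// mulr_ge0.
lra.
Qed.

End trig_ineq.

Section punctured_kernel_section.
Context (R : realType).
Notation mu := (@lebesgue_measure R).

(** The value 0 at the origin makes the bound [cauchy0_le] hold without exception. *)
Definition cauchy0 (s z : R) : R := cauchy s z * (z != 0)%:R.

Lemma cauchy0_ge0 s z : 0 < s -> 0 <= cauchy0 s z.
Proof. by move=> s0; rewrite /cauchy0 mulr_ge0// cauchy_ge0. Qed.

Lemma pi_ge1 : 1 <= pi :> R.
Proof. have := @pi_ge2 R; lra. Qed.

(** This is [s^(3/2) |z|^(1/2) <= s^2 + z^2]; the bound is integrable in [s] near 0 and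
    in [z] near 0. *)
Lemma cauchy0_le s z : 0 < s -> cauchy0 s z <= isqrt s * isqrt `|z|.
Proof.
move=> s0; rewrite /cauchy0; have [->|z0] := eqVneq z 0.
  by rewrite mulr0 mulr_ge0// isqrt_ge0.
rewrite mulr1; set a := Num.sqrt s; set b := Num.sqrt `|z|.
have zp : 0 < `|z| by rewrite normr_gt0.
have a0 : 0 < a by rewrite sqrtr_gt0.
have b0 : 0 < b by rewrite sqrtr_gt0.
have ea : s = a ^+ 2 by rewrite sqr_sqrtr// ltW.
have eb : z ^+ 2 = b ^+ 4 by rewrite (exprM b 2 2) sqr_sqrtr// real_normK// num_real.
apply: (@le_trans _ _ (s / (s ^+ 2 + z ^+ 2))).
  rewrite /cauchy ler_wpM2l ?(ltW s0)// lef_pV2 ?posrE ?mulr_gt0 ?pi_gt0 ?sum_sq_gt0//.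
  by rewrite ler_peMl ?pi_ge1// ltW// sum_sq_gt0.
rewrite /isqrt -/a -/b eb ea ler_pdivrMr; last first.
  by rewrite ltr_wpDr ?exprn_ge0 ?exprn_gt0 ?(ltW b0)// exprn_gt0.
have -> : a^-1 / b * ((a ^+ 2) ^+ 2 + b ^+ 4) = (a ^+ 4 + b ^+ 4) / (a * b).
  by field; rewrite !gt_eqF.
rewrite ler_pdivlMr ?mulr_gt0//.
have [ab|ba] := leP b a.
  have : a ^+ 3 * b <= a ^+ 3 * a by rewrite ler_wpM2l// exprn_ge0// ltW.
  have : 0 <= b ^+ 4 by rewrite exprn_ge0// ltW.
  have -> : a ^+ 2 * (a * b) = a ^+ 3 * b by ring.
  have -> : a ^+ 4 = a ^+ 3 * a by ring.
  lra.
have h : a ^+ 3 <= b ^+ 3 by rewrite lerXn2r ?nnegrE ?ltW.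
have : a ^+ 3 * b <= b ^+ 3 * b by rewrite ler_wpM2r// ltW.
have : 0 <= a ^+ 4 by rewrite exprn_ge0// ltW.
have -> : a ^+ 2 * (a * b) = a ^+ 3 * b by ring.
have -> : b ^+ 4 = b ^+ 3 * b by ring.
lra.
Qed.

Lemma measurable_cauchy0 d (T : measurableType d) (a b : T -> R) :
  measurable_fun setT a -> measurable_fun setT b ->
  measurable_fun setT (fun w => cauchy0 (a w) (b w)).
Proof.
move=> ma mb; apply: measurable_funM; first exact: measurable_cauchy2.
rewrite (_ : (fun w => _) = (\1_(~` [set 0]) : R -> R) \o b).
  by apply: measurableT_comp => //; apply: measurable_indic; exact: measurableC.
apply/funext => w /=; rewrite indicE in_setC; congr (_%:R).
by congr (nat_of_bool (~~ _)); apply/eqP/idP => [->|/set_mem//]; exact/mem_set.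
Qed.

Lemma integrable_sing (f : R -> R) (M x : R) : measurable_fun setT f ->
  (forall z, `|f z| <= M) -> mu.-integrable setT (EFin \o f) ->
  mu.-integrable setT (EFin \o (fun z => `|f z| * isqrt `|z - x|)) /\
  \int[mu]_z (`|f z| * isqrt `|z - x|) <= \int[mu]_z `|f z| + 4 * M.
Proof.
move=> mf fM fi.
have M0 : 0 <= M by exact: le_trans (fM 0).
have [i1 le1] := @isq1_int R.
have i1x := integrable_translate (- x) i1.
have in' : mu.-integrable setT (EFin \o (fun z => `|f z|)) by exact: integrable_norm.
have iM : mu.-integrable setT (EFin \o (fun z => M * isq1 (z - x))).
  by exact: integrable_mull.
have le z : `|f z| * isqrt `|z - x| <= `|f z| + M * isq1 (z - x).
  apply: (@le_trans _ _ (`|f z| * (1 + isq1 (z - x)))).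
    by rewrite ler_wpM2l// isqrt_le1.
  rewrite mulrDr mulr1 lerD2l ler_wpM2r// /isq1 mulr_ge0 ?isqrt_ge0//.
have mg : measurable_fun [set: R] (fun z => `|f z| * isqrt `|z - x|).
  apply: measurable_funM; first exact: measurableT_comp.
  apply: (measurableT_comp (@measurable_isqrt R)).
  by apply: measurableT_comp => //; exact: measurable_funB.
have ig : mu.-integrable setT (EFin \o (fun z => `|f z| * isqrt `|z - x|)).
  apply: (@integrable_dom _ _ _ mu setT _ (fun z => `|f z| + M * isq1 (z - x))) => //.
    exact: (integrableD _ in' iM).
  move=> z _; by rewrite ger0_norm ?mulr_ge0 ?isqrt_ge0//; exact: le.
split => //.
apply: (@le_trans _ _ (\int[mu]_z (`|f z| + M * isq1 (z - x)))).
  apply: le_Rintegral => //; exact: (integrableD _ in' iM).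
rewrite RintegralD// lerD2l RintegralZl// Rint_translate// mulrC ler_wpM2r//.
Qed.

End punctured_kernel_section.

(** * Duhamel formula in expectation *)

(** The Green kernel of the process killed at time [S]. *)
Definition green (R : realType) (S z : R) : R :=
  \int[@lebesgue_measure R]_(s in `]0, S[) cauchy0 s z.

Section transition.
Context (R : realType) d (T : measurableType d) (P : probability T R)
  (X : R -> {RV P >-> R}) (hX : symmetric_1stable_process X).
Notation mu := (@lebesgue_measure R).
Notation Xo := (Xo X).

Lemma Xo_expect (s : R) (h : R -> R) : 0 <= s -> bdd_meas h ->
  \int[P]_w h (Xo s w) = \int[P]_w h (X s w).
Proof.
move=> s0 [mh [M hM]].
have := levy_stationary hX.1 (lexx 0) s0; rewrite add0r => L.
exact: (has_law_expect (measurable_Xo X s) L mh hM).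
Qed.

Lemma bdd_meas_cos (x : R) : bdd_meas (fun y : R => cos (x * y)).
Proof.
split; last by exists 1 => y; exact: norm_cos_le1.
by apply: (measurableT_comp (@measurable_cos R)); exact: measurable_funM.
Qed.

Lemma bdd_meas_sin (x : R) : bdd_meas (fun y : R => sin (x * y)).
Proof.
split; last by exists 1 => y; exact: norm_sin_le1.
by apply: (measurableT_comp (@measurable_sin R)); exact: measurable_funM.
Qed.

Lemma Xo_cos (s x : R) : 0 <= s -> \int[P]_w cos (x * Xo s w) = expR (- (s * `|x|)).
Proof.
move=> s0; rewrite (Xo_expect s0 (bdd_meas_cos x)).
by have /(congr1 (@complex.Re R)) := hX.2 s x s0.
Qed.

Lemma Xo_sin (s x : R) : 0 <= s -> \int[P]_w sin (x * Xo s w) = 0.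
Proof.
move=> s0; rewrite (Xo_expect s0 (bdd_meas_sin x)).
by have /(congr1 (@complex.Im R)) := hX.2 s x s0.
Qed.

Lemma measurable_shift (c : R) : measurable_fun [set: R] (fun z => z - c).
Proof. exact: measurable_funB. Qed.

Lemma expect_Xo (g : R -> R) (s x : R) : 0 < s -> bdd_meas g ->
  mu.-integrable setT (EFin \o (fun z => g z * cauchy0 s (z - x))) /\
  \int[P]_w g (x + Xo s w) = \int[mu]_z (g z * cauchy0 s (z - x)).
Proof.
move=> s0 [mg [M gM]].
have M0 : 0 <= M by exact: le_trans (gM 0).
have mU : measurable_fun setT (fun w => x + Xo s w).
  by apply: measurable_funD => //; exact: measurable_Xo.
have ip : mu.-integrable setT (EFin \o (fun z => cauchy s (z - x))).
  by apply: (integrable_translate (- x)); exact: integrable_cauchy.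
have [i ->] := expect_density mU (fun z => cauchy_ge0 (z - x) s0) ip
  (cauchy_law x (measurable_Xo X s) s0 (fun x => Xo_cos x (ltW s0)) (fun x => Xo_sin x (ltW s0)))
  mg gM.
have mc : measurable_fun [set: R] (fun z => cauchy s (z - x)).
  exact: (measurable_cauchy2 (measurable_cst s) (measurable_shift x)).
have mc0 : measurable_fun [set: R] (fun z => cauchy0 s (z - x)).
  exact: (measurable_cauchy0 (measurable_cst s) (measurable_shift x)).
split.
  apply: (@integrable_dom _ _ _ mu setT _ (fun z => M * cauchy s (z - x))) => //.
  - exact: measurable_funM.
  - by exact: integrable_mull.
  - move=> z _; rewrite normrM ler_pM//.
    rewrite ger0_norm ?cauchy0_ge0// /cauchy0.
    by rewrite -[leRHS]mulr1 ler_wpM2l ?cauchy_ge0//; case: (_ != 0).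
apply: (@Rint_ae_pt _ x) => [||z zx].
- exact: measurable_funM.
- exact: measurable_funM.
- by rewrite /cauchy0 subr_eq0 zx mulr1.
Qed.

Section bounded_f.
Variables (f : R -> R) (M : R).
Hypotheses (mf : measurable_fun setT f) (fM : forall x, `|f x| <= M)
  (fi : mu.-integrable setT (EFin \o f)).

(** The constant in [expect_abs_Xo]: the Cauchy density at time [s] is at most [1 / (pi
    s)]. *)
Definition decay_const : R := (\int[mu]_z `|f z|) / pi.

Let bf : bdd_meas f. Proof. by split => //; exists M. Qed.

Let fn : mu.-integrable setT (EFin \o (fun z => `|f z|)).
Proof. exact: integrable_norm. Qed.

Lemma decay_const_ge0 : 0 <= decay_const.
Proof. by rewrite divr_ge0// ?pi_ge0// Rintegral_ge0. Qed.

Lemma expect_abs_Xo (s x : R) : 0 < s -> \int[P]_w `|f (x + Xo s w)| <= decay_const / s.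
Proof.
move=> s0.
have bn : bdd_meas (fun z => `|f z|).
  by split; [exact: measurableT_comp|exists M => z; rewrite normr_id].
have [i ->] := expect_Xo x s0 bn.
have -> : decay_const / s = \int[mu]_z ((pi * s)^-1 * `|f z|).
  rewrite RintegralZl// /decay_const invfM; ring.
apply: le_Rintegral => //.
  by exact: integrable_mull.
move=> z _; rewrite mulrC ler_wpM2r//.
apply: le_trans (cauchy_le (z - x) s0); rewrite /cauchy0.
by rewrite -[leRHS]mulr1 ler_wpM2l ?cauchy_ge0//; case: (_ != 0).
Qed.

Lemma int_invr (a b : R) : 0 < a -> a <= b ->
  \int[mu]_(r in `[a, b]) r^-1 = ln (b / a).
Proof.
move=> a0 ab; have b0 : 0 < b by exact: lt_le_trans ab.
transitivity (ln b - ln a); last by rewrite ln_div.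
apply: (Rftc2 ab) => x /andP[ax _].
  by apply: is_derive1_ln; exact: lt_le_trans ax.
by apply: cvgV; [rewrite gt_eqF// (lt_le_trans a0)|exact: cvg_id].
Qed.

Variables (H h : R -> R).
Hypotheses (mH : measurable_fun setT H) (mh : measurable_fun setT h)
  (H1 : forall a, `|H a| <= 1) (h1 : forall a, `|h a| <= 1)
  (hL : forall a b, `|h a - h b| <= `|a - b|)
  (HT : forall a b, `|H b - H a - h a * (b - a)| <= (b - a) ^+ 2)
  (hM : forall (x s S : R) (g : R -> R), bdd_meas g -> 0 <= s -> 0 <= S ->
    \int[P]_w (g (Xo s w) * h (occX X (fun y => f (x + y)) s S w)) =
    \int[P]_w (g (Xo s w) * \int[P]_v h (occX X (fun y => f (x + Xo s w + y)) 0 S v))).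

Definition expect_occ (h : R -> R) (S z : R) : R := \int[P]_v h (occX X (fun y => f (z + y)) 0 S v).

Let Y (z : R * (R * T)) : R := f (z.2.1 + Xo (Num.max 0 z.1) z.2.2).

Let mY : measurable_fun setT Y.
Proof.
apply: measurableT_comp => //; apply: measurable_funD.
  by apply: (measurableT_comp (f := fst)).
apply: (measurable_Xo_joint hX.1) => //.
- by apply: measurable_maxr.
- by apply: (measurableT_comp (f := snd)).
- by move=> z; rewrite le_max lexx.
Qed.

Let occY S x w : occX X (fun y => f (x + y)) 0 S w = \int[mu]_(r in `[0, S]) Y (r, (x, w)).
Proof.
apply: eq_Rintegral => r; rewrite inE/= in_itv/= => /andP[r0 _].
by rewrite /Y/= add0r max_r.
Qed.

Let mocc S : measurable_fun setT (fun z : R * T => occX X (fun y => f (z.1 + y)) 0 S z.2).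
Proof.
under eq_fun do rewrite occY.
rewrite (_ : (fun z => _) = occ Y S); last by apply/funext => -[a b].
exact: (@measurable_Rint_param2 _ _ (measurableTypeR R) (R * T)%type R mu `[0, S]%classic Y).
Qed.

Lemma measurable_occX S :
  measurable_fun setT (fun z : R * T => occX X (fun y => f (z.1 + y)) 0 S z.2).
Proof. exact: mocc. Qed.

Lemma bdd_meas_expect_occ (k : R -> R) S : measurable_fun setT k -> (forall a, `|k a| <= 1) ->
  bdd_meas (expect_occ k S).
Proof.
move=> mk k1; apply: (@bdd_meas_Rint _ _ R _ T P
  (fun z => k (occX X (fun y => f (z.1 + y)) 0 S z.2))).
by split; [exact: measurableT_comp|exists 1].
Qed.

Lemma expect_occ_le1 (k : R -> R) S z : measurable_fun setT k -> (forall a, `|k a| <= 1) ->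
  `|expect_occ k S z| <= 1.
Proof.
move=> mk k1; apply: Rint_prob_le => //.
by apply: measurableT_comp => //; exact: (measurable_fun_pair2 z (mocc S)).
Qed.

Let mY1 x : measurable_fun setT (fun z : R * T => Y (z.1, (x, z.2))).
Proof.
apply: (measurableT_comp mY); apply: measurable_fun_pair => //.
exact: measurable_fun_pair.
Qed.

Let mYr x w : measurable_fun setT (fun r => Y (r, (x, w))).
Proof. exact: (measurableT_comp (mY1 x) (measurable_pair2 _)). Qed.

(** The two horizons differ by the interval [[S - s, S]], on which the expected size of
    [f] along the path is at most [decay_const / r] at time [r]. *)
Lemma expect_occ_horizon (s S z : R) : 0 < s -> s < S ->
  `|expect_occ h (S - s) z - expect_occ h S z| <= decay_const * ln (S / (S - s)).
Proof.
move=> s0 sS.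
have d0 : 0 < S - s by lra.
have mo U : measurable_fun setT (fun v => h (occX X (fun y => f (z + y)) 0 U v)).
  by apply: measurableT_comp => //; exact: (measurable_fun_pair2 z (mocc U)).
have io U : P.-integrable setT (EFin \o (fun v => h (occX X (fun y => f (z + y)) 0 U v))).
  by apply: (@integrable_bdd _ _ _ _ _ 1).
rewrite /expect_occ -RintegralB//.
pose F (q : T * R) : R := `|Y (q.2, (z, q.1))|.
have mF : measurable_fun setT F.
  apply: measurableT_comp => //; apply: (measurableT_comp mY).
  by apply: measurable_fun_pair => //; exact: measurable_fun_pair.
have i1 : P.-integrable setT (EFin \o cst M) by apply: (@integrable_bdd _ _ _ _ _ `|M|).
have i2 : mu.-integrable `[S - s, S] (EFin \o (cst 1 : R -> R)).
  by apply: (@integrable_itv_bdd _ _ _ _ 1) => // r; rewrite normr1.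
have bF v r : setT v -> `[S - s, S]%classic r -> `|F (v, r)| <= cst M v * cst 1 r.
  by move=> _ _; rewrite /F normr_id /= mulr1; exact: fM.
have fub := @Rfubini_on _ _ T (measurableTypeR R) R P mu setT `[S - s, S]%classic
  measurableT (measurable_itv _) F (cst M) (cst 1) mF i1 i2 bF.
have fub1 := @integrable_fub1_on _ _ T (measurableTypeR R) R P mu setT `[S - s, S]%classic
  measurableT (measurable_itv _) F (cst M) (cst 1) mF i1 i2 bF.
have fub2 := @integrable_fub2_on _ _ T (measurableTypeR R) R P mu setT `[S - s, S]%classic
  measurableT (measurable_itv _) F (cst M) (cst 1) mF i1 i2 bF.
apply: (@le_trans _ _ (\int[P]_v \int[mu]_(r in `[S - s, S]) F (v, r))).
  apply: Rint_le_norm => //; first exact: measurable_funB.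
  move=> v _; apply: (le_trans (hL _ _)).
  rewrite !occY distrC.
  have iY a b : mu.-integrable `[a, b] (EFin \o (fun r => Y (r, (z, v)))).
    by apply: (@integrable_itv_bdd _ _ _ _ M) => // r; exact: fM.
  have := @Rintegral_itvB _ (fun r => Y (r, (z, v))) (BLeft 0) (BRight S) (S - s) (iY _ _).
  rewrite !bnd_simp => /(_ (ltW d0)).
  have le : S - s <= S by lra.
  move=> /(_ le) ->.
  rewrite Rintegral_itv_obnd_cbnd; last first.
    by apply: integrableS (iY (S - s) S) => //; apply: subset_itvr; rewrite bnd_simp.
  apply: Rint_le_norm => //.
  - by apply: measurable_funTS; exact: mYr.
  - apply: (@integrable_itv_bdd _ _ _ _ M); last by move=> r; rewrite normr_id; exact: fM.
    exact: (measurableT_comp (@normr_measurable _ _) (mYr z v)).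
rewrite fub -int_invr//; last by lra.
have iv : mu.-integrable `[S - s, S] (EFin \o (fun r : R => r^-1)).
  apply: (@integrable_dom _ _ _ mu _ _ (cst (S - s)^-1)) => //.
  - by apply: measurable_funTS; exact: measurable_invr.
  - by apply: (@integrable_itv_bdd _ _ _ _ `|(S - s)^-1|).
  - move=> r; rewrite /= in_itv/= => /andP[ar _].
    have r0 : 0 < r by exact: lt_le_trans ar.
    by rewrite ger0_norm ?invr_ge0 ?(ltW r0)// lef_pV2 ?posrE.
rewrite -RintegralZl//.
apply: le_Rintegral => //.
  by exact: integrable_mull.
move=> r; rewrite /= in_itv/= => /andP[ar _].
have r0 : 0 < r by exact: lt_le_trans ar.
apply: le_trans (expect_abs_Xo z r0).
by rewrite le_eqVlt; apply/orP; left; apply/eqP/eq_Rintegral => v _; rewrite /F/Y/= max_r// ltW.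
Qed.

Lemma int_isqrt_rev (S : R) : 0 <= S ->
  mu.-integrable `]0, S[ (EFin \o (fun s => isqrt (S - s))) /\
  \int[mu]_(s in `]0, S[) isqrt (S - s) <= 2 * Num.sqrt S.
Proof.
move=> S0.
have [i le] := isqrt_int S0.
have i' : mu.-integrable `]0, S[ (EFin \o (@isqrt R)).
  by apply: integrableS i => //; apply: subset_itvl; rewrite bnd_simp.
pose q : R -> R := (@isqrt R) \_ `]0, S[%classic.
have iq : mu.-integrable setT (EFin \o q).
  by rewrite -restrict_EFin; apply/(integrable_mkcond _ _).1.
have iqr := integrable_reflect S iq.
have e : (fun s => q (S - s)) = (fun s => isqrt (S - s)) \_ `]0, S[%classic.
  apply/funext => s; rewrite /q !patchE !mem_setE !in_itv/=.
  have -> : (0 < S - s < S) = (0 < s < S) => //.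
  by apply/idP/idP => /andP[? ?]; apply/andP; split; lra.
rewrite e in iqr; split.
  by apply/(integrable_mkcond _ _).2 => //; rewrite restrict_EFin.
rewrite [leLHS]Rintegral_mkcond -e Rint_reflect// /q -Rintegral_mkcond.
rewrite -Rintegral_itv_bndo_bndc// in le.
Qed.

Lemma integrable_oo_bdd (g : R -> R) (C S : R) : measurable_fun setT g ->
  (forall s, `|g s| <= C) -> mu.-integrable `]0, S[ (EFin \o g).
Proof.
move=> mg gC; apply: integrableS (@integrable_itv_bdd _ _ 0 S _ mg gC) => //.
exact: subset_itvW.
Qed.

Let F1 S x (z : R * T) := Y (z.1, (x, z.2)) * h (\int[mu]_(r in `[z.1, S]) Y (r, (x, z.2))).

Let mF1 S x : measurable_fun setT (F1 S x).
Proof.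
apply: measurable_funM => //; apply: measurableT_comp => //.
apply: (@measurable_Rint_itv _ _ _ (fun z : R * T => z.1) (fun=> S)
  (fun q : (R * T) * R => Y (q.2, (x, q.1.2)))) => //.
  exact: measurable_fst.
apply: (measurableT_comp mY); apply: measurable_fun_pair => //.
by apply: measurable_fun_pair => //; apply: (measurableT_comp (f := snd)).
Qed.

Let F1M S x z : `|F1 S x z| <= M.
Proof. by rewrite normrM -[leRHS]mulr1 ler_pM//; exact: fM. Qed.

Let path S x w : 0 <= S ->
  H (occX X (fun y => f (x + y)) 0 S w) - H 0 = \int[mu]_(s in `[0, S]) F1 S x (s, w).
Proof.
move=> S0; rewrite occY.
exact: (duhamel_gen (mYr x w) (fun=> fM _) S0 mh h1 hL HT).
Qed.

Let F1_markov S x s : 0 < s -> s < S ->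
  \int[P]_w F1 S x (s, w) = \int[P]_w (f (x + Xo s w) * expect_occ h (S - s) (x + Xo s w)).
Proof.
move=> s0 sS.
have S0 : 0 <= S - s by lra.
have bg : bdd_meas (fun y => f (x + y)).
  by apply: (bdd_meas_comp (f := fun y => x + y) bf); exact: measurable_funD.
rewrite -(hM x bg (ltW s0) S0); apply: eq_Rintegral => w _.
rewrite /F1 /= Rint_itv_translate; last first.
  by apply: (@integrable_itv_bdd _ _ _ _ M); [exact: mYr|move=> r; exact: fM].
congr (_ * h _); first by rewrite /Y/= max_r// ltW.
apply: eq_Rintegral => u; rewrite inE/= in_itv/= => /andP[u0 _].
by rewrite /Y/= max_r// addr_ge0// ltW.
Qed.

Let G S x (z : R * T) := f (x + Xo (Num.max 0 z.1) z.2) * expect_occ h S (x + Xo (Num.max 0 z.1) z.2).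

Let mG S x : measurable_fun setT (G S x).
Proof.
have m0 : measurable_fun setT (fun z : R * T => x + Xo (Num.max 0 z.1) z.2).
  apply: measurable_funD => //; apply: (measurable_Xo_joint hX.1) => //.
  - by apply: measurable_maxr.
  - by move=> z; rewrite le_max lexx.
apply: measurable_funM; first exact: measurableT_comp.
have [mhh _] := bdd_meas_expect_occ S mh h1.
exact: measurableT_comp.
Qed.

Let GM S x z : `|G S x z| <= M.
Proof. by rewrite normrM -[leRHS]mulr1 ler_pM// expect_occ_le1. Qed.

(** Dominated by [s^(-1/2) * |f z| |z - x|^(-1/2)], a product of integrable functions. *)
Lemma green_fubini (S x : R) (g : R -> R) : 0 < S -> measurable_fun setT g ->
  (forall z, `|g z| <= 1) ->
  mu.-integrable setT (EFin \o (fun z => f z * g z * green S (z - x))) /\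
  \int[mu]_z (f z * g z * green S (z - x)) =
  \int[mu]_(s in `]0, S[) \int[mu]_z (f z * g z * cauchy0 s (z - x)).
Proof.
move=> S0 mg g1.
pose F (q : R * R) := f q.2 * g q.2 * cauchy0 q.1 (q.2 - x).
have mF : measurable_fun setT F.
  apply: measurable_funM; first by apply: measurable_funM; [exact: (measurableT_comp mf measurable_snd)|exact: (measurableT_comp mg measurable_snd)].
  by apply: measurable_cauchy0 => //; apply: measurable_funB.
have [i1 _] := isqrt_int (ltW S0).
have i1' : mu.-integrable `]0, S[ (EFin \o (@isqrt R)).
  by apply: integrableS i1 => //; apply: subset_itvl; rewrite bnd_simp.
have [i2 _] := integrable_sing x mf fM fi.
have bF s z : `]0, S[%classic s -> setT z -> `|F (s, z)| <= isqrt s * (`|f z| * isqrt `|z - x|).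
  rewrite /= in_itv/= => /andP[s0 _] _; rewrite /F/= normrM mulrCA.
  apply: ler_pM => //; first by rewrite normrM -[leRHS]mulr1 ler_pM.
  by rewrite ger0_norm ?cauchy0_ge0// cauchy0_le.
have fub := @Rfubini_on _ _ (measurableTypeR R) (measurableTypeR R) R mu mu `]0, S[%classic setT
  (measurable_itv _) measurableT F _ _ mF i1' i2 bF.
have fub2 := @integrable_fub2_on _ _ (measurableTypeR R) (measurableTypeR R) R mu mu `]0, S[%classic setT
  (measurable_itv _) measurableT F _ _ mF i1' i2 bF.
have ic z : mu.-integrable `]0, S[ (EFin \o (fun s => cauchy0 s (z - x))).
  apply: (@integrable_dom _ _ _ mu _ _ (fun s => isqrt s * isqrt `|z - x|)).
  - exact: measurable_itv.
  - by apply: measurable_funTS; exact: (@measurable_cauchy0 R _ (measurableTypeR R) (fun s => s) (fun=> z - x)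
      (@measurable_id _ _ _) (measurable_cst _)).
  - by apply: integrable_mulr; [exact: measurable_itv|exact: i1'].
  - move=> s; rewrite /= in_itv/= => /andP[s0 _].
    rewrite ger0_norm; [exact: cauchy0_le|exact: cauchy0_ge0].
have e : (fun z => f z * g z * green S (z - x)) = (fun z => \int[mu]_(s in `]0, S[) F (s, z)).
  apply/funext => z; rewrite /F/green/= RintegralZl; [by []|exact: measurable_itv|exact: ic].
rewrite e; split; [exact: fub2|exact: (esym fub)].
Qed.

(** Expectation of [duhamel_gen], with the horizon [S - s] replaced by [S]. The error at
    time [s] is at most [decay_const^2 ln (S / (S - s)) / s], whose integral over [[0,
    S]] is bounded independently of [S] by [ln_ratio_le]. *)
Lemma duhamel_expect (S x : R) : 0 < S ->
  `|\int[P]_w H (occX X (fun y => f (x + y)) 0 S w) - H 0 -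
    \int[mu]_z (f z * expect_occ h S z * green S (z - x))| <= 4 * decay_const ^+ 2.
Proof.
move=> S0.
have M0 : 0 <= M by exact: le_trans (fM 0).
have iocc : P.-integrable setT (EFin \o (fun w => H (occX X (fun y => f (x + y)) 0 S w))).
  apply: (@integrable_bdd _ _ _ _ _ 1) => //; apply: measurableT_comp => //.
  exact: (measurable_fun_pair2 x (mocc S)).
pose A s := \int[P]_w F1 S x (s, w).
pose B s := \int[P]_w G S x (s, w).
have mA : measurable_fun setT A by exact: (@measurable_Rint_param _ _ (measurableTypeR R) T R P setT (F1 S x) measurableT (mF1 S x)).
have mB : measurable_fun setT B by exact: (@measurable_Rint_param _ _ (measurableTypeR R) T R P setT (G S x) measurableT (mG S x)).
have AM s : `|A s| <= M.
  apply: Rint_prob_le; last by move=> w; exact: F1M.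
  exact: (measurableT_comp (mF1 S x) (measurable_pair1 s)).
have BM s : `|B s| <= M.
  apply: Rint_prob_le; last by move=> w; exact: GM.
  exact: (measurableT_comp (mG S x) (measurable_pair1 s)).
have iA := integrable_oo_bdd S mA AM.
have iB := integrable_oo_bdd S mB BM.
have eA : \int[P]_w H (occX X (fun y => f (x + y)) 0 S w) - H 0 = \int[mu]_(s in `]0, S[) A s.
  rewrite -(Rint_prob_cst P (H 0)) -RintegralB//; last first.
    exact: (@integrable_bdd _ _ _ _ _ `|H 0|).
  transitivity (\int[P]_w \int[mu]_(s in `]0, S[) F1 S x (s, w)).
    apply: eq_Rintegral => w _; rewrite path ?(ltW S0)//.
    have mw : measurable_fun setT (fun s : R => F1 S x (s, w)).
      exact: (measurableT_comp (mF1 S x) (measurable_pair2 _)).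
    have iw := @integrable_itv_bdd _ _ 0 S _ mw (fun s => F1M S x (s, w)).
    rewrite Rintegral_itv_bndo_bndc; last by apply: integrableS iw => //; exact: subset_itvW.
    rewrite Rintegral_itv_obnd_cbnd//.
    by apply: integrableS iw => //; apply: subset_itvr; rewrite bnd_simp.
  have i1 : P.-integrable setT (EFin \o cst M) by apply: (@integrable_bdd _ _ _ _ _ `|M|).
  have i2 : mu.-integrable `]0, S[ (EFin \o (cst 1 : R -> R)).
    by apply: (@integrable_oo_bdd _ 1) => // r; rewrite normr1.
  pose F (z : T * R) := F1 S x (z.2, z.1).
  have mF : measurable_fun setT F.
    by apply: (measurableT_comp (mF1 S x)); exact: measurable_fun_pair.
  have bF w r : setT w -> `]0, S[%classic r -> `|F (w, r)| <= cst M w * cst 1 r.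
    by move=> _ _; rewrite /= mulr1; exact: F1M.
  exact: (@Rfubini_on _ _ T (measurableTypeR R) R P mu setT `]0, S[%classic
    measurableT (measurable_itv _) F (cst M) (cst 1) mF i1 i2 bF).
have eB : \int[mu]_z (f z * expect_occ h S z * green S (z - x)) = \int[mu]_(s in `]0, S[) B s.
  have [mhh _] := bdd_meas_expect_occ S mh h1.
  rewrite (proj2 (green_fubini x S0 mhh (fun z => expect_occ_le1 S z mh h1))).
  apply: eq_Rintegral => s; rewrite inE/= in_itv/= => /andP[s0 _].
  have bg := bdd_measM bf (bdd_meas_expect_occ S mh h1).
  rewrite -(proj2 (expect_Xo x s0 bg)); apply: eq_Rintegral => w _.
  by rewrite /G/= max_r// ltW.
rewrite eA eB -RintegralB//.
have [ir le] := int_isqrt_rev (ltW S0).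
apply: (@le_trans _ _ (\int[mu]_(s in `]0, S[) (2 * decay_const ^+ 2 * isqrt S * isqrt (S - s)))).
  apply: Rint_le_norm => //.
  - by apply: measurable_funTS; exact: measurable_funB.
  - by exact: integrable_mull.
  move=> s; rewrite /= in_itv/= => /andP[s0 sS].
  have mU : measurable_fun setT (fun w => x + Xo s w).
    by apply: measurable_funD => //; exact: measurable_Xo.
  have mfU := measurableT_comp mf mU.
  have mhU U := measurableT_comp (bdd_meas_expect_occ U mh h1).1 mU.
  have i3 U : P.-integrable setT (EFin \o (fun w => f (x + Xo s w) * expect_occ h U (x + Xo s w))).
    apply: (@integrable_bdd _ _ _ _ _ M); first exact: (measurable_funM mfU (mhU U)).
    by move=> w; rewrite normrM -[leRHS]mulr1 ler_pM// expect_occ_le1.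
  have -> : A s - B s = \int[P]_w (f (x + Xo s w) * (expect_occ h (S - s) (x + Xo s w) - expect_occ h S (x + Xo s w))).
    have -> : B s = \int[P]_w (f (x + Xo s w) * expect_occ h S (x + Xo s w)).
      by apply: eq_Rintegral => w _; rewrite /G/= max_r ?(ltW s0).
    have -> : A s = \int[P]_w (f (x + Xo s w) * expect_occ h (S - s) (x + Xo s w)) by exact: F1_markov.
    rewrite -(RintegralB measurableT (i3 (S - s)) (i3 S)).
    by apply: eq_Rintegral => w _; rewrite mulrBr.
  have ifa : P.-integrable setT (EFin \o (fun w => `|f (x + Xo s w)|)).
    apply: (@integrable_bdd _ _ _ _ _ M); last by move=> w; rewrite normr_id.
    exact: measurableT_comp.
  apply: (@le_trans _ _ (\int[P]_w (decay_const * ln (S / (S - s)) * `|f (x + Xo s w)|))).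
    apply: Rint_le_norm => //.
    - by apply: measurable_funM => //; exact: (measurable_funB (mhU _) (mhU _)).
    - by exact: integrable_mull.
    by move=> w _; rewrite normrM mulrC ler_wpM2r// expect_occ_horizon.
  rewrite RintegralZl//.
  have L := ln_ratio_le s0 sS.
  have l0 : 0 <= ln (S / (S - s)).
    by apply: ln_ge0; rewrite ler_pdivlMr ?mul1r ?subr_gt0// gerBl ltW.
  apply: (@le_trans _ _ (decay_const * ln (S / (S - s)) * (decay_const / s))).
    by rewrite ler_wpM2l ?expect_abs_Xo// mulr_ge0 ?decay_const_ge0.
  have -> : decay_const * ln (S / (S - s)) * (decay_const / s) = decay_const ^+ 2 * (ln (S / (S - s)) / s) by ring.
  have -> : 2 * decay_const ^+ 2 * isqrt S * isqrt (S - s) = decay_const ^+ 2 * (2 * isqrt S * isqrt (S - s)) by ring.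
  by rewrite ler_wpM2l// sqr_ge0.
rewrite RintegralZl//.
apply: (@le_trans _ _ (2 * decay_const ^+ 2 * isqrt S * (2 * Num.sqrt S))).
  apply: ler_wpM2l; last exact: le.
  apply: mulr_ge0; last exact: isqrt_ge0.
  by apply: mulr_ge0; [exact: ler0n|exact: sqr_ge0].
rewrite le_eqVlt; apply/orP; left; apply/eqP.
have : Num.sqrt S != 0 by rewrite gt_eqF// sqrtr_gt0.
by rewrite /isqrt => q0; field.
Qed.

End bounded_f.
End transition.

Section fubini_sections.
Context d1 d2 (T1 : measurableType d1) (T2 : measurableType d2) (R : realType).
Variables (m1 : {sigma_finite_measure set T1 -> \bar R})
          (m2 : {sigma_finite_measure set T2 -> \bar R}).

(** For kernels that depend on [y - x] with a singularity on the diagonal, which no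
    product of functions of [x] and of [y] dominates conveniently. *)
Lemma Rfubini_sections (F : T1 * T2 -> R) (g : T1 -> R) : measurable_fun setT F ->
  (forall x, m2.-integrable setT (EFin \o (fun y => F (x, y)))) ->
  (forall y, m1.-integrable setT (EFin \o (fun x => F (x, y)))) ->
  m1.-integrable setT (EFin \o g) -> (forall x, \int[m2]_y `|F (x, y)| <= g x) ->
  \int[m1]_x (\int[m2]_y F (x, y)) = \int[m2]_y (\int[m1]_x F (x, y)).
Proof.
move=> mF i2 i1 ig le.
have iF : (m1 \x m2)%E.-integrable setT (EFin \o F).
  apply/integrable12ltyP; first exact/measurable_EFinP.
  apply: (@le_lt_trans _ _ (\int[m1]_x (g x)%:E)%E).
    apply: ge0_le_integral => //=.
    - by move=> x _; exact: integral_ge0.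
    - apply: (@measurable_fun_fubini_tonelli_F _ _ _ _ _ m2 (fun z => `|(F z)%:E|%E)) => //.
      by apply: measurableT_comp => //; exact/measurable_EFinP.
    - by have /measurable_int := ig.
    - move=> x _; rewrite -Rint_EFin//; last exact: (integrable_norm (i2 x)).
      by rewrite lee_fin.
  by rewrite -Rint_EFin// ltry.
have := Fubini iF.
rewrite /Rintegral => e; congr fine.
transitivity (\int[m1]_x \int[m2]_y (EFin \o F) (x, y))%E.
  by apply: eq_integral => x _; rewrite -Rint_EFin.
by rewrite e; apply: eq_integral => y _; rewrite -Rint_EFin.
Qed.

End fubini_sections.

(** * Logarithmic splitting of the Green kernel *)

Section kernel.
Context (R : realType).
Notation mu := (@lebesgue_measure R).

(** What remains of [green] once its value [ln S / pi] at distance of order 1 is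
    removed. At [z = 0] the convention [ln 0 = 0] gives the value 0. *)
Definition reg_kernel (S z : R) : R := (2 * pi)^-1 * (ln (1 + z ^+ 2 / S ^+ 2) - ln (z ^+ 2)).

Lemma reg_kernelN S z : reg_kernel S (- z) = reg_kernel S z.
Proof. by rewrite /reg_kernel sqrrN. Qed.

Lemma measurable_reg_kernel S : measurable_fun [set: R] (reg_kernel S).
Proof.
apply: measurable_funM => //; apply: measurable_funB.
  apply: (measurableT_comp (@measurable_ln R)).
  by apply: measurable_funD => //; apply: measurable_funM.
apply: (measurableT_comp (@measurable_ln R)).
exact: measurable_funX.
Qed.

(** The antiderivative of [s / (pi (s^2 + z^2))] in [s] is [ln (s^2 + z^2) / (2 pi)]. *)
Lemma green_split (S z : R) : 0 < S -> z != 0 -> green S z = ln S / pi + reg_kernel S z.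
Proof.
move=> S0 z0.
have p0 := @pi_gt0 R.
have z2 : 0 < z ^+ 2 by rewrite exprn_even_gt0.
have q0 (s : R) : 0 < s ^+ 2 + z ^+ 2 by rewrite ltr_wpDl// sqr_ge0.
have cc : continuous (fun s => cauchy s z).
  move=> s; rewrite /cauchy; apply: cvgM; first exact: cvg_id.
  apply: cvgV; first by rewrite gt_eqF// mulr_gt0.
  apply: cvgM; first exact: cvg_cst.
  by apply: cvgD; [exact: exprn_continuous|exact: cvg_cst].
have ic := cont_integrable_itv 0 S cc.
transitivity (\int[mu]_(s in `[0, S]) cauchy s z).
  rewrite /green; under eq_Rintegral do rewrite /cauchy0 z0 mulr1.
  rewrite Rintegral_itv_bndo_bndc; last by apply: integrableS ic => //; exact: subset_itvW.
  rewrite Rintegral_itv_obnd_cbnd//.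
  by apply: integrableS ic => //; apply: subset_itvr; rewrite bnd_simp.
transitivity ((2 * pi)^-1 * ln (S ^+ 2 + z ^+ 2) - (2 * pi)^-1 * ln (0 ^+ 2 + z ^+ 2)).
  apply: (@Rftc2 R (fun s => cauchy s z) (fun s => (2 * pi)^-1 * ln (s ^+ 2 + z ^+ 2))).
  - exact: ltW.
  - move=> s _; have H := is_derive1_ln (q0 s).
    apply: is_derive_eq; rewrite /GRing.scale/= /cauchy.
    move: p0 (q0 s); generalize (pi : R) => p p0 energy_rate; field.
    by rewrite !gt_eqF.
  - by move=> s _; exact: cc.
rewrite expr0n/= add0r /reg_kernel.
have -> : S ^+ 2 + z ^+ 2 = S ^+ 2 * (1 + z ^+ 2 / S ^+ 2) by field; rewrite gt_eqF.
rewrite lnM ?posrE ?exprn_gt0//; last by rewrite ltr_wpDr// divr_ge0// sqr_ge0.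
rewrite lnXn//.
move: p0; generalize (pi : R) => p p0; field; by rewrite gt_eqF.
Qed.

(** With [a = sqrt |z|]: [1 + z^2 / S^2 <= (1 + a)^4] and [|ln a| <= a + 1/a]. *)
Lemma reg_kernel_le (S z : R) : 1 <= S -> `|reg_kernel S z| <= 2 * (Num.sqrt `|z| + isqrt `|z|).
Proof.
move=> S1; have S0 : 0 < S by lra.
have p2 := @pi_ge2 R.
have [->|z0] := eqVneq z 0.
  rewrite /reg_kernel expr0n/= mul0r addr0 ln1 ln0// subr0 mulr0 normr0.
  by rewrite mulr_ge0// addr_ge0 ?sqrtr_ge0 ?isqrt_ge0.
rewrite /isqrt; set a := Num.sqrt `|z|.
have a0 : 0 < a by rewrite sqrtr_gt0 normr_gt0.
have ez : z ^+ 2 = a ^+ 4 by rewrite (exprM a 2 2) sqr_sqrtr// real_normK// num_real.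
have h1 : 0 <= ln (1 + z ^+ 2 / S ^+ 2) <= 4 * a.
  have q : 0 <= z ^+ 2 / S ^+ 2 by rewrite divr_ge0// sqr_ge0.
  apply/andP; split; first by apply: ln_ge0; rewrite lerDl.
  have S2 : 1 <= S ^+ 2 by rewrite exprn_ege1.
  have le : 1 + z ^+ 2 / S ^+ 2 <= (1 + a) ^+ 4.
    apply: (@le_trans _ _ (1 + a ^+ 4)).
      by rewrite lerD2l -ez ler_pdivrMr ?exprn_gt0// ler_peMr// sqr_ge0.
    rewrite -subr_ge0 (_ : _ - _ = 4 * a + 6 * a ^+ 2 + 4 * a ^+ 3); last by ring.
    by rewrite !addr_ge0// ?mulr_ge0// ?exprn_ge0// ltW.
  apply: (@le_trans _ _ (ln ((1 + a) ^+ 4))).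
    by rewrite ler_ln// ?posrE ?exprn_gt0; lra.
  rewrite lnXn; last lra.
  have := @le_ln1Dx R a; rewrite -mulr_natl => H; have : ln (1 + a) <= a by apply: H; lra.
  lra.
have h2 : `|ln (z ^+ 2)| <= 4 * (a + a^-1).
  rewrite ez lnXn// -(mulr_natl (ln a)) normrM ger0_norm// ler_pM2l// ler_norml.
  have u (b : R) : 0 < b -> ln b <= b.
    move=> b0; have := @le_ln1Dx R (b - 1); rewrite (addrC 1) subrK => H.
    have : ln b <= b - 1 by apply: H; lra.
    lra.
  have ai : 0 < a^-1 by rewrite invr_gt0.
  have := u _ a0; have := u _ ai; rewrite lnV ?posrE// => H1 H2.
  apply/andP; split; lra.
have e : `|ln (1 + z ^+ 2 / S ^+ 2) - ln (z ^+ 2)| <= 8 * (a + a^-1).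
  have /andP[h1a h1b] := h1; move: h2; rewrite !ler_norml => /andP[h2a h2b].
  have ai : 0 < a^-1 by rewrite invr_gt0.
  apply/andP; split; lra.
rewrite /reg_kernel normrM ger0_norm ?invr_ge0; last lra.
rewrite ler_pdivrMl; last lra.
apply: (le_trans e).
have ai : 0 <= a + a^-1 by rewrite addr_ge0 ?invr_ge0 ?ltW.
have : 4 * (a + a^-1) <= 2 * pi * (a + a^-1) by rewrite ler_wpM2r//; lra.
lra.
Qed.

End kernel.

(** * The regularized potential and its energy *)

Section potential.
Context (R : realType).
Notation mu := (@lebesgue_measure R).
Variables (f : R -> R) (M : R).
Hypotheses (mf : measurable_fun setT f) (fM : forall x, `|f x| <= M)
  (fi : mu.-integrable setT (EFin \o f))
  (fxi : mu.-integrable setT (EFin \o (fun x => `|f x| * `|x|)))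
  (f0 : \int[mu]_x f x = 0).

(** The growth at infinity allowed by [reg_kernel_le]; its square is integrable against
    [|f|] because of the first moment. *)
Definition weight (x : R) : R := 1 + Num.sqrt `|x|.
Definition weighted_norm : R := \int[mu]_x (`|f x| * weight x ^+ 2).
Definition norm1 : R := \int[mu]_x `|f x|.
Definition pot_const : R := 2 * (weighted_norm + norm1) + 8 * M.

Lemma weight_ge1 x : 1 <= weight x.
Proof. by rewrite lerDl. Qed.

Let wt0 x : 0 <= weight x. Proof. by apply: le_trans (weight_ge1 x). Qed.

Lemma measurable_weight : measurable_fun [set: R] weight.
Proof.
apply: measurable_funD => //.
by apply: (measurableT_comp (@measurable_sqrt R)).
Qed.

Let M0 : 0 <= M. Proof. exact: le_trans (fM 0). Qed.

Let fn : mu.-integrable setT (EFin \o (fun z => `|f z|)).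
Proof. exact: integrable_norm. Qed.

Let sq (x : R) : Num.sqrt `|x| ^+ 2 = `|x|. Proof. by rewrite sqr_sqrtr. Qed.

Let iw : mu.-integrable setT (EFin \o (fun x => `|f x| * weight x ^+ 2)).
Proof.
have i2 : mu.-integrable setT (EFin \o (fun x => 2 * (`|f x| + `|f x| * `|x|))).
  by apply: integrable_mull => //; exact: (integrableD _ fn fxi).
apply: (integrable_dom _ _ i2) => //.
  apply: measurable_funM; first exact: measurableT_comp.
  by apply: measurable_funX; exact: measurable_weight.
move=> x _; rewrite ger0_norm ?mulr_ge0 ?sqr_ge0//.
have -> : 2 * (`|f x| + `|f x| * `|x|) = `|f x| * (2 * (1 + `|x|)) by ring.
rewrite ler_wpM2l// /weight -{2}(sq x).
have : 0 <= (1 - Num.sqrt `|x|) ^+ 2 by rewrite sqr_ge0.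
rewrite -subr_ge0 [X in _ -> 0 <= X](_ : _ = (1 - Num.sqrt `|x|) ^+ 2)//; ring.
Qed.

Let idom (g : R -> R) C : measurable_fun setT g ->
  (forall z, `|g z| <= C * (`|f z| * weight z ^+ 2)) -> mu.-integrable setT (EFin \o g).
Proof.
move=> mg gC; apply: (@integrable_dom _ _ _ mu setT _ (fun z => C * (`|f z| * weight z ^+ 2))) => //.
by exact: integrable_mull.
Qed.

Let le_int (g h : R -> R) : mu.-integrable setT (EFin \o g) -> mu.-integrable setT (EFin \o h) ->
  (forall x, g x <= h x) -> \int[mu]_x g x <= \int[mu]_x h x.
Proof. by move=> ig ih le; apply: le_Rintegral. Qed.

Lemma norm1_ge0 : 0 <= norm1.
Proof. by apply: Rintegral_ge0. Qed.

Lemma weighted_norm_ge0 : 0 <= weighted_norm.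
Proof. by apply: Rintegral_ge0 => x _; rewrite mulr_ge0// sqr_ge0. Qed.

Lemma pot_const_ge0 : 0 <= pot_const.
Proof. by rewrite /pot_const; have := norm1_ge0; have := weighted_norm_ge0; have := M0; lra. Qed.

Let sqrtD (z x : R) : Num.sqrt `|z - x| <= Num.sqrt `|z| + Num.sqrt `|x|.
Proof.
have h0 : 0 <= Num.sqrt `|z| + Num.sqrt `|x| by rewrite addr_ge0.
rewrite -[leRHS](ger0_norm h0) -(sqrtr_sqr (Num.sqrt `|z| + _)) ler_sqrt ?sqr_ge0//.
apply: (le_trans (ler_normB _ _)); rewrite sqrrD !sq.
by rewrite -addrA lerD2l lerDr mulrn_wge0// mulr_ge0.
Qed.

Lemma pot_bound x :
  mu.-integrable setT (EFin \o (fun z => `|f z| * (2 * (Num.sqrt `|z - x| + isqrt `|z - x|)))) /\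
  \int[mu]_z (`|f z| * (2 * (Num.sqrt `|z - x| + isqrt `|z - x|))) <= pot_const * weight x.
Proof.
have [i1 le1] := integrable_sing x mf fM fi.
have i2 : mu.-integrable setT (EFin \o (fun z => `|f z| * Num.sqrt `|z - x|)).
  apply: (idom (C := weight x)).
    apply: measurable_funM; first exact: measurableT_comp.
    apply: (measurableT_comp (@measurable_sqrt R)).
    by apply: measurableT_comp => //; exact: measurable_funB.
  move=> z; rewrite ger0_norm ?mulr_ge0// mulrCA ler_wpM2l//.
  apply: (le_trans (sqrtD z x)); rewrite /weight.
  set a := Num.sqrt `|z|; set b := Num.sqrt `|x|.
  have a0 : 0 <= a by exact: sqrtr_ge0.
  have b0 : 0 <= b by exact: sqrtr_ge0.
  rewrite -subr_ge0 (_ : _ - _ = 1 + a + a ^+ 2 + 2 * (a * b) + a ^+ 2 * b); last by ring.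
  by rewrite !addr_ge0// ?mulr_ge0// ?sqr_ge0.
have le2 : \int[mu]_z (`|f z| * Num.sqrt `|z - x|) <= weighted_norm + norm1 * Num.sqrt `|x|.
  have i3 : mu.-integrable setT (EFin \o (fun z => `|f z| * Num.sqrt `|x|)).
    by exact: integrable_mulr.
  apply: (@le_trans _ _ (\int[mu]_z (`|f z| * weight z ^+ 2 + `|f z| * Num.sqrt `|x|))).
    apply: le_int => //; first exact: (integrableD _ iw i3).
    move=> z; rewrite -mulrDr ler_wpM2l//; apply: (le_trans (sqrtD z x)).
    rewrite lerD2r /weight -subr_ge0 (_ : _ - _ = 1 + Num.sqrt `|z| + Num.sqrt `|z| ^+ 2); last by ring.
    by rewrite !addr_ge0// sqr_ge0.
  by rewrite RintegralD// RintegralZr.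
have e : (fun z => `|f z| * (2 * (Num.sqrt `|z - x| + isqrt `|z - x|))) =
   (fun z => 2 * (`|f z| * Num.sqrt `|z - x| + `|f z| * isqrt `|z - x|)).
  by apply/funext => z; ring.
have i4 : mu.-integrable setT (EFin \o (fun z => `|f z| * Num.sqrt `|z - x| + `|f z| * isqrt `|z - x|)).
  exact: (integrableD _ i2 i1).
rewrite e; split.
  by exact: integrable_mull.
rewrite RintegralZl// RintegralD//.
rewrite -/norm1 in le1.
have [n0 d0] := (norm1_ge0, weighted_norm_ge0).
apply: (@le_trans _ _ (2 * (weighted_norm + norm1 * Num.sqrt `|x| + (norm1 + 4 * M)))).
  by rewrite ler_wpM2l// lerD.
rewrite /pot_const /weight -subr_ge0.
set b := Num.sqrt `|x|; have b0 : 0 <= b by exact: sqrtr_ge0.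
rewrite (_ : _ - _ = 2 * (weighted_norm * b) + 8 * (M * b)); last by ring.
by have := M0 => m0; rewrite !addr_ge0// !mulr_ge0.
Qed.

Section S.
Variables (S : R).
Hypothesis S1 : 1 <= S.

Definition reg_pot (g : R -> R) (x : R) : R := \int[mu]_z (f z * g z * reg_kernel S (z - x)).

Let mk : measurable_fun setT (fun q : R * R => reg_kernel S (q.2 - q.1)).
Proof.
by apply: (measurableT_comp (@measurable_reg_kernel R S)); apply: measurable_funB.
Qed.

Let mk1 (x : R) : measurable_fun setT (fun z : R => reg_kernel S (z - x)).
Proof. by apply: (measurableT_comp (@measurable_reg_kernel R S)); exact: measurable_funB. Qed.

Section g.
Variable g : R -> R.
Hypotheses (mg : measurable_fun setT g) (g1 : forall z, `|g z| <= 1).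

Let Vg_le x z : `|f z * g z * reg_kernel S (z - x)| <= `|f z| * (2 * (Num.sqrt `|z - x| + isqrt `|z - x|)).
Proof.
rewrite normrM ler_pM// ?reg_kernel_le//.
by rewrite normrM -[leRHS]mulr1 ler_pM.
Qed.

Lemma integrable_reg_pot x : mu.-integrable setT (EFin \o (fun z => f z * g z * reg_kernel S (z - x))).
Proof.
have [i _] := pot_bound x.
apply: (integrable_dom _ _ i) => //.
by apply: measurable_funM; [exact: measurable_funM|exact: mk1].
Qed.

Lemma reg_pot_bound x : `|reg_pot g x| <= pot_const * weight x.
Proof.
have [i le] := pot_bound x.
apply: le_trans le; apply: Rint_le_norm => //.
by apply: measurable_funM; [exact: measurable_funM|exact: mk1].
Qed.

Lemma measurable_reg_pot : measurable_fun setT (reg_pot g).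
Proof.
apply: (@measurable_Rint_param _ _ (measurableTypeR R) (measurableTypeR R) R mu setT
  (fun q => f q.2 * g q.2 * reg_kernel S (q.2 - q.1))) => //.
apply: measurable_funM => //; apply: measurable_funM.
  exact: (measurableT_comp mf measurable_snd).
exact: (measurableT_comp mg measurable_snd).
Qed.

Lemma int_fg : mu.-integrable setT (EFin \o (fun z => f z * g z)).
Proof.
apply: (integrable_dom _ _ fn) => //; first exact: measurable_funM.
by move=> z _; rewrite normrM -[leRHS]mulr1 ler_pM.
Qed.

Lemma green_reg_pot x : \int[mu]_z (f z * g z * green S (z - x)) =
  ln S / pi * \int[mu]_z (f z * g z) + reg_pot g x.
Proof.
have S0 : 0 < S by exact: lt_le_trans S1.
have mu' : measurable_fun [set: R] (green S).
  apply: (@measurable_Rint_param _ _ (measurableTypeR R) (measurableTypeR R) R mu `]0, S[%classic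
   (fun q => cauchy0 q.2 q.1)) => //.
  exact: measurable_cauchy0.
have iL : mu.-integrable setT (EFin \o (fun z => ln S / pi * (f z * g z))).
  by apply: integrable_mull => //; exact: int_fg.
transitivity (\int[mu]_z (ln S / pi * (f z * g z) + f z * g z * reg_kernel S (z - x))).
  apply: (@Rint_ae_pt _ x).
  - apply: measurable_funM; first exact: measurable_funM.
    by apply: measurableT_comp => //; exact: measurable_funB.
  - apply: measurable_funD; first by apply: measurable_funM => //; exact: measurable_funM.
    by apply: measurable_funM; [exact: measurable_funM|exact: mk1].
  - by move=> z zx; rewrite green_split ?subr_eq0//; ring.
by rewrite RintegralD//; [rewrite RintegralZl//; exact: int_fg|exact: integrable_reg_pot].
Qed.

End g.

Let one1 (z : R) : `|(1 : R)| <= 1. Proof. by rewrite normr1. Qed.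
Notation V1 := (reg_pot (fun=> 1)).
Let mV1 : measurable_fun setT V1. Proof. exact: measurable_reg_pot. Qed.
Let V1_le x : `|V1 x| <= pot_const * weight x. Proof. exact: (reg_pot_bound _ (one1)). Qed.

(** The quadratic form of the kernel [reg_kernel] evaluated at [f]. *)
Definition energy : R := \int[mu]_x (f x * V1 x).

Let fwt (u v : R -> R) C1 C2 : 0 <= C1 -> 0 <= C2 -> measurable_fun setT u -> measurable_fun setT v ->
  (forall x, `|u x| <= C1 * weight x) -> (forall x, `|v x| <= C2 * weight x) ->
  mu.-integrable setT (EFin \o (fun x => f x * u x * v x)) /\
  `|\int[mu]_x (f x * u x * v x)| <= C1 * C2 * weighted_norm.
Proof.
move=> c1 c2 mu_ mv uC vC.
have le x : `|f x * u x * v x| <= C1 * C2 * (`|f x| * weight x ^+ 2).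
  have -> : C1 * C2 * (`|f x| * weight x ^+ 2) = `|f x| * ((C1 * weight x) * (C2 * weight x)) by ring.
  by rewrite -mulrA normrM ler_wpM2l// normrM ler_pM.
have m : measurable_fun setT (fun x => f x * u x * v x).
  by apply: measurable_funM => //; exact: measurable_funM.
split; first exact: (idom m le).
rewrite -RintegralZl//; apply: Rint_le_norm => //.
by exact: integrable_mull.
Qed.

Lemma reg_pot_sym (g : R -> R) : measurable_fun setT g -> (forall z, `|g z| <= 1) ->
  \int[mu]_x (f x * reg_pot g x) = \int[mu]_z (f z * g z * V1 z).
Proof.
move=> mg g1.
pose F (q : R * R) := f q.1 * (f q.2 * g q.2 * reg_kernel S (q.2 - q.1)).
have m2 : measurable_fun setT (fun q : R * R => f q.2 * g q.2 * reg_kernel S (q.2 - q.1)).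
  apply: measurable_funM => //; apply: measurable_funM.
    exact: (measurableT_comp mf measurable_snd).
  exact: (measurableT_comp mg measurable_snd).
have mF : measurable_fun setT F.
  apply: measurable_funM => //; exact: (measurableT_comp mf measurable_fst).
have i2 x : mu.-integrable setT (EFin \o (fun y => F (x, y))).
  rewrite /F/=; by apply: integrable_mull => //; exact: integrable_reg_pot.
have e1 y : (fun x => F (x, y)) = (fun x => f y * g y * (f x * 1 * reg_kernel S (x - y))).
  by apply/funext => x; rewrite /F/= -(reg_kernelN S (y - x)) opprB; ring.
have i1 y : mu.-integrable setT (EFin \o (fun x => F (x, y))).
  rewrite e1; by apply: integrable_mull => //; exact: (integrable_reg_pot _ one1).
have ig : mu.-integrable setT (EFin \o (fun x => `|f x| * (pot_const * weight x))).
  apply: (idom (C := pot_const)).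
    apply: measurable_funM; first exact: measurableT_comp.
    by apply: measurable_funM => //; exact: measurable_weight.
  move=> x; rewrite ger0_norm; last by rewrite !mulr_ge0// pot_const_ge0.
  rewrite mulrCA ler_wpM2l ?pot_const_ge0// ler_wpM2l// expr2 ler_peMr// weight_ge1//.
have le x : \int[mu]_y `|F (x, y)| <= `|f x| * (pot_const * weight x).
  rewrite /F/=; under eq_Rintegral do rewrite normrM.
  have [i le] := pot_bound x.
  have ivn := integrable_norm (integrable_reg_pot mg g1 x).
  rewrite RintegralZl// ler_wpM2l//; apply: le_trans le.
  apply: le_int => // z; rewrite /= normrM ler_pM// ?reg_kernel_le//.
  by rewrite normrM -[leRHS]mulr1 ler_pM.
have fub := @Rfubini_sections _ _ (measurableTypeR R) (measurableTypeR R) R mu mu F _ mF i2 i1 ig le.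
transitivity (\int[mu]_x \int[mu]_y F (x, y)).
  apply: eq_Rintegral => x _; rewrite /reg_pot -(RintegralZl _ measurableT (integrable_reg_pot mg g1 x)); by [].
rewrite fub; apply: eq_Rintegral => y _.
rewrite e1; apply: RintegralZl; first exact: measurableT.
exact: (integrable_reg_pot (@measurable_cst _ _ _ _ _ _) one1).
Qed.

Let le1w x (a C : R) : `|a| <= C -> `|a| <= C * weight x.
Proof. move=> aC; apply: (le_trans aC); rewrite ler_peMr ?weight_ge1//; exact: le_trans aC. Qed.

Let i1V : mu.-integrable setT (EFin \o (fun x => f x * 1 * V1 x)) /\
  `|\int[mu]_x (f x * 1 * V1 x)| <= 1 * pot_const * weighted_norm.
Proof.
exact: (fwt ler01 pot_const_ge0 (@measurable_cst _ _ _ _ setT (1 : R)) mV1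
   (fun x => le1w x (one1 x)) V1_le).
Qed.

Lemma energy_bound : `|energy| <= pot_const * weighted_norm.
Proof. by have [_] := i1V; rewrite mul1r; under eq_Rintegral do rewrite mulr1. Qed.

(** Up to [eps], [u = k + rho * reg_pot v]. Integrated against [f], the constant [k]
    disappears since [int f = 0]; in the rest [v] is replaced by the constant [k'], and
    the symmetry of the kernel is used to bound the error by the weighted norm of [f]. *)
Lemma second_order (u v : R -> R) (k k' rho eps : R) :
  measurable_fun setT u -> measurable_fun setT v ->
  (forall x, `|u x| <= 1) -> (forall x, `|v x| <= 1) -> 0 <= eps ->
  (forall x, `|u x - k - rho * reg_pot v x| <= eps) ->
  (forall x, `|v x - k'| <= `|rho| * pot_const * weight x + eps) ->
  `|\int[mu]_x (f x * u x) - rho * k' * energy| <=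
     eps * norm1 + `|rho| * ((`|rho| * pot_const + eps) * pot_const * weighted_norm).
Proof.
move=> mu_ mv u1 v1 e0 Hu Hv.
have B0 := pot_const_ge0.
have mVv := measurable_reg_pot mv.
have [iuV _] := fwt ler01 B0 (@measurable_cst _ _ _ _ setT (1 : R)) mVv
   (fun x => le1w x (one1 x)) (reg_pot_bound mv v1).
have [ivV _] := fwt ler01 B0 mv mV1 (fun x => le1w x (v1 x)) V1_le.
have C0 : 0 <= `|rho| * pot_const + eps by rewrite addr_ge0// mulr_ge0.
have Hvv x : `|v x - k'| <= (`|rho| * pot_const + eps) * weight x.
  by apply: (le_trans (Hv x)); rewrite mulrDl lerD2l ler_peMr// weight_ge1.
have mvk : measurable_fun setT (fun x => v x - k') by exact: measurable_funB.
have [idV leV] := fwt C0 B0 mvk mV1 Hvv V1_le.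
have [i1V' _] := i1V.
have iu := int_fg mu_ u1.
pose e x := u x - k - rho * reg_pot v x.
have me : measurable_fun setT e.
  apply: measurable_funB; first exact: measurable_funB.
  exact: measurable_funM.
have ie : mu.-integrable setT (EFin \o (fun x => f x * e x)).
  apply: (@integrable_dom _ _ _ mu setT _ (fun z => `|f z| * eps)) => //.
  - exact: measurable_funM.
  - by exact: integrable_mulr.
  - by move=> x _; rewrite normrM ler_wpM2l// Hu.
have le_e : `|\int[mu]_x (f x * e x)| <= eps * norm1.
  rewrite mulrC /norm1 -RintegralZr//; apply: Rint_le_norm => //.
  - exact: measurable_funM.
  - by exact: integrable_mulr.
  - by move=> x _; rewrite normrM ler_wpM2l// Hu.
have E1 : \int[mu]_x (f x * u x) = rho * \int[mu]_x (f x * reg_pot v x) + \int[mu]_x (f x * e x).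
  have iV : mu.-integrable setT (EFin \o (fun x => rho * (f x * reg_pot v x))).
    apply: integrable_mull => //.
    by apply: eq_integrable iuV => // x _ /=; rewrite mulr1.
  have ik : mu.-integrable setT (EFin \o (fun x => k * f x)).
    by exact: integrable_mull.
  transitivity (\int[mu]_x (k * f x + rho * (f x * reg_pot v x) + f x * e x)).
    by apply: eq_Rintegral => x _; rewrite /e; ring.
  rewrite RintegralD//; last exact: (integrableD _ ik iV).
  rewrite RintegralD// RintegralZl// f0 mulr0 add0r RintegralZl//.
  by apply: eq_integrable iuV => // x _ /=; rewrite mulr1.
have E2 : \int[mu]_x (f x * reg_pot v x) = k' * energy + \int[mu]_x (f x * (v x - k') * V1 x).
  rewrite reg_pot_sym//.
  have iG : mu.-integrable setT (EFin \o (fun x => f x * V1 x)).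
    by apply: eq_integrable i1V' => // x _ /=; rewrite mulr1.
  rewrite /energy -RintegralZl// -RintegralD//.
    by apply: eq_Rintegral => x _; ring.
  by exact: integrable_mull.
rewrite E1 E2.
have -> : rho * (k' * energy + \int[mu]_x (f x * (v x - k') * V1 x)) + \int[mu]_x (f x * e x) -
   rho * k' * energy = \int[mu]_x (f x * e x) + rho * \int[mu]_x (f x * (v x - k') * V1 x) by ring.
apply: (le_trans (ler_normD _ _)); rewrite lerD// normrM ler_wpM2l//.
Qed.

End S.
End potential.

(** * Fourier representation of the energy *)

Section spectral.
Context (R : realType).
Notation mu := (@lebesgue_measure R).
Variables (f : R -> R) (M : R).
Hypotheses (mf : measurable_fun setT f) (fM : forall x, `|f x| <= M)
  (fi : mu.-integrable setT (EFin \o f))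
  (fxi : mu.-integrable setT (EFin \o (fun x => `|f x| * `|x|)))
  (f0 : \int[mu]_x f x = 0).

Definition cos_transform (xi : R) : R := \int[mu]_y (f y * cos (xi * y)).
Definition sin_transform (xi : R) : R := \int[mu]_y (f y * sin (xi * y)).
(** The squared modulus of the Fourier transform of [f] ([fourier_spectrum]). *)
Definition spectrum (xi : R) : R := cos_transform xi ^+ 2 + sin_transform xi ^+ 2.
Notation N := (norm1 f).

Let fn : mu.-integrable setT (EFin \o (fun z => `|f z|)).
Proof. exact: integrable_norm. Qed.

Let N0 : 0 <= N. Proof. exact: norm1_ge0. Qed.

Let mtrig (h : R -> R) : measurable_fun setT h ->
  measurable_fun setT (fun q : R * R => f q.2 * h (q.1 * q.2)).
Proof.
move=> mh; apply: measurable_funM; first exact: (measurableT_comp mf measurable_snd).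
by apply: (measurableT_comp mh); apply: measurable_funM.
Qed.

Let mtrig1 (h : R -> R) xi : measurable_fun setT h -> measurable_fun setT (fun y => f y * h (xi * y)).
Proof. by move=> mh; apply: measurable_funM => //; apply: measurableT_comp => //; exact: measurable_funM. Qed.

Let itrig (h : R -> R) xi : measurable_fun setT h -> (forall x, `|h x| <= 1) ->
  mu.-integrable setT (EFin \o (fun y => f y * h (xi * y))).
Proof.
move=> mh h1; apply: (integrable_dom _ _ fn) => //; first exact: mtrig1.
by move=> z _; rewrite normrM -[leRHS]mulr1 ler_pM.
Qed.

Let trig_le (h : R -> R) xi : measurable_fun setT h -> (forall x, `|h x| <= 1) ->
  `|\int[mu]_y (f y * h (xi * y))| <= N.
Proof.
move=> mh h1; apply: Rint_le_norm => //; first exact: mtrig1.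
by move=> z _; rewrite normrM -[leRHS]mulr1 ler_pM.
Qed.

Let CS_le x xi : `|cos_transform xi * cos (xi * x) + sin_transform xi * sin (xi * x)| <= 2 * N.
Proof.
apply: (le_trans (ler_normD _ _)); rewrite mulr_natl mulr2n lerD// normrM -[leRHS]mulr1 ler_pM//.
- exact: (trig_le xi (@measurable_cos R) (@norm_cos_le1 R)).
- exact: norm_cos_le1.
- exact: (trig_le xi (@measurable_sin R) (@norm_sin_le1 R)).
- exact: norm_sin_le1.
Qed.

Lemma measurable_cos_transform : measurable_fun setT cos_transform.
Proof.
apply: (@measurable_Rint_param _ _ (measurableTypeR R) (measurableTypeR R) R mu setT
  (fun q => f q.2 * cos (q.1 * q.2))) => //.
exact: (mtrig (@measurable_cos R)).
Qed.

Lemma measurable_sin_transform : measurable_fun setT sin_transform.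
Proof.
apply: (@measurable_Rint_param _ _ (measurableTypeR R) (measurableTypeR R) R mu setT
  (fun q => f q.2 * sin (q.1 * q.2))) => //.
exact: (mtrig (@measurable_sin R)).
Qed.

Lemma measurable_spectrum : measurable_fun setT spectrum.
Proof.
by apply: measurable_funD; apply: measurable_funX; [exact: measurable_cos_transform|exact: measurable_sin_transform].
Qed.

Lemma spectrum_ge0 xi : 0 <= spectrum xi.
Proof. by rewrite addr_ge0// sqr_ge0. Qed.

Lemma spectrum0 : spectrum 0 = 0.
Proof.
rewrite /spectrum /cos_transform /sin_transform; under eq_Rintegral do rewrite mul0r cos0 mulr1.
under [X in _ + X ^+ 2]eq_Rintegral do rewrite mul0r sin0 mulr0.
by rewrite f0 Rintegral_cst//= mul0r expr0n/= addr0.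
Qed.

Lemma fourier_spectrum xi : Normc.normc (fourier f xi) ^+ 2 = spectrum xi.
Proof.
rewrite /fourier /Cintegral /Normc.normc sqr_sqrtr ?addr_ge0 ?sqr_ge0// /spectrum.
congr (_ ^+ 2 + _).
  apply: eq_Rintegral => y _; rewrite /expi/= cosN; ring.
rewrite -[RHS]sqrrN /sin_transform; congr (_ ^+ 2).
rewrite -mulN1r -RintegralZl//; last by apply: itrig; [exact: measurable_sin|exact: norm_sin_le1].
apply: eq_Rintegral => y _; rewrite /expi/= sinN; ring.
Qed.

(** The convolution of [f] with the Cauchy density, in the shape produced by
    [green_fubini] for a constant second factor. *)
Definition cauchy_conv (s x : R) : R := \int[mu]_z (f z * 1 * cauchy0 s (z - x)).

Let mg2 (s : R) : 0 < s -> mu.-integrable setT (EFin \o (fun xi : R => expR (- s * `|xi|))).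
Proof. exact: integrable_expN. Qed.

Let mexp (s : R) : measurable_fun setT (fun xi : R => expR (- s * `|xi|)).
Proof.
apply: (measurableT_comp (@measurable_expR R)).
by apply: measurable_funM => //; exact: measurableT_comp.
Qed.

Lemma cauchy_conv_spectral s x : 0 < s -> cauchy_conv s x =
  (2 * pi)^-1 * \int[mu]_xi (expR (- s * `|xi|) * (cos_transform xi * cos (xi * x) + sin_transform xi * sin (xi * x))).
Proof.
move=> s0; have p0 := @pi_gt0 R.
have mb : measurable_fun [set: R] (fun z : R => z - x) by exact: measurable_funB.
have mc : measurable_fun [set: R] (fun z => cauchy s (z - x)).
  exact: (measurable_cauchy2 (measurable_cst s) mb).
have mc0 : measurable_fun [set: R] (fun z => cauchy0 s (z - x)).
  exact: (measurable_cauchy0 (measurable_cst s) mb).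
have -> : cauchy_conv s x = \int[mu]_z (f z * cauchy s (z - x)).
  apply: (@Rint_ae_pt _ x).
  - by apply: measurable_funM => //; exact: measurable_funM.
  - exact: measurable_funM.
  - by move=> z zx; rewrite /cauchy0 subr_eq0 zx !mulr1.
pose F (q : R * R) := f q.1 * (expR (- s * `|q.2|) * cos (q.2 * (q.1 - x))).
have mF : measurable_fun setT F.
  apply: measurable_funM; first exact: (measurableT_comp mf measurable_fst).
  apply: measurable_funM; first exact: (measurableT_comp (mexp s) measurable_snd).
  apply: (measurableT_comp (@measurable_cos R)); apply: measurable_funM => //.
  exact: (measurableT_comp mb measurable_fst).
have bF z xi : `|F (z, xi)| <= `|f z| * expR (- s * `|xi|).
  rewrite /F/= normrM ler_wpM2l// normrM (ger0_norm (expR_ge0 _)) -[leRHS]mulr1.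
  by rewrite ler_wpM2l ?expR_ge0 ?norm_cos_le1.
have fub := @Rfubini _ _ (measurableTypeR R) (measurableTypeR R) R mu mu F _ _ mF fn (mg2 s0) bF.
transitivity ((2 * pi)^-1 * \int[mu]_z \int[mu]_xi F (z, xi)).
  have e z : f z * cauchy s (z - x) = (2 * pi)^-1 * \int[mu]_xi F (z, xi).
    rewrite /F/= (RintegralZl _ measurableT (integrable_expcos (z - x) s0)) (Rint_expcos _ s0).
    move: p0; generalize (pi : R) => p p0; field; by rewrite gt_eqF.
  under eq_Rintegral do rewrite e.
  exact: (RintegralZl _ measurableT
    (@integrable_fub1 _ _ (measurableTypeR R) (measurableTypeR R) R mu mu F _ _ mF fn (mg2 s0) bF)).
rewrite fub; congr (_ * _); apply: eq_Rintegral => xi _.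
have e2 z : F (z, xi) = expR (- s * `|xi|) * (cos (xi * x) * (f z * cos (xi * z)) + sin (xi * x) * (f z * sin (xi * z))).
  by rewrite /F/= mulrBr cosB; ring.
have ic := itrig xi (@measurable_cos R) (@norm_cos_le1 R).
have is_ := itrig xi (@measurable_sin R) (@norm_sin_le1 R).
have ic' : mu.-integrable setT (EFin \o (fun z => cos (xi * x) * (f z * cos (xi * z)))).
  by exact: integrable_mull.
have is' : mu.-integrable setT (EFin \o (fun z => sin (xi * x) * (f z * sin (xi * z)))).
  by exact: integrable_mull.
under eq_Rintegral do rewrite e2.
have iD : mu.-integrable setT (EFin \o (fun z => cos (xi * x) * (f z * cos (xi * z)) +
    sin (xi * x) * (f z * sin (xi * z)))) by exact: (integrableD _ ic' is').
rewrite (RintegralZl _ measurableT iD) (RintegralD measurableT ic' is').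
by rewrite (RintegralZl _ measurableT ic) (RintegralZl _ measurableT is_) -/(cos_transform xi) -/(sin_transform xi); ring.
Qed.

(** The derivative of [energy] with respect to the time horizon
    ([energy_time_integral]). *)
Definition energy_rate (s : R) : R := \int[mu]_x (f x * cauchy_conv s x).

Lemma integrable_exp_spectrum s : 0 < s -> mu.-integrable setT (EFin \o (fun xi => (2 * pi)^-1 * (expR (- s * `|xi|) * spectrum xi))).
Proof.
move=> s0; apply: integrable_mull => //.
apply: (@integrable_dom _ _ _ mu setT _ (fun xi => expR (- s * `|xi|) * (2 * N ^+ 2))) => //.
- exact: (measurable_funM (mexp s) measurable_spectrum).
- by apply: integrable_mulr => //; exact: mg2.
move=> xi _; rewrite normrM (ger0_norm (expR_ge0 _)) (ger0_norm (spectrum_ge0 _)) ler_wpM2l ?expR_ge0//.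
have h (a : R) : `|a| <= N -> a ^+ 2 <= N ^+ 2.
  by move=> aN; rewrite -(real_normK (num_real a)) lerXn2r ?nnegrE.
have := h _ (trig_le xi (@measurable_cos R) (@norm_cos_le1 R)).
have := h _ (trig_le xi (@measurable_sin R) (@norm_sin_le1 R)).
rewrite /spectrum -/(cos_transform xi) -/(sin_transform xi); lra.
Qed.

Lemma energy_rate_spectral s : 0 < s ->
  energy_rate s = \int[mu]_xi ((2 * pi)^-1 * (expR (- s * `|xi|) * spectrum xi)).
Proof.
move=> s0.
pose F (q : R * R) := f q.1 * (expR (- s * `|q.2|) * (cos_transform q.2 * cos (q.2 * q.1) + sin_transform q.2 * sin (q.2 * q.1))).
have mC := measurableT_comp measurable_cos_transform (@measurable_snd _ _ R R).
have mS := measurableT_comp measurable_sin_transform (@measurable_snd _ _ R R).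
have m21 : measurable_fun setT (fun q : R * R => q.2 * q.1) by apply: measurable_funM.
have mF : measurable_fun setT F.
  apply: measurable_funM; first exact: (measurableT_comp mf measurable_fst).
  apply: measurable_funM; first exact: (measurableT_comp (mexp s) measurable_snd).
  apply: measurable_funD.
    apply: (measurable_funM mC); exact: (measurableT_comp (@measurable_cos R)).
  apply: (measurable_funM mS); exact: (measurableT_comp (@measurable_sin R)).
have i2 : mu.-integrable setT (EFin \o (fun xi : R => expR (- s * `|xi|) * (2 * N))).
  by apply: integrable_mulr => //; exact: mg2.
have bF z xi : `|F (z, xi)| <= `|f z| * (expR (- s * `|xi|) * (2 * N)).
  rewrite /F/= normrM ler_wpM2l// normrM (ger0_norm (expR_ge0 _)).
  by apply: ler_wpM2l; [exact: expR_ge0|exact: CS_le].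
have fub := @Rfubini _ _ (measurableTypeR R) (measurableTypeR R) R mu mu F _ _ mF fn i2 bF.
have ix x : mu.-integrable setT (EFin \o (fun xi => expR (- s * `|xi|) * (cos_transform xi * cos (xi * x) + sin_transform xi * sin (xi * x)))).
  apply: (integrable_dom _ _ i2); first exact: measurableT.
  - apply: (measurable_funM (mexp s)); apply: measurable_funD.
      apply: (measurable_funM measurable_cos_transform); apply: (measurableT_comp (@measurable_cos R)).
      exact: measurable_funM.
    apply: (measurable_funM measurable_sin_transform); apply: (measurableT_comp (@measurable_sin R)).
    exact: measurable_funM.
  move=> xi _; rewrite normrM (ger0_norm (expR_ge0 _)).
  by apply: ler_wpM2l; [exact: expR_ge0|exact: CS_le].
transitivity (\int[mu]_x ((2 * pi)^-1 * \int[mu]_xi F (x, xi))).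
  apply: eq_Rintegral => x _; rewrite (cauchy_conv_spectral x s0) /F/= (RintegralZl _ measurableT (ix x)).
  by rewrite mulrCA.
rewrite (RintegralZl _ measurableT
  (@integrable_fub1 _ _ (measurableTypeR R) (measurableTypeR R) R mu mu F _ _ mF fn i2 bF)).
rewrite fub -(RintegralZl _ measurableT
  (@integrable_fub2 _ _ (measurableTypeR R) (measurableTypeR R) R mu mu F _ _ mF fn i2 bF)).
apply: eq_Rintegral => xi _; congr (_ * _).
have ic := itrig xi (@measurable_cos R) (@norm_cos_le1 R).
have is_ := itrig xi (@measurable_sin R) (@norm_sin_le1 R).
have ic' : mu.-integrable setT (EFin \o (fun z => cos_transform xi * (f z * cos (xi * z)))).
  by exact: integrable_mull.
have is' : mu.-integrable setT (EFin \o (fun z => sin_transform xi * (f z * sin (xi * z)))).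
  by exact: integrable_mull.
transitivity (\int[mu]_z (expR (- s * `|xi|) * (cos_transform xi * (f z * cos (xi * z)) + sin_transform xi * (f z * sin (xi * z))))).
  by apply: eq_Rintegral => z _; rewrite /F/=; ring.
have iD : mu.-integrable setT (EFin \o (fun z => cos_transform xi * (f z * cos (xi * z)) +
    sin_transform xi * (f z * sin (xi * z)))) by exact: (integrableD _ ic' is').
rewrite (RintegralZl _ measurableT iD) (RintegralD measurableT ic' is').
by rewrite (RintegralZl _ measurableT ic) (RintegralZl _ measurableT is_).
Qed.

End spectral.

Section gamma_limit.
Context (R : realType).
Notation mu := (@lebesgue_measure R).
Variables (f : R -> R) (M : R).
Hypotheses (mf : measurable_fun setT f) (fM : forall x, `|f x| <= M)
  (fi : mu.-integrable setT (EFin \o f))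
  (fxi : mu.-integrable setT (EFin \o (fun x => `|f x| * `|x|)))
  (f0 : \int[mu]_x f x = 0).
Notation spectrum := (spectrum f).

Let fn : mu.-integrable setT (EFin \o (fun z => `|f z|)).
Proof. exact: integrable_norm. Qed.

Let M0 : 0 <= M. Proof. exact: le_trans (fM 0). Qed.

Let mrs : measurable_fun setT (fun q : R * R => cauchy_conv f q.2 q.1).
Proof.
apply: (@measurable_Rint_param _ _ (R * R)%type (measurableTypeR R) R mu setT
  (fun q => f q.2 * 1 * cauchy0 q.1.2 (q.2 - q.1.1))) => //.
apply: measurable_funM.
  by apply: measurable_funM => //; exact: (measurableT_comp mf measurable_snd).
apply: measurable_cauchy0.
  exact: (measurableT_comp measurable_snd measurable_fst).
apply: measurable_funB => //; exact: (measurableT_comp measurable_fst measurable_fst).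
Qed.

Let rs_le s x : 0 < s -> `|cauchy_conv f s x| <= M.
Proof.
move=> s0.
have ic : mu.-integrable setT (EFin \o (fun z => cauchy s (z - x))).
  by apply: (integrable_translate (- x)); exact: integrable_cauchy.
have -> : M = \int[mu]_z (M * cauchy s (z - x)).
  by rewrite RintegralZl// (Rint_translate (- x) (integrable_cauchy s0)) Rint_cauchy// mulr1.
apply: Rint_le_norm => //.
- apply: measurable_funM; first exact: measurable_funM.
  by apply: (measurable_cauchy0 (measurable_cst s)); exact: measurable_funB.
- by exact: integrable_mull.
move=> z _; rewrite mulr1 normrM ler_pM// ger0_norm ?cauchy0_ge0// /cauchy0.
by rewrite -[leRHS]mulr1 ler_wpM2l ?cauchy_ge0//; case: (_ != 0).
Qed.

Let mF : measurable_fun setT (fun q : R * R => f q.1 * cauchy_conv f q.2 q.1).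
Proof. by apply: measurable_funM => //; exact: (measurableT_comp mf measurable_fst). Qed.

(** The constant [ln S / pi] separating [reg_kernel] from [green] does not contribute,
    since [int f = 0]. *)
Lemma energy_time_integral (S : R) : 1 <= S ->
  mu.-integrable `]0, S[ (EFin \o energy_rate f) /\ energy f S = \int[mu]_(s in `]0, S[) energy_rate f s.
Proof.
move=> S1; have S0 : 0 < S by exact: lt_le_trans S1.
have one1 (z : R) : `|(1 : R)| <= 1 by rewrite normr1.
have m1 : measurable_fun setT (fun _ : R => 1 : R) by exact: measurable_cst.
have V1E x : reg_pot f S (fun=> 1) x = \int[mu]_(s in `]0, S[) cauchy_conv f s x.
  have := green_reg_pot mf fM fi fxi S1 m1 one1 x.
  have -> : \int[mu]_z (f z * 1) = 0 by rewrite -f0; apply: eq_Rintegral => z _; rewrite mulr1.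
  rewrite mulr0 add0r => <-.
  by rewrite (proj2 (green_fubini mf fM fi x S0 m1 one1)).
have i2 : mu.-integrable `]0, S[ (EFin \o (cst M : R -> R)).
  by apply: (@integrable_oo_bdd _ _ `|M|).
have bF x s : setT x -> `]0, S[%classic s -> `|f x * cauchy_conv f s x| <= `|f x| * cst M s.
  by rewrite /= in_itv/= => _ /andP[s0 _]; rewrite normrM ler_wpM2l// rs_le.
have fub := @Rfubini_on _ _ (measurableTypeR R) (measurableTypeR R) R mu mu setT `]0, S[%classic
  measurableT (measurable_itv _) _ _ _ mF fn i2 bF.
have fub2 := @integrable_fub2_on _ _ (measurableTypeR R) (measurableTypeR R) R mu mu setT `]0, S[%classic
  measurableT (measurable_itv _) _ _ _ mF fn i2 bF.
split; first exact: fub2.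
rewrite /energy -[RHS]fub; apply: eq_Rintegral => x _.
have ir : mu.-integrable `]0, S[ (EFin \o (fun s => cauchy_conv f s x)).
  apply: (integrable_dom _ _ i2); first exact: measurable_itv.
    by apply: measurable_funTS; exact: (measurableT_comp mrs (measurable_pair1 x)).
  by move=> s; rewrite /= in_itv/= => /andP[s0 _]; exact: rs_le.
transitivity (\int[mu]_(s in `]0, S[) (f x * cauchy_conv f s x)); last by [].
by rewrite V1E; apply: esym; apply: RintegralZl; [exact: measurable_itv|exact: ir].
Qed.

Lemma energy_rate_ge0 s : 0 < s -> 0 <= energy_rate f s.
Proof.
move=> s0; rewrite energy_rate_spectral//; apply: Rintegral_ge0 => xi _.
by rewrite !mulr_ge0 ?invr_ge0 ?mulr_ge0 ?pi_ge0 ?expR_ge0 ?spectrum_ge0.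
Qed.

Lemma energy_ge0 S : 1 <= S -> 0 <= energy f S.
Proof.
move=> S1; rewrite (proj2 (energy_time_integral S1)); apply: Rintegral_ge0 => s.
by rewrite /= in_itv/= => /andP[s0 _]; exact: energy_rate_ge0.
Qed.

Let E (q : R * R) : \bar R :=
  ((2 * pi)^-1 * (spectrum q.2 * `|q.2|^-1) * exponential_pdf `|q.2| q.1)%:E.

Let mexpo : measurable_fun setT (fun q : R * R => exponential_pdf `|q.2| q.1).
Proof.
have m0 : measurable_fun setT (fun q : R * R => `|q.2|).
  exact: (measurableT_comp (@normr_measurable _ _) measurable_snd).
have mI : measurable_fun setT (fun q : R * R => \1_(`[0%R, +oo[%classic) q.1 : R).
  apply: (measurableT_comp (f := \1_(`[0%R, +oo[%classic) : R -> R)); last exact: measurable_fst.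
  by apply: measurable_indic.
rewrite (_ : (fun q => _) = (fun q : R * R => `|q.2| * expR (- `|q.2| * q.1) * \1_(`[0%R, +oo[%classic) q.1)).
  apply: measurable_funM => //; apply: measurable_funM => //.
  apply: (measurableT_comp (@measurable_expR R)); apply: measurable_funM.
    by apply: measurableT_comp.
  exact: measurable_fst.
apply/funext => q; rewrite /exponential_pdf patchE indicE.
by case: ifP => _; rewrite ?mulr1 ?mulr0.
Qed.

Let mE : measurable_fun setT E.
Proof.
have m0 : measurable_fun setT (fun q : R * R => `|q.2|).
  exact: (measurableT_comp (@normr_measurable _ _) measurable_snd).
apply/measurable_EFinP; apply: measurable_funM => //; apply: measurable_funM => //.
apply: measurable_funM; first exact: (measurableT_comp (measurable_spectrum mf) measurable_snd).
exact: (measurableT_comp (@measurable_invr R)).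
Qed.

Let E_ge0 q : (0 <= E q)%E.
Proof.
rewrite lee_fin !mulr_ge0 ?exponential_pdf_ge0// ?invr_ge0 ?mulr_ge0 ?pi_ge0//.
exact: spectrum_ge0.
Qed.

Let E_qs s : 0 < s -> (\int[mu]_xi E (s, xi) = (energy_rate f s)%:E)%E.
Proof.
move=> s0; rewrite (energy_rate_spectral mf fi)// Rint_EFin//; last exact: (integrable_exp_spectrum mf fi s0).
apply: eq_integral => xi _; rewrite /E/= exponential_pdfE ?(ltW s0)//; congr EFin.
have [->|x0] := eqVneq xi 0; first by rewrite normr0 spectrum0// !mul0r !mulr0.
have : `|xi| != 0 by rewrite normr_eq0.
rewrite !mulNr (mulrC s); have := @pi_gt0 R; generalize (pi : R) => p p0 n0.
by field; rewrite n0/= gt_eqF.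
Qed.

Let E_xi xi : (\int[mu]_s E (s, xi) = ((2 * pi)^-1 * (spectrum xi * `|xi|^-1))%:E)%E.
Proof.
rewrite /E/=.
have [->|x0] := eqVneq xi 0.
  by rewrite spectrum0// mul0r mulr0; under eq_integral do rewrite mul0r; rewrite integral0.
under eq_integral do rewrite EFinM.
rewrite ge0_integralZl//.
- by rewrite integral_exponential_pdf ?mule1// normr_gt0.
- by apply/measurable_EFinP; exact: measurable_exponential_pdf.
- by move=> s _; rewrite lee_fin exponential_pdf_ge0.
- by rewrite lee_fin !mulr_ge0 ?invr_ge0 ?mulr_ge0 ?pi_ge0// spectrum_ge0.
Qed.

(** By Tonelli, [int_0^oo e^(-s|xi|) ds = 1/|xi|]; this integral is encoded by the
    density of the exponential law of rate [|xi|]. At [xi = 0] both sides vanish because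
    [spectrum f 0 = 0]. Finiteness of the limit comes from [energy_bound]. *)
Lemma energy_cvg (Sn : nat -> R) : (forall n, 1 <= Sn n) -> nondecreasing_seq Sn ->
  (forall A, exists n, A < Sn n) ->
  energy f (Sn n) @[n --> \oo] --> (2 * pi)^-1 * \int[mu]_xi (spectrum xi * `|xi|^-1).
Proof.
move=> Sn1 Snd Snoo.
pose I n : set (measurableTypeR R) := `]0, Sn n[%classic.
have ndI : nondecreasing_seq I.
  move=> m n mn; apply/subsetPset => x; rewrite /I /= !in_itv/= => /andP[-> h].
  by apply: (lt_le_trans h); exact: Snd.
have UI : \bigcup_n I n = `]0, +oo[%classic.
  apply/seteqP; split => [x [n _]|x]; rewrite /I/= !in_itv/= ?andbT.
    by move=> /andP[].
  by move=> x0; have [n xn] := Snoo x; exists n => //; rewrite /= in_itv/= x0.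
pose G s := (\int[mu]_xi E (s, xi))%E.
have mG : measurable_fun setT G.
  exact: (@measurable_fun_fubini_tonelli_F _ _ (measurableTypeR R) (measurableTypeR R) R mu E).
have G0 s : (0 <= G s)%E by apply: integral_ge0.
have cv := @ge0_nondecreasing_set_cvg_integral _ _ _ I G mu ndI
  (fun=> measurable_itv _) (fun n => measurable_funTS mG) (fun n x _ => G0 x).
have eG n : (\int[mu]_(s in I n) G s = (energy f (Sn n))%:E)%E.
  have [ii ->] := energy_time_integral (Sn1 n).
  rewrite Rint_EFin//; apply: eq_integral => s; rewrite inE /I/= in_itv/= => /andP[s0 _].
  exact: E_qs.
have lE : (\int[mu]_(s in \bigcup_n I n) G s = \int[mu]_xi ((2 * pi)^-1 * (spectrum xi * `|xi|^-1))%:E)%E.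
  rewrite UI integral_itv_obnd_cbnd; last exact: measurable_funTS.
  transitivity (\int[mu]_s G s)%E.
    rewrite integral_mkcond; apply: eq_integral => s _; rewrite patchE.
    case: ifPn => // /negP h; rewrite /G integral0_eq// => xi _.
    rewrite /E/= lt0_exponential_pdf ?mulr0// ltNge; apply/negP => s0; apply: h.
    by rewrite inE/= in_itv/= s0.
  rewrite /G (@fubini_tonelli _ _ (measurableTypeR R) (measurableTypeR R) R mu mu E)//.
  by apply: eq_integral => xi _; exact: E_xi.
have Gle n : energy f (Sn n) <= pot_const f M * weighted_norm f.
  exact: le_trans (ler_norm _) (energy_bound mf fM fi fxi (Sn1 n)).
rewrite lE in cv.
have p0 : 0 <= (2 * pi)^-1 :> R by rewrite invr_ge0 mulr_ge0// pi_ge0.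
have mpsi : measurable_fun setT (fun xi : R => spectrum xi * `|xi|^-1).
  apply: measurable_funM; first exact: measurable_spectrum.
  by apply: (measurableT_comp (@measurable_invr R)).
have ppsi xi : 0 <= spectrum xi * `|xi|^-1 by rewrite mulr_ge0 ?spectrum_ge0.
have fin : (\int[mu]_xi ((2 * pi)^-1 * (spectrum xi * `|xi|^-1))%:E <= (pot_const f M * weighted_norm f)%:E)%E.
  by apply: (cvge_to_le cv); apply: nearW => n; rewrite eG lee_fin.
have ip : mu.-integrable setT (EFin \o (fun xi => (2 * pi)^-1 * (spectrum xi * `|xi|^-1))).
  apply/integrableP; split; first by apply/measurable_EFinP; exact: measurable_funM.
  have e xi : `|(2 * pi)^-1 * (spectrum xi * `|xi|^-1)| = (2 * pi)^-1 * (spectrum xi * `|xi|^-1).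
    by apply: ger0_norm; apply: mulr_ge0; [exact: p0|exact: ppsi].
  under eq_integral do rewrite /= e.
  by apply: (le_lt_trans fin); exact: ltry.
have ip' : mu.-integrable setT (EFin \o (fun xi => spectrum xi * `|xi|^-1)).
  have := integrableZl measurableT (2 * pi) ip.
  apply: eq_integrable => // xi _ /=; rewrite -EFinM; congr EFin.
  have := @pi_gt0 R; generalize (pi : R) => p q0; rewrite mulrA mulfV ?mul1r//.
  by rewrite gt_eqF// mulr_gt0.
rewrite -Rint_EFin// RintegralZl// in cv.
have e : (fun n => \int[mu]_(s in I n) G s)%E = (fun n => (energy f (Sn n))%:E).
  by apply/funext => n; exact: eG.
by rewrite e in cv; exact: (fine_cvg cv).
Qed.

End gamma_limit.

(** * Characteristic function of the occupation integral at a fixed horizon *)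

Section estimate.
Context (R : realType) d (T : measurableType d) (P : probability T R)
  (X : R -> {RV P >-> R}) (hX : symmetric_1stable_process X).
Notation mu := (@lebesgue_measure R).
Notation Xo := (Xo X).
Variables (f : R -> R) (M : R).
Hypotheses (mf : measurable_fun setT f) (fM : forall x, `|f x| <= M)
  (fi : mu.-integrable setT (EFin \o f))
  (fxi : mu.-integrable setT (EFin \o (fun x => `|f x| * `|x|)))
  (f0 : \int[mu]_x f x = 0).

Section fixed.
Variables (lam S : R).
Hypothesis S1 : 1 <= S.

Let S0 : 0 < S. Proof. exact: lt_le_trans S1. Qed.
Let g (z : R) : R := lam * f z.
Notation C := (expect_occ X g cos S).
Notation D := (expect_occ X g sin S).

Let mg : measurable_fun setT g. Proof. exact: measurable_funM. Qed.
Let gM z : `|g z| <= `|lam| * M. Proof. by rewrite normrM ler_wpM2l. Qed.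
Let gi : mu.-integrable setT (EFin \o g).
Proof. by exact: integrable_mull. Qed.

Let Kg : decay_const g = `|lam| * decay_const f.
Proof.
rewrite /decay_const mulrA; congr (_ / _).
have fn : mu.-integrable setT (EFin \o (fun z => `|f z|)) by exact: integrable_norm.
transitivity (\int[mu]_z (`|lam| * `|f z|)).
  by apply: eq_Rintegral => z _; rewrite normrM.
by apply: RintegralZl; [exact: measurableT|exact: fn].
Qed.

Let eps := 4 * (lam ^+ 2 * decay_const f ^+ 2).

Let eE : 4 * decay_const g ^+ 2 = eps.
Proof. by rewrite Kg exprMn real_normK ?num_real. Qed.

Let mC : measurable_fun setT C.
Proof. exact: (proj1 (bdd_meas_expect_occ hX mg S (@measurable_cos R) (@norm_cos_le1 R))). Qed.
Let mD : measurable_fun setT D.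
Proof. exact: (proj1 (bdd_meas_expect_occ hX mg S (@measurable_sin R) (@norm_sin_le1 R))). Qed.
Let C1 z : `|C z| <= 1.
Proof. exact: (expect_occ_le1 hX mg S z (@measurable_cos R) (@norm_cos_le1 R)). Qed.
Let D1 z : `|D z| <= 1.
Proof. exact: (expect_occ_le1 hX mg S z (@measurable_sin R) (@norm_sin_le1 R)). Qed.

Let msinN : measurable_fun [set: R] (fun a : R => - sin a).
Proof. by apply: measurableT_comp => //; exact: measurable_sin. Qed.

Let sg (h : R -> R) x := \int[mu]_z (f z * h z * green S (z - x)).

Lemma duhamel_sin x : `|D x - lam * sg C x| <= eps.
Proof.
have hM : forall (x s S : R) (h : R -> R), bdd_meas h -> 0 <= s -> 0 <= S ->
    \int[P]_w (h (Xo s w) * cos (occX X (fun y => g (x + y)) s S w)) =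
    \int[P]_w (h (Xo s w) * \int[P]_v cos (occX X (fun y => g (x + Xo s w + y)) 0 S v)).
  by move=> x' s S' h bh s0 S0'; exact: (markov_cos hX.1 x' mg gM bh s0 S0').
have := duhamel_expect hX mg gM gi (@measurable_sin R) (@measurable_cos R)
  (@norm_sin_le1 R) (@norm_cos_le1 R) (@cos_lip R) (@sin_taylor R) hM x S0.
rewrite eE sin0 subr0 => le.
rewrite (_ : lam * sg C x = \int[mu]_z (g z * C z * green S (z - x))); first exact: le.
have [i _] := green_fubini mf fM fi x S0 mC C1.
transitivity (\int[mu]_z (lam * (f z * C z * green S (z - x)))).
  by apply: esym; apply: RintegralZl; [exact: measurableT|exact: i].
by apply: eq_Rintegral => z _; rewrite /g !mulrA.
Qed.

(** [duhamel_expect] for the pair formed by the cosine and its derivative, minus the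
    sine. *)
Lemma duhamel_cos x : `|C x - 1 + lam * sg D x| <= eps.
Proof.
have hM : forall (x s S : R) (h : R -> R), bdd_meas h -> 0 <= s -> 0 <= S ->
    \int[P]_w (h (Xo s w) * - sin (occX X (fun y => g (x + y)) s S w)) =
    \int[P]_w (h (Xo s w) * \int[P]_v - sin (occX X (fun y => g (x + Xo s w + y)) 0 S v)).
  move=> x' s S' h bh s0 S0'.
  have e1 : \int[P]_w (h (Xo s w) * - sin (occX X (fun y => g (x' + y)) s S' w)) =
      \int[P]_w ((fun y => - h y) (Xo s w) * sin (occX X (fun y => g (x' + y)) s S' w)).
    by apply: eq_Rintegral => w _; rewrite mulrN mulNr.
  have bh' : bdd_meas (fun y => - h y).
    have [mh [N hN]] := bh; split; first exact: measurableT_comp.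
    by exists N => y; rewrite normrN.
  rewrite e1 (markov_sin hX.1 x' mg gM bh' s0 S0').
  apply: eq_Rintegral => w _; rewrite mulNr -mulrN; congr (_ * _).
  rewrite -mulN1r.
  have bs := @bdd_meas_integrable _ _ _ P (fun v => sin (occX X (fun y => g (x' + Xo s w + y)) 0 S' v)).
  rewrite -(RintegralZl _ measurableT (bs _)).
    by apply: eq_Rintegral => v _; rewrite mulN1r.
  split; last by exists 1 => v; exact: norm_sin_le1.
  apply: (measurableT_comp (@measurable_sin R)).
  exact: (measurableT_comp (measurable_occX hX mg S') (measurable_pair1 (x' + Xo s w))).
have lip a b : `|- sin a - - sin b| <= `|a - b| :> R.
  by rewrite -opprD normrN; exact: sin_lip.
have n1 a : `|- sin a| <= 1 :> R by rewrite normrN norm_sin_le1.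
have := duhamel_expect hX mg gM gi (@measurable_cos R) msinN
  (@norm_cos_le1 R) n1 lip (@cos_taylor R) hM x S0.
rewrite eE cos0 => le.
rewrite (_ : lam * sg D x = - \int[mu]_z (g z * expect_occ X g (fun a => - sin a) S z * green S (z - x))); first exact: le.
have [i _] := green_fubini mf fM fi x S0 mD D1.
rewrite -mulN1r.
have hN z : expect_occ X g (fun a => - sin a) S z = - D z.
  rewrite -mulN1r /expect_occ.
  have bs := @bdd_meas_integrable _ _ _ P (fun v => sin (occX X (fun y => g (z + y)) 0 S v)).
  rewrite -(RintegralZl _ measurableT (bs _)).
    by apply: eq_Rintegral => v _; rewrite mulN1r.
  split; last by exists 1 => v; exact: norm_sin_le1.
  apply: (measurableT_comp (@measurable_sin R)).
  exact: (measurableT_comp (measurable_occX hX mg S) (measurable_pair1 z)).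
transitivity (-1 * \int[mu]_z (- lam * (f z * D z * green S (z - x)))).
  by rewrite (RintegralZl _ measurableT i) mulN1r mulNr opprK.
by congr (_ * _); apply: eq_Rintegral => z _; rewrite hN /g; ring.
Qed.

Let kc := 1 - lam * (ln S / pi * \int[mu]_z (f z * D z)).
Let ks := lam * (ln S / pi * \int[mu]_z (f z * C z)).

Let Hc x : `|C x - kc - (- lam) * reg_pot f S D x| <= eps.
Proof.
have := duhamel_cos x; rewrite /sg (green_reg_pot mf fM fi fxi S1 mD D1 x).
rewrite (_ : C x - 1 + _ = C x - kc - - lam * reg_pot f S D x) ///kc; ring.
Qed.

Let Hs x : `|D x - ks - lam * reg_pot f S C x| <= eps.
Proof.
have := duhamel_sin x; rewrite /sg (green_reg_pot mf fM fi fxi S1 mC C1 x).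
rewrite (_ : D x - _ = D x - ks - lam * reg_pot f S C x) ///ks; ring.
Qed.

Let e0 : 0 <= eps.
Proof. by rewrite mulr_ge0// mulr_ge0 ?sqr_ge0. Qed.

Let near_k (u v : R -> R) k rho x : measurable_fun setT v -> (forall z, `|v z| <= 1) ->
  `|rho| = `|lam| ->
  `|u x - k - rho * reg_pot f S v x| <= eps -> `|u x - k| <= `|lam| * pot_const f M * weight x + eps.
Proof.
move=> mv v1 rl H.
rewrite (_ : u x - k = rho * reg_pot f S v x + (u x - k - rho * reg_pot f S v x)); last by ring.
apply: (le_trans (ler_normD _ _)); apply: lerD => //.
by rewrite normrM rl -mulrA ler_wpM2l//; exact: (reg_pot_bound mf fM fi fxi S1 mv v1 x).
Qed.

Let lamN : `|- lam| = `|lam|. Proof. exact: normrN. Qed.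

Let Hc' x : `|C x - kc| <= `|lam| * pot_const f M * weight x + eps.
Proof. exact: (near_k mD D1 lamN (Hc x)). Qed.

Let Hs' x : `|D x - ks| <= `|lam| * pot_const f M * weight x + eps.
Proof. exact: (near_k mC C1 erefl (Hs x)). Qed.

Let c1 := 4 * decay_const f ^+ 2 * norm1 f + pot_const f M ^+ 2 * weighted_norm f.
Let c2 := 4 * decay_const f ^+ 2 * pot_const f M * weighted_norm f.

(** To be read at [l = |lam|], [q = lam^2 ln S] and [a = q * energy / pi]: it tends to 0
    with [l] when [a] and [q] stay bounded. *)
Definition error_bound (l a q : R) : R := (l * pot_const f M + 4 * (l ^+ 2 * decay_const f ^+ 2)) * (1 + a) +
  q / pi * (l * (4 * decay_const f ^+ 2 * norm1 f + pot_const f M ^+ 2 * weighted_norm f) + l ^+ 2 * (4 * decay_const f ^+ 2 * pot_const f M * weighted_norm f)).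

Let a := lam ^+ 2 * ln S / pi * energy f S.

Let lamsq : lam ^+ 2 = `|lam| ^+ 2. Proof. by rewrite real_normK ?num_real. Qed.

Let S2 : eps * norm1 f + `|lam| * ((`|lam| * pot_const f M + eps) * pot_const f M * weighted_norm f) =
  `|lam| ^+ 2 * (c1 + `|lam| * c2).
Proof. by rewrite /eps lamsq /c1 /c2; ring. Qed.

Let L0 : 0 <= ln S / pi. Proof. by rewrite divr_ge0 ?pi_ge0 ?ln_ge0. Qed.

Let a0 : 0 <= a.
Proof.
rewrite /a -(mulrA (lam ^+ 2)); apply: mulr_ge0; last exact: (energy_ge0 mf fM fi fxi f0 S1).
by apply: mulr_ge0; [exact: sqr_ge0|exact: L0].
Qed.

Let wt_0 : weight (0 : R) = 1. Proof. by rewrite /weight normr0 sqrtr0 addr0. Qed.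

Let small k u v : `|u - k| <= `|lam| * pot_const f M * weight 0 + eps ->
  `|k * (1 + a) - v| <= `|lam| * (ln S / pi) * (`|lam| ^+ 2 * (c1 + `|lam| * c2)) ->
  `|u * (1 + a) - v| <= error_bound `|lam| a (lam ^+ 2 * ln S).
Proof.
move=> h1 h2.
rewrite (_ : u * (1 + a) - v = (u - k) * (1 + a) + (k * (1 + a) - v)); last by ring.
apply: (le_trans (ler_normD _ _)); apply: lerD.
  rewrite normrM (ger0_norm (_ : 0 <= 1 + a)); last by rewrite addr_ge0.
  by apply: ler_wpM2r; [rewrite addr_ge0|rewrite -lamsq; move: h1; rewrite wt_0 mulr1].
apply: (le_trans h2); rewrite le_eqVlt; apply/orP; left; apply/eqP.
by rewrite lamsq -/c1 -/c2; ring.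
Qed.

(** The constants [kc] and [ks] solve, up to the error of [second_order], a linear
    system whose matrix is [1 + a] times the identity. *)
Lemma cos_estimate : `|C 0 * (1 + a) - 1| <= error_bound `|lam| a (lam ^+ 2 * ln S).
Proof.
apply: (small (Hc' 0)).
have := second_order mf fM fi fxi f0 S1 mD mC D1 C1 e0 Hs Hc'.
rewrite S2 => le.
rewrite (_ : kc * (1 + a) - 1 = - (lam * (ln S / pi) * (\int[mu]_x (f x * D x) - lam * kc * energy f S))).
  by rewrite normrN normrM normrM (ger0_norm L0) ler_wpM2l// mulr_ge0.
by rewrite [in LHS]/kc mulrDr mulr1 [X in _ + X - _](_ : _ = kc * a)// /a; rewrite /kc; ring.
Qed.

Lemma sin_estimate : `|D 0 * (1 + a)| <= error_bound `|lam| a (lam ^+ 2 * ln S).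
Proof.
rewrite -[D 0 * _]subr0; apply: (small (Hs' 0)); rewrite subr0.
have Hs'' x : `|D x - ks| <= `|- lam| * pot_const f M * weight x + eps by rewrite lamN; exact: Hs'.
have := second_order mf fM fi fxi f0 S1 mC mD C1 D1 e0 Hc Hs''.
rewrite lamN S2 => le.
rewrite (_ : ks * (1 + a) = lam * (ln S / pi) * (\int[mu]_x (f x * C x) - - lam * ks * energy f S)).
  by rewrite normrM normrM (ger0_norm L0) ler_wpM2l// mulr_ge0.
have -> : lam * (ln S / pi) * (\int[mu]_x (f x * C x) - - lam * ks * energy f S) =
  ks + lam ^+ 2 * (ln S / pi) * energy f S * ks by rewrite /ks; ring.
by rewrite /a; ring.
Qed.

End fixed.
End estimate.

(** * Limit of the characteristic functions *)

Section char_limit.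
Context (R : realType) d (T : measurableType d) (P : probability T R)
  (X : R -> {RV P >-> R}) (hX : symmetric_1stable_process X).
Notation mu := (@lebesgue_measure R).
Notation Xo := (Xo X).
Variables (f : R -> R) (M : R).
Hypotheses (mf : measurable_fun setT f) (fM : forall x, `|f x| <= M).

Definition occ_scaled (t : R) (n : nat) (w : T) : R :=
  (Num.sqrt n%:R)^-1 * \int[mu]_(s in `[0, expR (n%:R * t)]) f (X s w).

Lemma measurable_occ_scaled t n : measurable_fun setT (occ_scaled t n).
Proof.
apply: measurable_funM => //.
have mY : measurable_fun setT (fun z : R * T => f (X (Num.max 0 z.1) z.2)).
  by apply: (measurableT_comp mf); exact: (measurable_joint hX.1).
rewrite (_ : (fun w => _) = (fun w => \int[mu]_(s in `[0, expR (n%:R * t)]) f (X (Num.max 0 s) w))).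
  exact: (@measurable_Rint_param2 _ _ (measurableTypeR R) T R mu `[0, expR (n%:R * t)]%classic
   (fun z : R * T => f (X (Num.max 0 z.1) z.2))).
apply/funext => w; apply: eq_Rintegral => s; rewrite inE/= in_itv/= => /andP[s0 _].
by rewrite max_r.
Qed.

Lemma occ_scaled_expect (t y : R) n (h : R -> R) : measurable_fun setT h ->
  \int[P]_w h (y * occ_scaled t n w) =
  expect_occ X (fun z => y * (Num.sqrt n%:R)^-1 * f z) h (expR (n%:R * t)) 0.
Proof.
move=> mh; set lam := y * _; set S := expR _.
have mg : measurable_fun setT (fun z => lam * f z) by exact: measurable_funM.
have mo : measurable_fun setT (fun w => occX X (fun z => lam * f (0 + z)) 0 S w).
  exact: (measurableT_comp (measurable_occX hX mg S) (measurable_pair1 (0 : R))).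
congr fine; apply: ae_eq_integral => //.
- apply/measurable_EFinP; apply: (measurableT_comp mh); apply: measurable_funM => //.
  exact: measurable_occ_scaled.
- by apply/measurable_EFinP; exact: (measurableT_comp mh mo).
have := levy_start hX.1; apply: filterS => w X0 _ /=; congr (h _)%:E.
rewrite /occ_scaled mulrA -/lam -/S /occX.
have mYw : measurable_fun setT (fun s : R => f (X (Num.max 0 s) w)).
  apply: (measurableT_comp mf).
  exact: (measurableT_comp (measurable_joint hX.1) (measurable_pair2 w)).
have iY := @integrable_itv_bdd _ _ 0 S M mYw (fun s => fM _).
transitivity (lam * \int[mu]_(s in `[0, S]) f (X (Num.max 0 s) w)).
  congr (_ * _); apply: eq_Rintegral => s; rewrite inE/= in_itv/= => /andP[s0 _].
  by rewrite max_r.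
transitivity (\int[mu]_(s in `[0, S]) (lam * f (X (Num.max 0 s) w))).
  by apply: esym; apply: RintegralZl; [exact: measurable_itv|exact: iY].
apply: eq_Rintegral => s; rewrite inE/= in_itv/= => /andP[s0 _].
by rewrite max_r// !add0r (_ : Xo s w = X s w - X 0 w)// X0 subr0.
Qed.

Hypotheses (fi : mu.-integrable setT (EFin \o f))
  (fxi : mu.-integrable setT (EFin \o (fun x => `|f x| * `|x|)))
  (f0 : \int[mu]_x f x = 0).
Variable t : R.
Hypothesis t0 : 0 < t.

Lemma cvg_inv_sqrt : (Num.sqrt n.+1%:R)^-1 @[n --> \oo] --> (0 : R).
Proof.
have -> : (fun n => (Num.sqrt n.+1%:R)^-1 : R) = (fun n => Num.sqrt (n.+1%:R^-1)).
  by apply/funext => n; rewrite sqrtrV.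
rewrite -[X in _ --> X](@sqrtr0 R).
by apply: continuous_cvg; [exact: sqrt_continuous|exact: cvg_harmonic].
Qed.

(** The limit of the energies ([energy_cvg]). *)
Definition energy_lim : R := (2 * pi)^-1 * \int[mu]_xi (spectrum f xi * `|xi|^-1).

Let Sn (n : nat) : R := expR (n.+1%:R * t).

Let Sn1 n : 1 <= Sn n.
Proof. by rewrite /Sn -expR0 ler_expR mulr_ge0// ltW. Qed.

Let cvg_Gam : energy f (Sn n) @[n --> \oo] --> energy_lim.
Proof.
apply: (energy_cvg mf fM fi fxi f0 Sn1).
- by move=> m n mn; rewrite /Sn ler_expR ler_wpM2r ?(ltW t0)// ler_nat ltnS.
- move=> A; exists (Num.trunc (`|A| / t)).
  have h : 0 <= `|A| / t by rewrite divr_ge0// ltW.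
  have /andP[_ H] := truncn_itv h.
  rewrite ltr_pdivrMr// in H.
  apply: (le_lt_trans (ler_norm A)); apply: (lt_le_trans H); rewrite /Sn.
  by apply: le_trans (expR_ge1Dx _); rewrite lerDr.
Qed.

Lemma energy_lim_ge0 : 0 <= energy_lim.
Proof.
apply: (@ler_cvg_to _ _ _ _ (fun=> 0) _ _ _ _ cvg_Gam); first exact: cvg_cst.
by apply: nearW => n; exact: (energy_ge0 mf fM fi fxi f0 (Sn1 n)).
Qed.

Section y.
Variable y : R.
Let lam n : R := y * (Num.sqrt n.+1%:R)^-1.
Let a n : R := y ^+ 2 * t / pi * energy f (Sn n).
Let aoo : R := y ^+ 2 * t / pi * energy_lim.

Let lamL n : lam n ^+ 2 * ln (Sn n) = y ^+ 2 * t.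
Proof.
rewrite /Sn expRK /lam exprMn exprVn sqr_sqrtr//.
have : n.+1%:R != 0 :> R by rewrite pnatr_eq0.
by move=> n0; rewrite -mulrA mulKf.
Qed.

Let cvg_lam : `|lam n| @[n --> \oo] --> (0 : R).
Proof.
have : lam n @[n --> \oo] --> y * 0 by apply: cvgM; [exact: cvg_cst|exact: cvg_inv_sqrt].
by rewrite mulr0 => /cvg_norm; rewrite normr0.
Qed.

Let cvg_a : a n @[n --> \oo] --> aoo.
Proof. by apply: cvgM; [exact: cvg_cst|exact: cvg_Gam]. Qed.

Let a_ge0 n : 0 <= a n.
Proof.
rewrite mulr_ge0 ?(energy_ge0 mf fM fi fxi f0)// divr_ge0 ?pi_ge0//.
by rewrite mulr_ge0 ?sqr_ge0// ltW.
Qed.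

Lemma aoo_ge0 : 0 <= aoo.
Proof.
rewrite mulr_ge0 ?energy_lim_ge0// divr_ge0 ?pi_ge0//.
by rewrite mulr_ge0 ?sqr_ge0// ltW.
Qed.

Let e n := error_bound f M `|lam n| (a n) (y ^+ 2 * t).

Let cvg_e : e n @[n --> \oo] --> (0 : R).
Proof.
have c2 : `|lam n| ^+ 2 @[n --> \oo] --> (0 : R).
  by rewrite -[X in _ --> X](mulr0 (0 : R)); apply: cvgM; exact: cvg_lam.
rewrite /e /error_bound.
pose k1 := pot_const f M; pose k2 := decay_const f ^+ 2; pose k3 := y ^+ 2 * t / pi.
pose k4 := 4 * k2 * norm1 f + pot_const f M ^+ 2 * weighted_norm f; pose k5 := 4 * k2 * pot_const f M * weighted_norm f.
have z : (0 * k1 + 4 * (0 * k2)) * (1 + aoo) + k3 * (0 * k4 + 0 * k5) = 0 by ring.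
rewrite -[X in _ --> X]z.
have kc (k : R) : (fun _ : nat => k) n @[n --> \oo] --> k by exact: cvg_cst.
have h1 (k : R) : `|lam n| * k @[n --> \oo] --> 0 * k := cvgM cvg_lam (kc k).
have h2 (k : R) : `|lam n| ^+ 2 * k @[n --> \oo] --> 0 * k := cvgM c2 (kc k).
have h3 : 4 * (`|lam n| ^+ 2 * k2) @[n --> \oo] --> 4 * (0 * k2) := cvgM (kc 4) (h2 _ k2).
have h4 : 1 + a n @[n --> \oo] --> 1 + aoo := cvgD (kc 1) cvg_a.
apply: cvgD; apply: cvgM.
- by apply: cvgD; [exact: h1|exact: h3].
- exact: h4.
- exact: kc.
- by apply: cvgD; [exact: (h1 _ k4)|exact: (h2 _ k5)].
Qed.

Let limit_of (u : nat -> R) v : (forall n, `|u n * (1 + a n) - v| <= e n) ->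
  u n @[n --> \oo] --> v / (1 + aoo).
Proof.
move=> H.
have c1 : u n * (1 + a n) @[n --> \oo] --> v.
  apply/subr_cvg0; apply/norm_cvg0P.
  apply: (@squeeze_cvgr _ _ _ _ (fun=> 0) e); [|exact: cvg_cst|exact: cvg_e].
  by apply: nearW => n; rewrite normr_ge0 H.
have -> : u = (fun n => u n * (1 + a n) / (1 + a n)).
  by apply/funext => n; rewrite mulfK// gt_eqF// ltr_wpDr.
apply: cvgM => //; apply: cvgV; first by rewrite gt_eqF// ltr_wpDr ?aoo_ge0.
by apply: cvgD; [exact: cvg_cst|exact: cvg_a].
Qed.

Lemma cos_limit :
  \int[P]_w cos (y * occ_scaled t n w) @[n --> \oo] --> 1 / (1 + aoo).
Proof.
rewrite -cvg_shiftS; apply: limit_of => n.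
rewrite (occ_scaled_expect _ _ _ (@measurable_cos R)).
have := cos_estimate hX mf fM fi fxi f0 (lam n) (Sn1 n).
by rewrite lamL.
Qed.

Lemma sin_limit :
  \int[P]_w sin (y * occ_scaled t n w) @[n --> \oo] --> (0 : R).
Proof.
rewrite -cvg_shiftS.
have H n : `|\int[P]_w sin (y * occ_scaled t n.+1 w) * (1 + a n) - 0| <= e n.
  rewrite (occ_scaled_expect _ _ _ (@measurable_sin R)) subr0.
  have := sin_estimate hX mf fM fi fxi f0 (lam n) (Sn1 n).
  by rewrite lamL.
by have := limit_of H; rewrite mul0r.
Qed.

End y.
End char_limit.

(** * Characteristic function of the standard normal law *)

Section gaussian.
Context (R : realType).
Notation mu := (@lebesgue_measure R).

(** A Taylor bound of order two on an integrand, once integrated, gives the hypothesis;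
    this differentiates an integral with respect to a parameter. *)
Lemma is_derive_quadratic (F : R -> R) (a l C : R) :
  (forall b, `|F b - F a - l * (b - a)| <= C * (b - a) ^+ 2) -> is_derive a 1 F l.
Proof.
move=> H.
have C0 : 0 <= C.
  have := H (a + 1); rewrite (_ : a + 1 - a = 1); last by ring.
  by rewrite expr1n !mulr1 => h; apply: le_trans h.
have cv : h^-1 *: (F (h *: (1 : R) + a) - F a) @[h --> (0 : R)^'] --> l.
  apply/cvgrPdist_le => e e0; near=> h.
  have h0 : h != 0 by near: h; exact: nbhs_dnbhs_neq.
  have hC : `|h| <= e / (C + 1).
    near: h; apply: dnbhs0_le; rewrite divr_gt0// ltr_wpDl//.
  have := H (h *: (1 : R) + a); rewrite addrK /GRing.scale/= mulr1 => H1.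
  rewrite distrC (_ : _ - l = h^-1 * (F (h + a) - F a - l * h)); last by field; exact: h0.
  rewrite normrM normfV ler_pdivrMl ?normr_gt0//; apply: (le_trans H1).
  rewrite -(real_normK (num_real h)) expr2 mulrCA; apply: ler_wpM2l => //.
  apply: (@le_trans _ _ (C * (e / (C + 1)))); first exact: ler_wpM2l.
  by rewrite mulrA ler_pdivrMr ?ltr_wpDl// mulrC ler_wpM2l ?(ltW e0)// lerDl.
split; first by apply/cvg_ex; exists l; exact: cv.
exact: (cvg_lim (@norm_hausdorff _ _) cv).
Unshelve. all: by end_near. Qed.

Let p := normal_pdf (0 : R) 1.

Let pE x : p x = normal_peak 1 * expR (- (x ^+ 2 / 2)).
Proof.
rewrite /p normal_pdfE ?oner_neq0// /normal_fun subr0 expr1n mulNr; congr (_ * expR (- (_ / _))).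
Qed.

Let p0 x : 0 <= p x. Proof. exact: normal_pdf_ge0. Qed.
Let mp : measurable_fun setT p. Proof. exact: measurable_normal_pdf. Qed.
Let ip : mu.-integrable setT (EFin \o p). Proof. exact: integrable_normal_pdf. Qed.

Let pint : \int[mu]_x p x = 1.
Proof. by rewrite /Rintegral integral_normal_pdf. Qed.

Let s2 : Num.sqrt 2 ^+ 2 = 2 :> R. Proof. by rewrite sqr_sqrtr. Qed.

Let ix2 : mu.-integrable setT (EFin \o (fun x => x ^+ 2 * p x)).
Proof.
have s0 : Num.sqrt 2 != 0 :> R by rewrite gt_eqF// sqrtr_gt0.
(* [x^2 e^(-x^2/2) <= 4 e^(-x^2/4)] is dominated by the normal density of variance 2 *)
pose k := 4 * normal_peak 1 / normal_peak (Num.sqrt 2) : R.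
have i2 : mu.-integrable setT (EFin \o (fun x => k * normal_pdf 0 (Num.sqrt 2) x)).
  by apply: integrable_mull => //; exact: integrable_normal_pdf.
apply: (integrable_dom _ _ i2) => //; first by apply: measurable_funM.
move=> x _; rewrite ger0_norm; last by rewrite mulr_ge0 ?sqr_ge0.
rewrite pE normal_pdfE// /normal_fun subr0 s2 /k.
have g0 := @normal_peak_gt0 R _ s0.
have -> : 4 * normal_peak 1 / normal_peak (Num.sqrt 2) *
    (normal_peak (Num.sqrt 2) * expR (- x ^+ 2 / (2 *+ 2))) =
    normal_peak 1 * (4 * expR (- x ^+ 2 / (2 *+ 2))) by field; rewrite gt_eqF.
rewrite mulrCA ler_wpM2l ?normal_peak_ge0//.
have -> : - (x ^+ 2 / 2) = - x ^+ 2 / (2 *+ 2) + - x ^+ 2 / (2 *+ 2) by field.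
rewrite expRD mulrA ler_pM2r ?expR_gt0//.
have : x ^+ 2 / (2 *+ 2) <= expR (x ^+ 2 / (2 *+ 2)).
  by apply: le_trans (expR_ge1Dx _); rewrite lerDr.
rewrite mulNr expRN => h; rewrite ler_pdivrMr ?expR_gt0//.
have e4 : x ^+ 2 = 4 * (x ^+ 2 / (2 *+ 2)) by field.
by rewrite {1}e4 ler_wpM2l.
Qed.

Let dom (h : R -> R) : measurable_fun setT h -> (forall x, `|h x| <= 1 + x ^+ 2) ->
  mu.-integrable setT (EFin \o (fun x => h x * p x)).
Proof.
move=> mh h1.
have i : mu.-integrable setT (EFin \o (fun x => p x + x ^+ 2 * p x)) by exact: (integrableD _ ip ix2).
apply: (integrable_dom _ _ i) => //; first exact: measurable_funM.
move=> x _; rewrite normrM (ger0_norm (p0 x)) -[X in _ <= X + _]mul1r -mulrDl.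
by apply: ler_wpM2r.
Qed.

Let mcos (u : R) : measurable_fun setT (fun x => cos (u * x)).
Proof. by apply: (measurableT_comp (@measurable_cos R)); exact: measurable_funM. Qed.
Let msin (u : R) : measurable_fun setT (fun x => sin (u * x)).
Proof. by apply: (measurableT_comp (@measurable_sin R)); exact: measurable_funM. Qed.

Let icos u : mu.-integrable setT (EFin \o (fun x => cos (u * x) * p x)).
Proof. by apply: dom => // x; apply: (le_trans (norm_cos_le1 _)); rewrite lerDl sqr_ge0. Qed.

Let absx (x : R) : `|x| <= 1 + x ^+ 2.
Proof.
rewrite -(real_normK (num_real x)); have := sqr_ge0 (`|x| - 1).
have : 0 <= `|x| by []. set a := `|x|; rewrite sqrrB1; nra.
Qed.

Let isin u : mu.-integrable setT (EFin \o (fun x => x * sin (u * x) * p x)).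
Proof.
apply: dom => [|x]; first exact: measurable_funM.
by rewrite normrM; apply: le_trans (absx x); rewrite ler_piMr// norm_sin_le1.
Qed.

Definition gaussian_cf (u : R) : R := \int[mu]_x (cos (u * x) * p x).

(** Integration by parts on [[-n, n]]; the boundary terms tend to 0. *)
Lemma gaussian_parts u : \int[mu]_x (x * sin (u * x) * p x) = u * gaussian_cf u.
Proof.
have icu : mu.-integrable setT (EFin \o (fun x => u * (cos (u * x) * p x))).
  by apply: integrable_mull => //; exact: icos.
have ib := integrableB measurableT (isin u) icu.
apply/eqP; rewrite -subr_eq0 /gaussian_cf -(RintegralZl _ measurableT (icos u)).
rewrite -(RintegralB measurableT (isin u) icu); apply/eqP.
apply: (cvg_nat_unique (Rint_exhaust ib)).
pose F (x : R) := - (p x * sin (u * x)).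
have e n : \int[mu]_(x in `[(- n%:R)%R, n%:R]) (x * sin (u * x) * p x - u * (cos (u * x) * p x)) =
    F n%:R - F (- n%:R).
  apply: Rftc2.
  - by apply: (@le_trans _ _ 0); rewrite ?oppr_le0.
  - move=> x _; have -> : F = (fun x => - (normal_peak 1 * expR (- (x ^+ 2 / 2)) * sin (u * x))).
      by apply/funext => z; rewrite /F pE.
    rewrite pE; apply: is_derive_eq; rewrite /GRing.scale/=.
    by field.
  - move=> x _; have cp : {for x, continuous p} by exact: continuous_normal_pdf (oner_neq0 _) x.
    have cu : {for x, continuous (fun x => u * x)} by apply: cvgM; [exact: cvg_cst|exact: cvg_id].
    apply: cvgB; apply: cvgM => //.
    + apply: cvgM; first exact: cvg_id.
      by apply: continuous_comp => //; exact: continuous_sin.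
    + exact: cvg_cst.
    + by apply: cvgM => //; apply: continuous_comp => //; exact: continuous_cos.
under eq_fun do rewrite e.
have le n : `|F n%:R - F (- n%:R)| <= 2 * normal_peak 1 * expR (- 2^-1 * n%:R).
  have -> : F n%:R - F (- n%:R) = - (2 * (p n%:R * sin (u * n%:R))).
    by rewrite /F mulrN sinN !pE sqrrN; ring.
  rewrite normrN normrM ger0_norm// -mulrA ler_pM2l// normrM (ger0_norm (p0 _)).
  apply: (@le_trans _ _ (p n%:R)); first by rewrite ler_piMr ?norm_sin_le1.
  rewrite pE ler_wpM2l ?normal_peak_ge0// ler_expR mulNr lerN2 mulrC ler_wpM2r//.
  by rewrite -natrX ler_nat; case: (n) => // m; rewrite expnS expn1 leq_pmulr.
apply/norm_cvg0P.
have c0 : 2 * normal_peak 1 * expR (- 2^-1 * n%:R) @[n --> \oo] --> (2 * normal_peak 1 * 0 : R).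
  by apply: cvgM; [exact: cvg_cst|apply: cvg_expN_nat; rewrite invr_gt0].
rewrite mulr0 in c0.
apply: (@squeeze_cvgr _ _ _ _ (fun=> 0) _ _ _ _ _ c0); last exact: cvg_cst.
by apply: nearW => n; rewrite normr_ge0 le.
Qed.

Lemma is_derive_gaussian_cf (u : R) : is_derive u 1 gaussian_cf (- (u * gaussian_cf u)).
Proof.
apply: (@is_derive_quadratic _ _ _ (\int[mu]_x (x ^+ 2 * p x))) => b.
have i1 : mu.-integrable setT (EFin \o (fun x => cos (b * x) * p x - cos (u * x) * p x)).
  exact: (integrableB _ (icos b) (icos u)).
have i2 : mu.-integrable setT (EFin \o (fun x => (b - u) * (x * sin (u * x) * p x))).
  by apply: integrable_mull => //; exact: isin.
have -> : gaussian_cf b - gaussian_cf u - - (u * gaussian_cf u) * (b - u) = \int[mu]_x (cos (b * x) * p x - cos (u * x) * p x + (b - u) * (x * sin (u * x) * p x)).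
  rewrite (RintegralD measurableT i1 i2) (RintegralB measurableT (icos b) (icos u)).
  by rewrite (RintegralZl _ measurableT (isin u)) gaussian_parts /gaussian_cf; ring.
rewrite mulrC -(RintegralZl _ measurableT ix2).
apply: Rint_le_norm => //.
- by apply: measurable_funD; [have /measurable_int/measurable_EFinP := i1|have /measurable_int/measurable_EFinP := i2].
- by exact: integrable_mull.
move=> x _.
have -> : cos (b * x) * p x - cos (u * x) * p x + (b - u) * (x * sin (u * x) * p x) =
   (cos (b * x) - cos (u * x) - (- sin (u * x)) * (b * x - u * x)) * p x by ring.
rewrite normrM (ger0_norm (p0 x)) mulrA; apply: ler_wpM2r => //.
by apply: (le_trans (cos_taylor _ _)); rewrite -mulrBl exprMn.
Qed.

(** The function [gaussian_cf u * e^(u^2/2)] has zero derivative. *)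
Lemma gaussian_cfE (u : R) : gaussian_cf u = expR (- (u ^+ 2 / 2)).
Proof.
pose H (v : R) := gaussian_cf v * expR (v ^+ 2 / 2).
have dH (v : R) : is_derive v 1 H 0.
  have := is_derive_gaussian_cf v => dg.
  by apply: is_derive_eq; rewrite /GRing.scale/=; field.
have H0 : H 0 = 1.
  rewrite /H expr0n/= mul0r expR0 mulr1 /gaussian_cf -pint.
  by apply: eq_Rintegral => x _; rewrite mul0r cos0 mul1r.
have : H u = H 0 by exact: is_derive_0_is_cst.
have q : expR (u ^+ 2 / 2) != 0 by rewrite gt_eqF ?expR_gt0.
by rewrite H0 /H => e; rewrite expRN; apply: (mulIf q); rewrite e mulVf.
Qed.

(** The density is even. *)
Lemma gaussian_sin (u : R) : \int[mu]_x (sin (u * x) * p x) = 0.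
Proof.
have i : mu.-integrable setT (EFin \o (fun x => sin (u * x) * p x)).
  by apply: dom => // x; apply: (le_trans (norm_sin_le1 _)); rewrite lerDl sqr_ge0.
have := Rint_reflect 0 i.
have -> : \int[mu]_x (sin (u * (0 - x)) * p (0 - x)) = -1 * \int[mu]_x (sin (u * x) * p x).
  rewrite -(RintegralZl _ measurableT i); apply: eq_Rintegral => x _.
  by rewrite sub0r mulrN sinN !pE sqrrN mulN1r mulNr.
rewrite mulN1r; lra.
Qed.

End gaussian.

(** * Characteristic function of the limit, and the theorem *)

Section mixture.
Context (R : realType) d (T : measurableType d) (Q : probability T R).
Notation mu := (@lebesgue_measure R).
Variables (Z eta : {RV Q >-> R}) (t : R).
Hypotheses (t0 : 0 < t) (Zlaw : has_law Q Z (exponential_prob t^-1))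
  (etalaw : has_law Q eta (normal_prob 0 1)) (indep : independent_RVs2 Q Z eta).

Let mZ : measurable_fun setT (Z : T -> R). Proof. exact: measurable_funPT. Qed.
Let meta : measurable_fun setT (eta : T -> R). Proof. exact: measurable_funPT. Qed.

Lemma gaussian_cos_law u : \int[Q]_w cos (u * eta w) = expR (- (u ^+ 2 / 2)).
Proof.
rewrite -gaussian_cfE /gaussian_cf.
by have [_ ->] := expect_density meta (normal_pdf_ge0 0 1) (integrable_normal_pdf 0 1) etalaw
  (bdd_meas_cos u).1 (fun x => norm_cos_le1 (u * x)).
Qed.

Lemma gaussian_sin_law u : \int[Q]_w sin (u * eta w) = 0.
Proof.
rewrite -(gaussian_sin u).
by have [_ ->] := expect_density meta (normal_pdf_ge0 0 1) (integrable_normal_pdf 0 1) etalaw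
  (bdd_meas_sin u).1 (fun x => norm_sin_le1 (u * x)).
Qed.

(** The product of [e^(-k^2 z / 2)] with the exponential density of rate [1/t] is a
    multiple of the exponential density of rate [1/t + k^2/2]. *)
Lemma exponential_laplace (k : R) : 0 <= k ->
  \int[Q]_w expR (- ((k * Num.sqrt (Z w)) ^+ 2 / 2)) = 1 / (1 + k ^+ 2 * t / 2).
Proof.
move=> k0.
have r0 : 0 < t^-1 by rewrite invr_gt0.
pose h (z : R) := expR (- ((k * Num.sqrt z) ^+ 2 / 2)).
have mh : measurable_fun setT h.
  apply: (measurableT_comp (@measurable_expR R)); apply: measurableT_comp => //.
  apply: measurable_funM => //; apply: measurable_funX; apply: measurable_funM => //.
  exact: measurable_sqrt.
have h1 z : `|h z| <= 1.
  by rewrite ger0_norm ?expR_ge0// -expR0 ler_expR oppr_le0 divr_ge0// sqr_ge0.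
have [_ ->] := expect_density mZ (fun x => exponential_pdf_ge0 (ltW r0) x)
  (integrable_exponential_pdf r0) Zlaw mh h1.
pose b := t^-1 + k ^+ 2 / 2.
have b0 : 0 < b by rewrite ltr_wpDr// divr_ge0// sqr_ge0.
have ib := integrable_exponential_pdf b0.
transitivity (\int[mu]_z (t^-1 / b * exponential_pdf b z)).
  apply: eq_Rintegral => z _.
  have [z0|z0] := leP 0 z; last by rewrite !lt0_exponential_pdf// !mulr0.
  rewrite !exponential_pdfE// /h exprMn sqr_sqrtr//.
  rewrite [RHS]mulrA divfK ?gt_eqF// mulrCA -expRD.
  by congr (_ * expR _); rewrite /b; field; rewrite gt_eqF.
rewrite (RintegralZl _ measurableT ib) /Rintegral integral_exponential_pdf// mulr1 /b.
have d0 : 0 < 1 + k ^+ 2 * t / 2 by rewrite ltr_wpDr// divr_ge0// mulr_ge0 ?sqr_ge0// ltW.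
field; rewrite !gt_eqF//.
by rewrite (_ : _ + _ = 2 * (1 + k ^+ 2 * t / 2)) ?mulr_gt0//; field.
Qed.

Variable c : R.
Let Wv (w : T) : R := c * Num.sqrt (Z w) * eta w.

Lemma measurable_mixture : measurable_fun setT Wv.
Proof.
apply: measurable_funM => //; apply: measurable_funM => //.
exact: (measurableT_comp (@measurable_sqrt R)).
Qed.

Let mixture_gen (phi : R -> R) x : measurable_fun setT phi -> (forall y, `|phi y| <= 1) ->
  \int[Q]_w phi (x * Wv w) = \int[Q]_w \int[Q]_v phi (x * c * Num.sqrt (Z w) * eta v).
Proof.
move=> mphi phi1.
have mPhi : measurable_fun setT (fun z : R * R => phi (x * c * Num.sqrt z.1 * z.2)).
  apply: (measurableT_comp mphi); apply: measurable_funM; last exact: measurable_snd.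
  by apply: measurable_funM => //; exact: (measurableT_comp (@measurable_sqrt R) measurable_fst).
rewrite -(expect_indep mZ meta indep mPhi (fun z => phi1 _)).
by apply: eq_Rintegral => w _; rewrite /Wv !mulrA.
Qed.

(** Conditionally on [Z] the mixture is Gaussian of variance [c^2 Z]. *)
Lemma mixture_cos x : \int[Q]_w cos (x * Wv w) = 1 / (1 + (x * c) ^+ 2 * t / 2).
Proof.
rewrite (mixture_gen _ (@measurable_cos R) (@norm_cos_le1 R)).
have e := exponential_laplace (normr_ge0 (x * c)).
rewrite real_normK ?num_real// in e.
rewrite -e; apply: eq_Rintegral => w _; rewrite gaussian_cos_law.
by rewrite [in LHS]exprMn [in RHS]exprMn real_normK ?num_real.
Qed.

Lemma mixture_sin x : \int[Q]_w sin (x * Wv w) = 0.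
Proof.
rewrite (mixture_gen _ (@measurable_sin R) (@norm_sin_le1 R)).
under eq_Rintegral do rewrite gaussian_sin_law.
by rewrite Rint_prob_cst.
Qed.

End mixture.

Section moments.
Context (R : realType).
Notation mu := (@lebesgue_measure R).
Variables (f : R -> R) (M : R).
Hypotheses (mf : measurable_fun setT f) (fM : forall x, `|f x| <= M)
  (fmom : (\int[mu]_x (`|x * f x|)%:E < +oo)%E).

Lemma integrable_moment : mu.-integrable setT (EFin \o (fun x => `|f x| * `|x|)).
Proof.
apply/integrableP; split.
  by apply/measurable_EFinP; apply: measurable_funM; [exact: measurableT_comp|exact: normr_measurable].
rewrite (_ : (\int[mu]_x _ = \int[mu]_x (`|x * f x|)%:E)%E)//.
by apply: eq_integral => x _; rewrite /= ger0_norm ?mulr_ge0// normrM mulrC.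
Qed.

(** Near the origin [f] is bounded, and the bound is dominated by a multiple of the
    Cauchy density of scale 1, which is at least [1/(2 pi)] there. *)
Lemma integrable_from_moment : mu.-integrable setT (EFin \o f).
Proof.
have M0 : 0 <= M by exact: le_trans (fM 0).
have ic : mu.-integrable setT (EFin \o (fun x => 2 * pi * M * cauchy 1 x)).
  by apply: integrable_mull => //; exact: integrable_cauchy.
have i : mu.-integrable setT (EFin \o (fun x => 2 * pi * M * cauchy 1 x + `|f x| * `|x|)).
  exact: (integrableD _ ic integrable_moment).
apply: (integrable_dom _ _ i) => // x _.
have p0 := @pi_gt0 R.
have c0 : 0 <= 2 * pi * M * cauchy 1 x.
  by rewrite mulr_ge0 ?cauchy_ge0// mulr_ge0// mulr_ge0// ltW.
have [x1|x1] := leP `|x| 1; last first.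
  apply: (@le_trans _ _ (`|f x| * `|x|)); last by rewrite lerDr.
  by rewrite ler_peMr// ltW.
apply: (@le_trans _ _ (2 * pi * M * cauchy 1 x)); last by rewrite lerDl mulr_ge0.
apply: (le_trans (fM x)).
have x2 : x ^+ 2 <= 1 by rewrite -(real_normK (num_real x)) expr_le1.
have q0 : 0 < 1 + x ^+ 2 by rewrite ltr_wpDr// sqr_ge0.
have -> : 2 * pi * M * cauchy 1 x = M * (2 / (1 + x ^+ 2)).
  rewrite /cauchy expr1n; move: p0 q0; generalize (pi : R) => p p0 q0; field.
  by rewrite !gt_eqF.
rewrite ler_peMr// ler_pdivlMr//; lra.
Qed.

End moments.

Theorem theorem1p2 (R : realType)
  (d : measure_display) (T : measurableType d) (P : probability T R)
  (X : R -> {RV P >-> R}) (hX : symmetric_1stable_process X)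
  (f : R -> R) (fmeas : measurable_fun [set: R] f)
  (fbnd : exists M : R, forall x, `|f x| <= M)
  (fmom : (\int[lebesgue_measure]_x (`|x * f x|)%:E < +oo)%E)
  (fint0 : Rintegral lebesgue_measure [set: R] f = 0)
  (t : R) (t_gt0 : 0 < t)
  (d' : measure_display) (T' : measurableType d') (Q : probability T' R)
  (Z eta : {RV Q >-> R})
  (* the library parametrizes the exponential law by its rate 1 / mean *)
  (Zlaw : has_law Q Z (exponential_prob t^-1))
  (etalaw : has_law Q eta (normal_prob 0 1))
  (indep : independent_RVs2 Q Z eta) :
  cvg_in_law P
    (fun n w => (Num.sqrt n%:R)^-1 *
       Rintegral lebesgue_measure `[0, expR (n%:R * t)] (fun s => f (X s w)))
    Q
    (fun w => Num.sqrt ((pi ^+ 2)^-1 *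
         Rintegral lebesgue_measure [set: R]
           (fun x => Normc.normc (fourier f x) ^+ 2 * `|x|^-1))
       * Num.sqrt (Z w) * eta w).
Proof.
have [M fM] := fbnd.
have fxi := integrable_moment fmeas fmom.
have fi := integrable_from_moment fmeas fM fmom.
set K := (pi ^+ 2)^-1 * _.
have KG : K = 2 * energy_lim f / pi.
  rewrite /K /energy_lim.
  have -> : \int[lebesgue_measure]_x (Normc.normc (fourier f x) ^+ 2 * `|x|^-1) =
      \int[lebesgue_measure]_x (spectrum f x * `|x|^-1).
    by apply: eq_Rintegral => x _; rewrite fourier_spectrum.
  have := @pi_gt0 R; generalize (pi : R) => p p0; field.
  by rewrite gt_eqF.
have K0 : 0 <= K.
  by rewrite KG divr_ge0 ?pi_ge0// mulr_ge0//; exact: (energy_lim_ge0 fmeas fM fi fxi fint0 t_gt0).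
set Y := fun n w => _; set Y' := fun w => _.
have mY n : measurable_fun setT (Y n) by exact: (measurable_occ_scaled hX fmeas t n).
have mY' : measurable_fun setT Y' by exact: (measurable_mixture Z eta (Num.sqrt K)).
have cc x : \int[P]_w cos (x * Y n w) @[n --> \oo] --> \int[Q]_w cos (x * Y' w).
  rewrite (mixture_cos t_gt0 Zlaw etalaw indep (Num.sqrt K) x).
  have -> : (x * Num.sqrt K) ^+ 2 * t / 2 = x ^+ 2 * t / pi * energy_lim f.
    rewrite exprMn sqr_sqrtr// KG.
    by have := @pi_gt0 R; generalize (pi : R) => p p0; field; rewrite gt_eqF.
  exact: (cos_limit hX fmeas fM fi fxi fint0 t_gt0).
have cs x : \int[P]_w sin (x * Y n w) @[n --> \oo] --> \int[Q]_w sin (x * Y' w).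
  rewrite (mixture_sin etalaw indep (Num.sqrt K) x).
  exact: (sin_limit hX fmeas fM fi fxi fint0 t_gt0).
split => // g cg [N gN].
have mg : measurable_fun setT g by exact: continuous_measurable_fun.
have eP n : ('E_P[g \o Y n] = (\int[P]_w g (Y n w))%:E)%E.
  rewrite unlock Rint_EFin//; apply: (@integrable_bdd _ _ _ _ _ N) => [|w]; last exact: gN.
  exact: (measurableT_comp mg (mY n)).
have eQ : ('E_Q[g \o Y'] = (\int[Q]_w g (Y' w))%:E)%E.
  rewrite unlock Rint_EFin//; apply: (@integrable_bdd _ _ _ _ _ N) => [|w]; last exact: gN.
  exact: (measurableT_comp mg mY').
rewrite eQ; under eq_fun do rewrite eP.
apply: cvg_EFin; first exact: nearW.
exact: (levy_continuity mY mY' cc cs cg gN).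
Qed.
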